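(* Let $\hat G$ be a weighted directed graph on the vertex set $\{1,\dots,N\}$ with positive edge weights which has at least one directed spanning tree. Define $$\mathrm{Vol}_{\text{upper}} := \frac{2^{N-1}}{\sqrt N}\sum_{\hat H\in\hat{\mathcal H}}\gamma(\hat H),\qquad \mathrm{Vol}_{\text{upper}}' := \frac{(2\pi)^{N-1}}{\sqrt N}\sum_{\hat T\in\hat{\mathcal{ST}}}\gamma(\hat T),$$ $$\mathrm{Vol}_{\text{lower}} := \frac{1}{\sqrt N}\sum_{\hat T\in\hat{\mathcal{ST}}}\gamma(\hat T)\sum_{i=1}^N\prod_{j\neq i} I(\deg_j(\hat T)),$$ where $I(x):=\frac12\int_0^{\pi/2}(\cos\theta+\sin\theta)^x\,d\theta$ and $\deg_j(\hat T)$ is the total degree (in-degree plus out-degree) of the vertex $j$ in the directed spanning tree $\hat T$. Then $$\mathrm{Vol}_{\text{lower}}\le \mathrm{Vol}_{\text{stable}}\le \mathrm{Vol}_{\text{locked}}\le\min\{\mathrm{Vol}_{\text{upper}},\mathrm{Vol}_{\text{upper}}'\}.$$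
   Context: **Graph.** $\hat G=(V,\hat E,\Gamma)$ is a weighted directed graph with $V=\{1,\dots,N\}$, edge set $\hat E\subseteq\{(i,j): i\ne j\in V\}$ and positive weights $\gamma_e$, $e\in\hat E$. The edge $e=(i,j)$ is directed from $i$ to $j$, and $\gamma_{ij}=\gamma_e$; set $\gamma_{ij}=0$ if $(i,j)\notin\hat E$. **Volumes.** Let $\mathbf g:\mathbb R^N\to\mathbb R^N$, $\mathbf g(\boldsymbol\theta)_i=\sum_{j\ne i}\gamma_{ij}\sin(\theta_i-\theta_j)$, and let $\mathbf J(\boldsymbol\theta)$ be the Jacobian matrix of $\mathbf g$. Let $\mathbf 1=(1,\dots,1)^\top$ and let $\mathbf P$ be an $(N-1)\times N$ matrix whose rows form an orthonormal basis of $\mathbf 1^\perp$ (an orthonormal projection onto $\mathbf 1^\perp$). Put $$\Omega_{\text{locked}}=\mathbf g(\mathbb R^N),\qquad \Omega_{\text{stable}}=\mathbf g(\Theta_{\text{stable}}),\qquad \Theta_{\text{stable}}=\{\boldsymbol\theta\in\mathbb R^N:\mathbf J(\boldsymbol\theta)>0\text{ on }\mathbf 1^\perp\},$$ where ''$\mathbf J(\boldsymbol\theta)>0$ on $\mathbf 1^\perp$'' means (linear stability modulo the direction $\mathbf 1$) that all eigenvalues of the $(N-1)\times(N-1)$ matrix $\mathbf P\mathbf J(\boldsymbol\theta)\mathbf P^\top$ have strictly positive real part. Let $\mathrm{Vol}_{\text{locked}}=|\mathbf P\,\Omega_{\text{locked}}|$ and $\mathrm{Vol}_{\text{stable}}=|\mathbf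 P\,\Omega_{\text{stable}}|$, where $|\cdot|$ is $(N-1)$-dimensional Lebesgue measure. **Directed trees.** A connected subgraph $\hat T$ of $\hat G$ is a directed tree if it has a vertex (the root) of out-degree $0$ and every other vertex of $\hat T$ has out-degree $1$ in $\hat T$. It is a directed spanning tree if it contains every vertex of $\hat G$. $\hat{\mathcal{ST}}$ is the set of directed spanning trees of $\hat G$. The weight of a directed tree is $\gamma(\hat T)=\prod_{e\in\hat E_{\hat T}}\gamma_e$ (product over its edges; the empty product is $1$). **The class $\hat{\mathcal H}$.** $\hat{\mathcal H}$ is the set of all subgraphs $\hat H$ of $\hat G$ that contain every vertex of $\hat G$ and have the form $$\hat H=\hat T\sqcup\bigsqcup_{\hat R}\hat R\bowtie_r\hat T_r,$$ i.e. $\hat H$ is the disjoint union of one directed tree $\hat T$ (possibly a single vertex) and any number (possibly zero) of graphs $\hat R\bowtie_r\hat T_r$, each consisting of a ''ring'' $\hat R$ together with, for each vertex $r$ of $\hat R$, a directed tree $\hat T_r$ (possibly just the vertex $r$) with root $r$ that meets $\hat R$ only in $r$, the trees $\hat T_r$ being pairwise disjoint. A ring $\hat R$ (a cycle on at least $3$ vertices) is of one of two types: (1) a single directed cycle, all edges pointing in the same direction around the cycle; this type is only allowed if the reversed cycle is not also contained in $\hat G$; its weight is $\gamma(\hat R)=\prod_{e\in\hat E_{\hat R}}\gamma_e$; (2) a double directed cycle, i.e. a directed cycle $\hat R_+$ together with the reversed directed cycle $\hat R_-$, both contained in $\hat G$; its weight is $\gamma(\hat R)=|\gamma(\hat R_+)-\gamma(\hat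 R_-)|$, where $\gamma(\hat R_\pm)$ is the product of the edge weights of $\hat R_\pm$. The weight of $\hat H$ is $\gamma(\hat H)=\gamma(\hat T)\prod_{\hat R}\gamma(\hat R)\prod_r\gamma(\hat T_r)$. *)

(* Defs.v *)
(* MathComp / MathComp-Analysis development. *)
From HB Require Import structures.
From mathcomp Require Import all_boot all_order all_algebra.
From mathcomp Require Import complex.
From mathcomp Require Import all_classical all_reals all_analysis.

Set Implicit Arguments.
Unset Strict Implicit.
Unset Printing Implicit Defensive.

Import Order.TTheory GRing.Theory Num.Theory.
Import numFieldNormedType.Exports.

Local Open Scope ring_scope.

Record wdigraph (R : realType) (N : nat) := WDigraph {
  edges : {set 'I_N * 'I_N};
  weight : 'I_N -> 'I_N -> R;
  edges_loopless : forall i, (i, i) \notin edges;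
  weight_gt0 : forall i j, (i, j) \in edges -> 0 < weight i j;
  weight_eq0 : forall i j, (i, j) \notin edges -> weight i j = 0
}.

(* A pair (vertex set, edge set); well-formedness is part of is_subgraph. *)
Definition graph (N : nat) : finType :=
  ({set 'I_N} * {set 'I_N * 'I_N})%type.

Definition verts (N : nat) (H : graph N) : {set 'I_N} := H.1.
Definition arcs (N : nat) (H : graph N) : {set 'I_N * 'I_N} := H.2.

Definition is_subgraph (R : realType) (N : nat) (G : wdigraph R N)
    (H : graph N) : Prop :=
  arcs H \subset edges G /\
  forall e, e \in arcs H -> e.1 \in verts H /\ e.2 \in verts H.

Definition gunion (N : nat) (H K : graph N) : graph N :=
  (verts H :|: verts K, arcs H :|: arcs K).

Definition vdisjoint (N : nat) (H K : graph N) : bool :=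
  [disjoint verts H & verts K].

Definition outdeg (N : nat) (H : graph N) (v : 'I_N) : nat :=
  #|[set e in arcs H | e.1 == v]|.

Definition indeg (N : nat) (H : graph N) (v : 'I_N) : nat :=
  #|[set e in arcs H | e.2 == v]|.

Definition deg (N : nat) (H : graph N) (v : 'I_N) : nat :=
  (indeg H v + outdeg H v)%N.

(* Connectedness ignores the direction of the edges. *)
Definition connected_graph (N : nat) (H : graph N) : Prop :=
  {in verts H &, forall x y,
    connect (fun a b => ((a, b) \in arcs H) || ((b, a) \in arcs H)) x y}.

Definition graph_weight (R : realType) (N : nat) (G : wdigraph R N)
    (H : graph N) : R :=
  \prod_(e in arcs H) weight G e.1 e.2.

Definition ditree_rooted (R : realType) (N : nat) (G : wdigraph R N)
    (r : 'I_N) (T : graph N) : Prop :=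
  [/\ is_subgraph G T, connected_graph T, r \in verts T,
      outdeg T r = 0%N &
      forall v, v \in verts T -> v != r -> outdeg T v = 1%N].

Definition ditree (R : realType) (N : nat) (G : wdigraph R N)
    (T : graph N) : Prop :=
  exists r, ditree_rooted G r T.

Definition spanning_ditree (R : realType) (N : nat) (G : wdigraph R N)
    (T : graph N) : Prop :=
  ditree G T /\ verts T = [set: 'I_N].

Definition dicycle (N : nat) (C : graph N) : Prop :=
  exists c : seq 'I_N,
    [/\ uniq c, (2 < size c)%N, verts C = [set x in c] &
        arcs C = [set (x, next c x) | x in c]].

Definition reverse (N : nat) (H : graph N) : graph N :=
  (verts H, [set (e.2, e.1) | e in arcs H]).

(* [is_ring G Q w]: Q is a ring of G and w is its weight. *)
Inductive is_ring (R : realType) (N : nat) (G : wdigraph R N) :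
    graph N -> R -> Prop :=
| ring_single C :
    dicycle C -> is_subgraph G C -> ~ is_subgraph G (reverse C) ->
    is_ring G C (graph_weight G C)
| ring_double C :
    dicycle C -> is_subgraph G C -> is_subgraph G (reverse C) ->
    is_ring G (gunion C (reverse C))
      `| graph_weight G C - graph_weight G (reverse C) |.

(* [ring_trees G K w]: K is a ring Q with a directed tree Tr r rooted at each
   of its vertices r, and w is the product of the weights of these pieces.
   Only the values of Tr on the vertices of Q matter. *)
Definition ring_trees (R : realType) (N : nat) (G : wdigraph R N)
    (K : graph N) (w : R) : Prop :=
  exists (Q : graph N) (wQ : R) (Tr : 'I_N -> graph N),
    [/\ is_ring G Q wQ,
        forall r, r \in verts Q ->
          ditree_rooted G r (Tr r) /\ verts (Tr r) :&: verts Q = [set r],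
        {in verts Q &, forall r s, r != s -> vdisjoint (Tr r) (Tr s)},
        K = (verts Q :|: \bigcup_(r in verts Q) verts (Tr r),
             arcs Q :|: \bigcup_(r in verts Q) arcs (Tr r)) &
        w = wQ * \prod_(r in verts Q) graph_weight G (Tr r)].

(* [tree_rings G H w]: H is a spanning subgraph of G which is the disjoint
   union of one directed tree T and of a finite set Ks of rings with trees,
   and w is the product of the weights of these pieces. *)
Definition tree_rings (R : realType) (N : nat) (G : wdigraph R N)
    (H : graph N) (w : R) : Prop :=
  exists (T : graph N) (Ks : {set graph N}) (wK : graph N -> R),
    [/\ ditree G T,
        forall K, K \in Ks -> ring_trees G K (wK K) /\ vdisjoint T K,
        {in Ks &, forall K L, K != L -> vdisjoint K L},
        H = (verts T :|: \bigcup_(K in Ks) verts K,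
             arcs T :|: \bigcup_(K in Ks) arcs K) &
        verts H = [set: 'I_N] /\
        w = graph_weight G T * \prod_(K in Ks) wK K].

Local Open Scope classical_set_scope.

Definition ST (R : realType) (N : nat) (G : wdigraph R N) : set (graph N) :=
  [set T | spanning_ditree G T].

Definition calH (R : realType) (N : nat) (G : wdigraph R N) : set (graph N) :=
  [set H | exists w, tree_rings G H w].

(* The weight of H in calH.  The pieces of H are determined by H (they are its
   connected components, each containing at most one ring), so exactly one w
   satisfies tree_rings G H w and xget returns it. *)
Definition calH_weight (R : realType) (N : nat) (G : wdigraph R N)
    (H : graph N) : R :=
  xget 0 [set w | tree_rings G H w].

(* n-dimensional Lebesgue measure as an iterated product measure. *)
Fixpoint lebesgue_tuple (R : realType) (n : nat) :
    set (n.-tuple (measurableTypeR R)) -> \bar R :=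
  match n with
  | 0 => dirac [tuple]
  | n'.+1 =>
      pushforward (lebesgue_measure \x @lebesgue_tuple R n')%E
        (fun xt : measurableTypeR R * n'.-tuple (measurableTypeR R) =>
           [tuple of xt.1 :: xt.2])
  end.

Definition lebesgue_rV (R : realType) (n : nat) (A : set 'rV[R]_n) : \bar R :=
  lebesgue_tuple
    [set t : n.-tuple (measurableTypeR R) | A (\row_i (tnth t i : R))].

(* Vectors are row vectors, so that the library's Jacobian applies. *)
Definition gmap (R : realType) (N : nat) (G : wdigraph R N)
    (theta : 'rV[R]_N) : 'rV[R]_N :=
  \row_i \sum_(j < N | j != i)
    weight G i j * sin (theta ord0 i - theta ord0 j).

(* The library's jacobian acts on row vectors from the right; its transpose
   has entries d g_i / d theta_j. *)
Definition Jmx (R : realType) (N : nat) (G : wdigraph R N)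
    (theta : 'rV[R]_N) : 'M[R]_N :=
  (jacobian (gmap G) theta)^T.

(* The row space of kermx (const_mx 1) is the orthogonal of (1, ..., 1). *)
Definition orthonormal_projection (R : realType) (N : nat)
    (P : 'M[R]_(N.-1, N)) : Prop :=
  P *m P^T = 1%:M /\ (P :=: kermx (const_mx 1 : 'cV[R]_N))%MS.

Definition Theta_stable (R : realType) (N : nat) (G : wdigraph R N)
    (P : 'M[R]_(N.-1, N)) : set 'rV[R]_N :=
  [set theta | forall z : R[i],
     eigenvalue (map_mx (real_complex R) (P *m Jmx G theta *m P^T)) z ->
     0 < complex.Re z].

Definition Omega_locked (R : realType) (N : nat) (G : wdigraph R N) :
    set 'rV[R]_N :=
  range (gmap G).

Definition Omega_stable (R : realType) (N : nat) (G : wdigraph R N)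
    (P : 'M[R]_(N.-1, N)) : set 'rV[R]_N :=
  gmap G @` Theta_stable G P.

(* On row vectors, y |-> P y reads y |-> y *m P^T. *)
Definition proj_vol (R : realType) (N : nat) (P : 'M[R]_(N.-1, N))
    (A : set 'rV[R]_N) : \bar R :=
  lebesgue_rV [set y *m P^T | y in A].

Definition Vol_locked (R : realType) (N : nat) (G : wdigraph R N)
    (P : 'M[R]_(N.-1, N)) : \bar R :=
  proj_vol P (Omega_locked G).

Definition Vol_stable (R : realType) (N : nat) (G : wdigraph R N)
    (P : 'M[R]_(N.-1, N)) : \bar R :=
  proj_vol P (Omega_stable G P).

Definition Iint (R : realType) (x : nat) : R :=
  2^-1 * \int[lebesgue_measure]_(t in `[0, pi / 2]) (cos t + sin t) ^+ x.

Definition Vol_upper (R : realType) (N : nat) (G : wdigraph R N) : R :=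
  2 ^+ N.-1 / Num.sqrt N%:R * \sum_(H in calH G) calH_weight G H.

Definition Vol_upper' (R : realType) (N : nat) (G : wdigraph R N) : R :=
  (2 * pi) ^+ N.-1 / Num.sqrt N%:R * \sum_(T in ST G) graph_weight G T.

Definition Vol_lower (R : realType) (N : nat) (G : wdigraph R N) : R :=
  (Num.sqrt N%:R)^-1 *
  \sum_(T in ST G) graph_weight G T *
    \sum_(i < N) \prod_(j < N | j != i) Iint R (deg T j).

(* Main.v *)
(* Modulo the direction (1, ..., 1), the frequency map is
   theta |-> sum over pairs a < b of sin(theta_a - theta_b) (w_ab e_a - w_ba e_b),
   so its range lies in the zonotope spanned by these vectors, whose volume is
   at most 2^n/n! times the sum of the absolute values of the n x n minors.  A
   non-zero minor uses every vertex but one exactly once, hence comes from a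
   functional graph; its determinant splits into a tree and cycles and is the
   weight of an element of calH.  This gives Vol_upper.

   Fixing the phase of one vertex turns the map into one between n-dimensional
   spaces whose Jacobian determinant is, by the matrix-tree theorem, the sum
   over spanning trees of the products of w_e cos(theta_e1 - theta_e2), up to
   1/sqrt N.  Linearizing it on the cells of a fine grid of the torus bounds the
   volume of the range by Vol_upper'.

   For the lower bound, pin a vertex i at 0 and let the other phases range over
   (0, pi/2).  All these phase vectors are stable, and a maximum principle shows
   that they have pairwise distinct images, also for different i.  By a
   contraction argument the image of a grid cell is almost as large as the
   Jacobian determinant predicts.  The resulting Riemann sum of products of
   cosines over a tree is computed exactly: in
   2 cos(a - b) = (cos a + sin a)(cos b + sin b) + (sin a - cos a)(sin b - cos b)
   the last product changes sign under the reflections x |-> pi/2 - x of single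
   coordinates, and only the first one survives averaging. *)

Require Import Defs.
From HB Require Import structures.
From mathcomp Require Import all_boot all_order all_algebra.
From mathcomp Require Import all_fingroup complex ring lra zify.
From mathcomp Require Import all_classical all_reals all_analysis measurable_realfun.

Set Implicit Arguments.
Unset Strict Implicit.
Unset Printing Implicit Defensive.

Import Order.TTheory GRing.Theory Num.Theory.
Import numFieldNormedType.Exports.

Local Open Scope ring_scope.

(** * Functional graphs and the matrix-tree theorem *)

(** The range and the stable image are never shown to be measurable. [lebesgue_rV] is an iterated
    integral, defined and monotone on all sets, so these images are only compared with compact sets
    and finite unions of such: zonotopes from above, images of closed cubes from below. Both upper
    bounds rest on the same zonotope estimate. Its denominator n! cancels against the orderings of
    the n vertex pairs of an element of [calH] in one case, and against the orderings of the n
    Jacobian rows on a grid cell in the other. No change of variables is needed, and critical points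
    require no separate treatment. For the lower bound the obstacle is that the Jacobian determinant
    may tend to 0 at the boundary of the region, while the cells on which the contraction works
    shrink with it. Cells with determinant below a threshold e are therefore discarded, at a total
    cost proportional to e. The cells are also shrunk by a factor q < 1, to keep closed cubes
    disjoint. The mesh goes to 0 with e and q fixed, then e goes to 0, then q to 1. Cell midpoints
    are used because the reflections permute them, so that the averaging is exact already for the
    finite sums. *)

Section FunctionalMatrix.
Variables (R : comNzRingType) (N : nat).
Implicit Types (a b : 'I_N -> R) (phi : 'I_N -> 'I_N) (X U W : {set 'I_N}).

(** Vertices outside [X] get identity rows, so all subsets share the format N x N. With a_v the
    weight of v -> phi v and b_v that of phi v -> v, row v is up to sign the vector by which the
    pair {v, phi v} enters the frequency map. *)
Definition fmx a b phi X : 'M[R]_N :=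
  \matrix_(v, u) if v \in X then a v *+ (v == u) - b v *+ (phi v == u)
                 else (v == u)%:R.

Lemma fmx_set0 a b phi : fmx a b phi finset.set0 = 1%:M.
Proof. by apply/matrixP => v u; rewrite !mxE inE. Qed.

(** Row v of the product, for v in [U], only involves the rows v and phi v of the second factor, and
    these are identity rows since neither vertex lies in [W]. This is the splitting of a block
    triangular determinant. *)
Lemma fmxU a b phi U W : [disjoint U & W] -> (forall v, v \in U -> phi v \notin W) ->
  fmx a b phi (U :|: W) = fmx a b phi U *m fmx a b phi W.
Proof.
move=> UW UphiW; apply/matrixP => v u; rewrite !mxE finset.in_setU.
under eq_bigr do rewrite !mxE.
case: (boolP (v \in U)) => vU /=; last first.
  by rewrite (bigD1 v)//= eqxx mul1r big1 ?addr0// => k; rewrite eq_sym => /negbTE ->; rewrite mul0r.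
have vW : v \notin W by rewrite (disjointFr UW).
have pW := UphiW v vU.
have sumE (F : 'I_N -> R) c w : \sum_k c *+ (w == k) * F k = c * F w.
  rewrite (bigD1 w)//= eqxx big1 ?addr0// => k.
  by rewrite eq_sym => /negbTE ->; rewrite mul0r.
under eq_bigr do rewrite mulrBl.
by rewrite sumrB !sumE (negbTE vW) (negbTE pW) !mulr_natr.
Qed.

(** Row v reduced to a unit row e_z. Expanding row v leaves z = phi v; moving z along the orbit then
    traces the cycle through v. *)
Definition gmx a b phi X v z : 'M[R]_N :=
  \matrix_(w, u) if w == v then (z == u)%:R else fmx a b phi X w u.

Lemma gmx_setD1 a b phi X v z : gmx a b phi (X :\ v) v z = gmx a b phi X v z.
Proof.
apply/matrixP => w u; rewrite !mxE in_setD1.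
by case: (w == v).
Qed.

Lemma gmx_diag a b phi X v : gmx a b phi X v v = fmx a b phi (X :\ v).
Proof.
apply/matrixP => w u; rewrite !mxE in_setD1; case: eqP => //= -> //.
Qed.

Lemma det_fmx_row a b phi X v : v \in X ->
  \det (fmx a b phi X) = a v * \det (fmx a b phi (X :\ v)) -
                         b v * \det (gmx a b phi X v (phi v)).
Proof.
move=> vX; rewrite -mulNr -gmx_diag.
apply: (determinant_multilinear (i0 := v)).
- by apply/rowP => u; rewrite !mxE eqxx vX mulr_natr mulNr mulr_natr.
- by apply/matrixP => w u; rewrite !mxE eq_sym (negbTE (neq_lift _ _)).
- by apply/matrixP => w u; rewrite !mxE eq_sym (negbTE (neq_lift _ _)).
Qed.

Lemma det_gmx_notin a b phi X v z : z \notin X -> z != v -> \det (gmx a b phi X v z) = 0.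
Proof.
move=> zX zv; apply: (determinant_alternate (i1 := v) (i2 := z)); first by rewrite eq_sym.
by move=> u; rewrite !mxE eqxx (negbTE zv) (negbTE zX).
Qed.

(** Row z is a_z e_z - b_z e_(phi z). The first term repeats row v. In the second, exchanging rows v
    and z moves the unit row on to phi z and turns row z into an identity row; the sign of the
    exchange cancels the minus. *)
Lemma det_gmx_in a b phi X v z : z \in X -> z != v ->
  \det (gmx a b phi X v z) = b z * \det (gmx a b phi (X :\ z) v (phi z)).
Proof.
move=> zX zv.
pose A y1 y2 : 'M[R]_N := \matrix_(w, u) if w == v then (y1 == u)%:R else
  if w == z then (y2 == u)%:R else fmx a b phi X w u.
have -> : gmx a b phi (X :\ z) v (phi z) = A (phi z) z.
  by apply/matrixP => w u; rewrite !mxE !inE; case: eqP => // _; case: eqP => //= ->.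
have A0 : \det (A z z) = 0.
  apply: (determinant_alternate (i1 := v) (i2 := z)); first by rewrite eq_sym.
  by move=> u; rewrite !mxE eqxx (negbTE zv) eqxx.
have -> : \det (gmx a b phi X v z) = a z * \det (A z z) + (- b z) * \det (A z (phi z)).
  apply: (determinant_multilinear (i0 := z)).
  - by apply/rowP => u; rewrite !mxE (negbTE zv) eqxx zX mulr_natr mulNr mulr_natr.
  - by apply/matrixP => w u; rewrite !mxE [lift _ _ == z]eq_sym (negbTE (neq_lift _ _)).
  - by apply/matrixP => w u; rewrite !mxE [lift _ _ == z]eq_sym (negbTE (neq_lift _ _)).
rewrite A0 mulr0 add0r.
have -> : A z (phi z) = xrow v z (A (phi z) z).
  apply/matrixP => w u; rewrite !mxE.
  have [->|wv] := eqVneq w v; first by rewrite tpermL (negbTE zv) eqxx.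
  have [->|wz] := eqVneq w z; first by rewrite tpermR eqxx.
  by rewrite tpermD 1?eq_sym// (negbTE wv) (negbTE wz).
by rewrite xrowE det_mulmx det_perm odd_tperm eq_sym zv expr1 mulN1r mulrNN.
Qed.

(** The last vertex v that an orbit visits before it first leaves [X] maps outside [X], so it splits
    off as a factor with determinant a_v. *)
Lemma det_fmx_acyclic a b phi X :
  (forall v, v \in X -> exists k, iter k phi v \notin X) ->
  \det (fmx a b phi X) = \prod_(v in X) a v.
Proof.
have [n] := ubnP #|X|; elim: n X => // n IH X; rewrite ltnS => Xn hX.
have [->|[v0 v0X]] := set_0Vmem X; first by rewrite fmx_set0 det1 big_set0.
have [v vX vN] : exists2 v, v \in X & phi v \notin X.
  have exk : exists k, iter k phi v0 \notin X := hX v0 v0X.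
  case: (ex_minnP exk) => -[|k] /=; first by rewrite v0X.
  move=> kN kmin; exists (iter k phi v0) => //.
  by apply/negPn/negP => /kmin; rewrite ltnn.
have e : X = [set v] :|: (X :\ v) by rewrite finset.setD1K.
rewrite {1}e fmxU; last 2 first.
- by rewrite disjoints1 !inE eqxx.
- by move=> w /set1P ->; rewrite !inE negb_and vN orbT.
rewrite det_mulmx (IH (X :\ v)); last 2 first.
- by rewrite (cardsD1 v X) vX in Xn.
- move=> w; rewrite inE => /andP[_ /hX[k kN]]; exists k.
  by rewrite !inE negb_and kN orbT.
rewrite [RHS](bigD1 v)//=; congr (_ * _); last by apply: eq_bigl => w; rewrite !inE andbC.
have vv : phi v != v by apply: contraNneq vN => ->.
rewrite (@det_fmx_row _ _ _ _ v) ?inE// finset.setDv fmx_set0 det1 mulr1.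
by rewrite det_gmx_notin ?mulr0 ?subr0 ?inE.
Qed.

Lemma det_gmx_path a b phi v z s : uniq (v :: z :: s) -> fpath phi z s ->
  phi (last z s) = v ->
  \det (gmx a b phi [set x in z :: s] v z) = \prod_(x <- z :: s) b x.
Proof.
elim: s z => [|y s IH] z.
  rewrite /= !inE => /andP[vz _] _ pz.
  rewrite det_gmx_in ?inE ?eqxx 1?eq_sym//.
  rewrite pz gmx_diag big_seq1.
  rewrite (_ : _ :\ _ :\ _ = finset.set0) ?fmx_set0 ?det1 ?mulr1//.
  by apply/setP => x; rewrite !inE; case: (x == z); rewrite ?andbF.
move=> /= /andP[vn /andP[zn uys]] /andP[/eqP pz ps] lst.
have vz : v != z by apply: contraNneq vn => ->; rewrite inE eqxx.
rewrite det_gmx_in ?inE ?eqxx//; last by rewrite eq_sym.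
rewrite big_cons pz -IH//; last first.
  by rewrite /= uys andbT; apply: contra vn; rewrite !inE => ->; rewrite orbT.
congr (_ * \det (gmx _ _ _ _ _ _)); apply/setP => x; rewrite !inE.
have [->|//] := eqVneq x z; rewrite /= .
by rewrite inE in zn; rewrite (negbTE zn).
Qed.

(** In the row of one vertex v, keeping a_v opens the cycle and leaves an acyclic set, while keeping
    b_v forces every other vertex to contribute its b. The minus sign is the same for all
    lengths. *)
Lemma det_fmx_cycle a b phi c : uniq c -> fcycle phi c -> c != [::] ->
  \det (fmx a b phi [set x in c]) = \prod_(x in c) a x - \prod_(x in c) b x.
Proof.
case: c => // v s uc cc _.
rewrite -!big_uniq//= !big_cons.
rewrite (@det_fmx_row _ _ _ _ v) ?inE ?eqxx//.
have sE : [set x in v :: s] :\ v = [set x in s].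
  apply/setP => x; rewrite !inE; have [->|//] := eqVneq x v.
  by case/andP: uc => /negbTE ->.
congr (_ * _ - _ * _).
  rewrite sE det_fmx_acyclic.
    by rewrite big_uniq; [apply: eq_bigl => x; rewrite inE|case/andP: uc].
  move=> x; rewrite inE => xs.
  have xc : x \in v :: s by rewrite inE xs orbT.
  exists (findex phi x v); rewrite iter_findex.
    by rewrite inE; case/andP: uc.
  by apply: (connect_cycle cc) => //; rewrite inE eqxx.
case: s uc cc sE => [|z s] uc cc sE.
  have /= := cc; rewrite andbT => /eqP pv.
  rewrite pv gmx_diag sE big_nil (_ : [set x in [::]] = finset.set0).
    by rewrite fmx_set0 det1.
  by apply/setP => x; rewrite !inE.
move: (cc); rewrite /= rcons_path => /andP[/eqP pz /andP[ps /eqP lst]].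
by rewrite -gmx_setD1 sE pz det_gmx_path.
Qed.

End FunctionalMatrix.

Lemma det_sum_rows (R : comNzRingType) N (c : 'I_N -> 'I_N -> R)
    (M : 'I_N -> 'I_N -> 'I_N -> R) :
  \det (\matrix_(a, u) \sum_b c a b * M a b u) =
  \sum_(phi : {ffun 'I_N -> 'I_N})
    (\prod_a c a (phi a)) * \det (\matrix_(a, u) M a (phi a) u).
Proof.
rewrite /determinant.
under eq_bigr do under eq_bigr do rewrite mxE.
under eq_bigr do rewrite bigA_distr_bigA /= mulr_sumr.
rewrite exchange_big /=; apply: eq_bigr => phi _.
rewrite mulr_sumr; apply: eq_bigr => s _.
rewrite big_split /= mulrCA; congr (_ * (_ * _)).
by apply: eq_bigr => a _; rewrite mxE.
Qed.

Section MatrixTree.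
Variables (R : fieldType) (N : nat).

Definition laplacian (w : 'I_N -> 'I_N -> R) : 'M[R]_N :=
  \matrix_(a, u) \sum_b w a b * ((a == u)%:R - (b == u)%:R).

Definition set_row (A : 'M[R]_N) (r : 'I_N) (v : 'I_N -> R) : 'M[R]_N :=
  \matrix_(a, u) if a == r then v u else A a u.

Definition rooted_fun (r : 'I_N) (phi : {ffun 'I_N -> 'I_N}) : bool :=
  (phi r == r) && [forall v, fconnect phi v r].

(** If some vertex misses r, the indicator of the vertices that never reach r is constant along
    [phi] and 0 at r, hence a non-zero vector in the kernel. *)
Lemma det_fmx_rooted (r : 'I_N) (phi : {ffun 'I_N -> 'I_N}) : phi r = r ->
  \det (fmx (fun=> 1 : R) (fun=> 1) phi (~: [set r])) = (rooted_fun r phi)%:R.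
Proof.
move=> pr; rewrite /rooted_fun pr eqxx /=.
case: (boolP [forall v, _]) => [/forallP conn|].
  rewrite det_fmx_acyclic ?big1// => v _.
  by exists (findex phi v r); rewrite iter_findex// !inE eqxx.
rewrite negb_forall => /existsP[v0 v0r]; apply/eqP.
rewrite -det_tr; apply/det0P.
exists (\row_v (~~ fconnect phi v r)%:R).
  by apply/eqP => /rowP/(_ v0); rewrite !mxE v0r; apply/eqP; exact: oner_neq0.
have fc v : fconnect phi (phi v) r -> fconnect phi v r.
  by apply: connect_trans; exact: fconnect1.
have cf v : v != r -> fconnect phi v r -> fconnect phi (phi v) r.
  move=> vr vc; have := iter_findex vc; case: (findex phi v r) => [/= vE|k].
    by rewrite vE eqxx in vr.
  by rewrite iterSr => <-; exact: fconnect_iter.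
apply/rowP => v; rewrite !mxE.
under eq_bigr do rewrite !mxE !inE.
have [->|vr] := eqVneq v r.
  rewrite /= (bigD1 r)//= eqxx connect0 mul0r big1 ?addr0// => k kr.
  by rewrite eq_sym (negbTE kr) mulr0.
rewrite /=.
under eq_bigr do rewrite mulrBr.
rewrite sumrB (bigD1 v)//= eqxx mulr1 big1 => [|k]; last first.
  by rewrite eq_sym => /negbTE ->; rewrite mulr0.
rewrite addr0 (bigD1 (phi v))//= eqxx mulr1 big1 => [|k]; last first.
  by rewrite eq_sym => /negbTE ->; rewrite mulr0.
rewrite addr0; apply/eqP; rewrite subr_eq0; apply/eqP; congr ((~~ _)%:R).
by apply/idP/idP; [exact: cf|exact: fc].
Qed.

Lemma matrix_tree (w : 'I_N -> 'I_N -> R) (r : 'I_N) :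
  \det (set_row (laplacian w) r (fun u => (r == u)%:R)) =
  \sum_(phi | rooted_fun r phi) \prod_(a | a != r) w a (phi a).
Proof.
(* Row r is written with coefficients that vanish unless b = r, so only maps fixing r survive the
   expansion over all [phi]. *)
pose c a b := if a == r then (b == r)%:R else w a b.
pose M a b u : R := if a == r then (r == u)%:R else (a == u)%:R - (b == u)%:R.
have -> : set_row (laplacian w) r (fun u => (r == u)%:R) =
    \matrix_(a, u) \sum_b c a b * M a b u.
  apply/matrixP => a u; rewrite !mxE /c /M; case: eqP => // ar.
  by rewrite (bigD1 r)//= eqxx mul1r big1 ?addr0// => b /negbTE ->; rewrite mul0r.
rewrite det_sum_rows [RHS]big_mkcond /=; apply: eq_bigr => phi _.
rewrite (bigD1 r)//= {1}/c eqxx.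
have [pr|pr] := eqVneq (phi r) r; last by rewrite !mul0r /rooted_fun (negbTE pr).
rewrite mul1r.
have -> : \matrix_(a, u) M a (phi a) u = fmx (fun=> 1 : R) (fun=> 1) phi (~: [set r]).
  by apply/matrixP => a u; rewrite !mxE !inE /M; case: eqP => // ->.
rewrite det_fmx_rooted//; case: ifP => _; last by rewrite mulr0.
by rewrite mulr1; apply: eq_bigr => a ar; rewrite /c (negbTE ar).
Qed.

Lemma det_row_sum0 (A : 'M[R]_N) (i : 'I_N) : (forall a, \sum_u A a u = 0) -> \det A = 0.
Proof.
move=> hA; rewrite -det_tr; apply/eqP/det0P; exists (const_mx 1).
  by apply/eqP => /rowP/(_ i); rewrite !mxE; apply/eqP; exact: oner_neq0.
apply/rowP => a; rewrite !mxE -[RHS](hA a).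
by apply: eq_bigr => u _; rewrite !mxE mul1r.
Qed.

Lemma laplacian_row_sum w a : \sum_u laplacian w a u = 0.
Proof.
under eq_bigr do rewrite mxE.
rewrite exchange_big/= big1// => b _; rewrite -mulr_sumr sumrB.
have s c : \sum_(i < N) (c == i)%:R = 1 :> R.
  by rewrite (bigD1 c)//= eqxx big1 ?addr0// => i; rewrite eq_sym => /negbTE ->.
by rewrite !s subrr mulr0.
Qed.

Lemma cofactor_set_row (A : 'M[R]_N) r i :
  cofactor A r i = \det (set_row A r (fun u => (i == u)%:R)).
Proof.
rewrite (expand_det_row _ r) (bigD1 i)//= !mxE !eqxx mul1r big1 ?addr0.
  congr (_ * \det _); apply/matrixP => x y; rewrite !mxE.
  by rewrite eq_sym (negbTE (neq_lift _ _)).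
by move=> j; rewrite !mxE eqxx eq_sym => /negbTE ->; rewrite mul0r.
Qed.

(** The difference of the two cofactors is the determinant with row r replaced by e_i - e_r, a
    matrix all of whose rows sum to 0. *)
Lemma cofactor_row_sum0 (A : 'M[R]_N) r i : (forall a, \sum_u A a u = 0) ->
  cofactor A r i = cofactor A r r.
Proof.
move=> hA; apply/eqP; rewrite -subr_eq0 !cofactor_set_row; apply/eqP.
pose B := set_row A r (fun u => (i == u)%:R - (r == u)%:R).
have <- : \det B = 0.
  apply: (det_row_sum0 r) => a; rewrite /B.
  under eq_bigr do rewrite mxE.
  have [_|_] := eqVneq a r; last exact: hA.
  have s c : \sum_(i < N) (c == i)%:R = 1 :> R.
    by rewrite (bigD1 c)//= eqxx big1 ?addr0// => j; rewrite eq_sym => /negbTE ->.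
  by rewrite sumrB !s subrr.
apply/esym; rewrite -[X in _ - X]mul1r -mulNr -[X in X + _]mul1r.
apply: (determinant_multilinear (i0 := r)).
- by apply/rowP => u; rewrite !mxE eqxx mul1r mulN1r.
- by apply/matrixP => x u; rewrite !mxE eq_sym (negbTE (neq_lift _ _)).
- by apply/matrixP => x u; rewrite !mxE eq_sym (negbTE (neq_lift _ _)).
Qed.

(** Expanding along the column of ones gives the cofactors of column i. Each equals the principal
    cofactor of its row r, which enumerates the trees rooted at r; so all roots are collected at
    once. *)
Lemma det_laplacian_col1 (w : 'I_N -> 'I_N -> R) (i : 'I_N) :
  \det (\matrix_(a, u) if u == i then 1 else laplacian w a u) =
  \sum_r \sum_(phi | rooted_fun r phi) \prod_(a | a != r) w a (phi a).
Proof.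
rewrite (expand_det_col _ i); apply: eq_bigr => r _.
rewrite mxE eqxx mul1r -matrix_tree -cofactor_set_row.
rewrite -(@cofactor_row_sum0 _ r i); last exact: laplacian_row_sum.
congr (_ * \det _); apply/matrixP => x y; rewrite !mxE.
by rewrite eq_sym (negbTE (neq_lift _ _)).
Qed.

End MatrixTree.

(** * Projection along (1, ..., 1) and the factor 1 / sqrt N *)

Section Projection.
Local Open Scope classical_set_scope.
Local Open Scope ring_scope.
Variables (R : realType) (n : nat) (P : 'M[R]_(n, n.+1)).
Hypothesis hP : @orthonormal_projection R n.+1 P.

Let ones : 'rV[R]_n.+1 := const_mx 1.

Lemma projection_orth : P *m P^T = 1%:M.
Proof. by case: hP. Qed.

Lemma projection_ones : P *m ones^T = 0.
Proof.
have [_ Pk] := hP; rewrite trmx_const; apply/sub_kermxP.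
have : (P <= kermx (const_mx 1 : 'cV[R]_n.+1))%MS by rewrite Pk.
done.
Qed.

Lemma ones_projection : ones *m P^T = 0.
Proof. by rewrite -[LHS]trmxK trmx_mul trmxK projection_ones trmx0. Qed.

Lemma projection_ker (y : 'rV[R]_n.+1) : y *m P^T = 0 -> exists c, y = c *: ones.
Proof.
move=> yP; pose c := (\sum_i y 0 i) / n.+1%:R; exists c.
have N0 : n.+1%:R != 0 :> R by rewrite pnatr_eq0.
have [_ Pk] := hP.
have : (y - c *: ones <= kermx (const_mx 1 : 'cV[R]_n.+1))%MS.
  apply/sub_kermxP/matrixP => i j; rewrite (ord1 i) !mxE.
  under eq_bigr do rewrite !mxE mulr1.
  rewrite -mulr_suml mulr1 sumrB sumr_const card_ord /c -[_ *+ n.+1]mulr_natr divfK//.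
  by rewrite subrr.
rewrite -Pk => /submxP[u uE].
have : (y - c *: ones) *m P^T = u by rewrite uE -mulmxA projection_orth mulmx1.
rewrite mulmxBl yP -scalemxAl ones_projection scaler0 subr0 => u0.
by apply/eqP; rewrite -subr_eq0 uE -u0 mul0mx.
Qed.

(** [P] together with ones / sqrt N is an orthogonal matrix. Multiplying the bordered matrix by its
    transpose makes it block triangular with corner sqrt N. Every 1 / sqrt N in the volumes comes
    from here. *)
Lemma det_projection (W : 'M[R]_(n, n.+1)) :
  `|\det (W *m P^T)| = `|\det (col_mx ones W : 'M[R]_(1 + n))| / Num.sqrt n.+1%:R.
Proof.
have s0 : 0 < Num.sqrt n.+1%:R :> R by rewrite sqrtr_gt0.
have ss : Num.sqrt n.+1%:R * Num.sqrt n.+1%:R = n.+1%:R :> R by rewrite -expr2 sqr_sqrtr.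
pose c : 'rV[R]_n.+1 := (Num.sqrt n.+1%:R)^-1 *: ones.
pose O : 'M[R]_(1 + n) := col_mx c P.
have oo : ones *m ones^T = n.+1%:R%:M.
  apply/matrixP => i j; rewrite !ord1 !mxE.
  under eq_bigr do rewrite !mxE mulr1.
  by rewrite sumr_const card_ord eqxx mulr1n.
have OO : O *m O^T = 1%:M.
  rewrite /O tr_col_mx mul_col_row projection_orth.
  rewrite /c linearZ/= -!scalemxAl -!scalemxAr projection_ones ones_projection !scaler0 oo.
  rewrite scalerA scale_scalar_mx -invfM ss mulVf ?pnatr_eq0//.
  by rewrite -scalar_mx_block.
have detO : `|\det O^T| = 1.
  have : \det O * \det O = 1.
    by rewrite -{2}(det_tr O) -det_mulmx OO det1.
  move=> h; rewrite det_tr; apply/eqP; rewrite -(@eqrXn2 _ 2)//.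
  by rewrite -normrX expr2 h normr1 expr1n.
have : \det (col_mx ones W *m O^T : 'M[R]_(1 + n)) = Num.sqrt n.+1%:R * \det (W *m P^T).
  rewrite /O tr_col_mx mul_col_row ones_projection det_lblock.
  congr (_ * _); rewrite /c linearZ/= -scalemxAr oo scale_scalar_mx det_scalar1.
  by rewrite -{2}ss mulrA mulVf ?mul1r// gt_eqF.
rewrite det_mulmx => /(congr1 Num.norm); rewrite !normrM detO mulr1 => ->.
by rewrite (gtr0_norm s0) mulrAC divff ?mul1r// gt_eqF.
Qed.

End Projection.

Section OnesExpansion.
Local Open Scope classical_set_scope.
Local Open Scope ring_scope.
Variables (R : realType) (n : nat).
Let ones : 'rV[R]_n.+1 := const_mx 1.

Lemma det_ones_expand (W : 'M[R]_(n, n.+1)) :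
  \det (col_mx ones W : 'M[R]_(1 + n)) = \sum_(i < n.+1) (-1) ^+ i * \det (col' i W).
Proof.
rewrite (expand_det_row _ ord0); apply: eq_bigr => i _.
have -> : (col_mx ones W : 'M[R]_(1 + n)) ord0 i = 1.
  by rewrite (_ : ord0 = lshift n (ord0 : 'I_1)) ?col_mxEu ?mxE//; apply/val_inj.
rewrite mul1r /cofactor add0n; congr (_ * \det _).
apply/matrixP => x y; rewrite !mxE.
have -> : lift ord0 x = rshift 1 x by apply/val_inj.
by rewrite (unsplitK (inr x)).
Qed.

Lemma det_ones_le (W : 'M[R]_(n, n.+1)) :
  `|\det (col_mx ones W : 'M[R]_(1 + n))| <= \sum_i `|\det (col' i W)|.
Proof.
rewrite det_ones_expand (le_trans (ler_norm_sum _ _ _))//.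
by apply: ler_sum => i _; rewrite normrM normrX normrN1 expr1n mul1r.
Qed.

(** After transposition the column of ones stands in front instead of at place i, which accounts for
    the sign. *)
Lemma det_ones_col1 (L : 'M[R]_n.+1) (i : 'I_n.+1) :
  \det (col_mx ones (row' i L^T) : 'M[R]_(1 + n)) =
  (-1) ^+ i * \det (\matrix_(a, u) if u == i then 1 else L a u).
Proof.
rewrite det_ones_expand (expand_det_col _ i) mulr_sumr; apply: eq_bigr => a _.
rewrite mxE eqxx mul1r /cofactor exprD.
have key (x y d : R) : x * x = 1 -> x * (y * x * d) = y * d.
  by move=> xx; rewrite mulrA (mulrC y) mulrA xx mul1r.
rewrite key; last by rewrite -expr2 sqrr_sign.
congr (_ * _); rewrite -det_tr; congr (\det _); apply/matrixP => x y; rewrite !mxE.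
by rewrite [_ == i]eq_sym (negbTE (neq_lift _ _)).
Qed.

End OnesExpansion.

(** * Spanning trees as rooted functions *)

Section Trees.
Local Open Scope classical_set_scope.
Local Open Scope ring_scope.
Variables (R : realType) (N : nat) (G : wdigraph R N).

(** The default value [v] makes the root a fixed point, so that reaching the root becomes [fconnect]
    to a fixed point. *)
Definition outf (T : graph N) (v : 'I_N) : 'I_N :=
  if [pick u | (v, u) \in arcs T] is Some u then u else v.

Lemma outdeg0 (T : graph N) v u : outdeg T v = 0%N -> (v, u) \notin arcs T.
Proof.
move=> /eqP; rewrite cards_eq0 => /eqP/setP/(_ (v, u)).
by rewrite !inE /= eqxx andbT => ->.
Qed.

Lemma outdeg1 (T : graph N) v u : outdeg T v = 1%N ->
  ((v, u) \in arcs T) = (u == outf T v).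
Proof.
move=> /eqP/cards1P[[x y] E].
have mem z : ((v, z) \in arcs T) = ((v, z) == (x, y)).
  by have /setP/(_ (v, z)) := E; rewrite !inE/= eqxx andbT.
have vx : v = x.
  by have /setP/(_ (x, y)) := E; rewrite !inE/= eqxx => /andP[_ /eqP].
rewrite /outf; case: pickP => [z|h]; last first.
  by have := h y; rewrite mem -vx eqxx.
by rewrite !mem -!pair_eqE /= vx eqxx /= => /eqP ->.
Qed.

Lemma fconnect_fixed (phi : 'I_N -> 'I_N) v r r' : phi r = r -> phi r' = r' ->
  fconnect phi v r -> fconnect phi v r' -> r = r'.
Proof.
move=> pr pr' /iter_findex E /iter_findex E'.
have fx k x : phi x = x -> iter k phi x = x by move=> px; elim: k => //= k ->.
transitivity (iter (findex phi v r') phi r); first by rewrite fx.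
by rewrite -[in LHS]E -iterD addnC iterD E' fx.
Qed.

Lemma fconnect_next (phi : 'I_N -> 'I_N) v r : v != r ->
  fconnect phi v r -> fconnect phi (phi v) r.
Proof.
move=> vr vc; have := iter_findex vc; case: (findex phi v r) => [/= vE|k].
  by rewrite vE eqxx in vr.
by rewrite iterSr => <-; exact: fconnect_iter.
Qed.

Lemma ditree_rooted_out r T : ditree_rooted G r T ->
  [/\ outf T r = r,
      arcs T = [set (v, outf T v) | v in verts T :\ r]%SET,
      forall v, v \in verts T -> outf T v \in verts T,
      forall v, v \in verts T -> fconnect (outf T) v r &
      forall v, v \in verts T -> v != r -> (v, outf T v) \in arcs T].
Proof.
move=> [[subE sub] conn rT o0 o1].
have pr : outf T r = r.
  by rewrite /outf; case: pickP => // u; rewrite (negbTE (outdeg0 u o0)).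
have arcsE : arcs T = [set (v, outf T v) | v in verts T :\ r]%SET.
  apply/setP => -[x y]; apply/idP/imsetP.
    move=> xy; have [/= xT yT] := sub _ xy.
    have xr : x != r by apply: contraTneq xy => ->; exact: outdeg0.
    exists x; first by rewrite !inE xr.
    by have := outdeg1 y (o1 x xT xr); rewrite xy => /esym/eqP ->.
  move=> [v]; rewrite !inE => /andP[vr vT] [-> ->].
  by rewrite outdeg1 ?eqxx// o1.
have arc v : v \in verts T -> v != r -> (v, outf T v) \in arcs T.
  by move=> vT vr; rewrite arcsE; apply/imsetP; exists v; rewrite ?inE ?vr.
split => // v vT.
  have [->|vr] := eqVneq v r; first by rewrite pr.
  by have [] := sub _ (arc v vT vr).
set e := fun a b => ((a, b) \in arcs T) || ((b, a) \in arcs T).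
(* Connectedness ignores orientation, but it yields directed paths to r: the set of vertices that
   reach r is closed under arcs in both directions, because a vertex other than r has only one
   out-arc. *)
suff cl : fingraph.closed e [set x | fconnect (outf T) x r]%SET.
  by have := closed_connect cl (conn _ _ vT rT); rewrite !inE connect0.
move=> x y /orP[|] xy; rewrite !inE.
  have [/= xT yT] := sub _ xy.
  have xr : x != r by apply: contraTneq xy => ->; exact: outdeg0.
  have yE : y = outf T x by have := outdeg1 y (o1 x xT xr); rewrite xy => /esym/eqP.
  apply/idP/idP; rewrite yE; first exact: fconnect_next.
  by apply: connect_trans; exact: fconnect1.
have [/= xT yT] := sub _ xy.
have xr : y != r by apply: contraTneq xy => ->; exact: outdeg0.
have yE : x = outf T y by have := outdeg1 x (o1 y xT xr); rewrite xy => /esym/eqP.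
apply/idP/idP; rewrite yE; last exact: fconnect_next.
by apply: connect_trans; exact: fconnect1.
Qed.

Lemma ditree_rooted_fun (r : 'I_N) (V : {set 'I_N}) (phi : 'I_N -> 'I_N) :
  r \in V -> (forall v, v \in V -> v != r -> phi v \in V /\ (v, phi v) \in edges G) ->
  (forall v, v \in V -> fconnect phi v r) ->
  ditree_rooted G r (V, [set (v, phi v) | v in V :\ r]%SET).
Proof.
move=> rV hV conn; split => //.
- split.
    apply/fintype.subsetP => e /imsetP[v]; rewrite !inE => /andP[vr vV] ->.
    by have [] := hV v vV vr.
  move=> e /imsetP[v]; rewrite !inE => /andP[vr vV] -> /=.
  by have [] := hV v vV vr.
- move=> x y xV yV; set e := (X in connect X).
  have esym : connect_sym e.
    by apply: sym_connect_sym => a b; rewrite /e orbC.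
  have toR z : z \in V -> connect e z r.
    move=> zV; have := iter_findex (conn z zV).
    move: (findex phi z r) => k0; elim: k0 z zV => [|k IH] z zV.
      by move=> /= ->; exact: connect0.
    have [->|zr] := eqVneq z r; first by rewrite connect0.
    have [pV _] := hV z zV zr.
    rewrite iterSr => /(IH _ pV); apply: connect_trans; apply: connect1.
    by apply/orP; left; apply/imsetP; exists z; rewrite ?inE ?zr.
  by apply: connect_trans (toR x xV) _; rewrite esym toR.
- apply/eqP; rewrite cards_eq0; apply/eqP/setP => -[x y]; rewrite !inE/=.
  apply/negbTE/negP => /andP[/imsetP[v + [-> _]] /eqP vr].
  by rewrite !inE vr eqxx.
- move=> v vV vr; apply/eqP/cards1P; exists (v, phi v).
  apply/setP => -[x y]; rewrite !inE/=; apply/idP/eqP.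
    by move=> /andP[/imsetP[u _ [-> ->]] /eqP ->].
  by move=> [-> ->]; rewrite eqxx andbT; apply/imsetP; exists v; rewrite ?inE ?vr.
Qed.

Lemma big_arcs_fun (r : 'I_N) (V : {set 'I_N}) (phi : 'I_N -> 'I_N) (F : 'I_N * 'I_N -> R) :
  \prod_(e in [set (v, phi v) | v in V :\ r]%SET) F e =
  \prod_(v in V :\ r) F (v, phi v).
Proof. by rewrite big_imset//= => x y _ _ []. Qed.

(** Spanning trees correspond to pairs (r, phi): r is the only vertex without an out-arc and phi
    gives the heads of the others. Maps that use a non-edge have product 0. *)
Lemma sum_rooted_fun (F : 'I_N -> 'I_N -> R) :
  (forall x y, (x, y) \notin edges G -> F x y = 0) ->
  \sum_r \sum_(phi | rooted_fun r phi) \prod_(a | a != r) F a (phi a) =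
  \sum_(T in ST G) \prod_(e in arcs T) F e.1 e.2.
Proof.
move=> F0.
pose tg (p : 'I_N * {ffun 'I_N -> 'I_N}) : graph N :=
  ([set: 'I_N]%SET, [set (v, p.2 v) | v in [set: 'I_N]%SET :\ p.1]%SET).
pose D := [set p : 'I_N * {ffun 'I_N -> 'I_N} | rooted_fun p.1 p.2 &&
  (arcs (tg p) \subset edges G)]%SET.
rewrite (pair_big_dep xpredT (fun r phi => rooted_fun r phi)
  (fun r phi => \prod_(a | a != r) F a (phi a)))/=.
have prodE (p : 'I_N * {ffun 'I_N -> 'I_N}) : \prod_(a | a != p.1) F a (p.2 a) = \prod_(e in arcs (tg p)) F e.1 e.2.
  by rewrite big_arcs_fun; apply: eq_bigl => a; rewrite !inE andbT.
rewrite (bigID (fun p => arcs (tg p) \subset edges G))/= [X in _ + X]big1 ?addr0; last first.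
  move=> p /andP[_ /subsetPn[e eT eG]]; rewrite prodE (bigD1 e)//=.
  by case: e eT eG => x y _ /F0 /= ->; rewrite mul0r.
under eq_bigr do rewrite prodE.
have tgI : {in D &, injective tg}.
  move=> [r phi] [s psi]; rewrite !inE /= => /andP[/andP[/eqP pr _] /fintype.subsetP sG].
  move=> /andP[/andP[/eqP ps _] _] [E].
  have out v u : ((v, u) \in [set (v0, phi v0) | v0 in [set: 'I_N]%SET :\ r]%SET) =
      (v != r) && (u == phi v).
    apply/imsetP/andP; first by move=> [z]; rewrite !inE andbT => zr [-> ->].
    by move=> [vr /eqP ->]; exists v; rewrite ?inE ?vr.
  have out' v u : ((v, u) \in [set (v0, psi v0) | v0 in [set: 'I_N]%SET :\ s]%SET) =
      (v != s) && (u == psi v).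
    apply/imsetP/andP; first by move=> [z]; rewrite !inE andbT => zr [-> ->].
    by move=> [vr /eqP ->]; exists v; rewrite ?inE ?vr.
  have rs : r = s.
    apply/eqP/negPn/negP => rs.
    have := out' r (psi r); rewrite -E out !eqxx andbT rs.
    by [].
  congr pair => //; apply/ffunP => v.
  have [->|vr] := eqVneq v r; first by rewrite pr rs ps.
  by have := out' v (phi v); rewrite -E out -rs vr eqxx => /esym/eqP.
rewrite (eq_bigl (fun p => p \in D)) => [|p]; last by rewrite [RHS]inE.
rewrite -(big_imset (fun T : graph N => \prod_(e in arcs T) F e.1 e.2) tgI)/=.
apply: eq_bigl => T; apply/imsetP/idP.
  move=> [[r phi] pD ->]; rewrite inE /= /rooted_fun in pD.
  move: pD => /andP[/andP[/eqP pr /forallP conn] /fintype.subsetP sG].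
  apply/mem_set; split => //; exists r; apply: ditree_rooted_fun => // [|v _ vr]; first by rewrite inE.
  by split; rewrite ?inE//; apply: sG; apply/imsetP; exists v; rewrite ?inE ?vr.
move=> /set_mem [[r tr] vT].
have [pr arcsE _ conn _] := ditree_rooted_out tr.
exists (r, finfun (outf T)).
  rewrite !inE /= /rooted_fun ffunE pr eqxx /=; apply/andP; split.
    apply/forallP => v; rewrite (eq_fconnect (ffunE (outf T))) conn// vT inE.
    done.
  have [[sG _] _ _ _ _] := tr.
  apply: fintype.subset_trans sG; apply/fintype.subsetP => e /imsetP[v]; rewrite ffunE !inE andbT => vr ->.
  by rewrite arcsE; apply/imsetP; exists v; rewrite // vT !inE vr.
rewrite [LHS]surjective_pairing /tg /=; congr pair; first exact: vT.
rewrite -[LHS]/(arcs T) arcsE vT.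
by apply: eq_imset => v; rewrite ffunE.
Qed.

End Trees.

(** * Lebesgue measure on row vectors *)

Section LebesgueTuple.
Local Open Scope classical_set_scope.
Local Open Scope ring_scope.
Variable R : realType.
Local Notation mR := (measurableTypeR R).

Definition tcons n (xt : mR * n.-tuple mR) : n.+1.-tuple mR :=
  [tuple of xt.1 :: xt.2].

Definition tbehead n (t : n.+1.-tuple mR) : n.-tuple mR := [tuple of behead t].

Lemma thead_tcons n (x : mR) (t : n.-tuple mR) : thead (tcons (x, t)) = x.
Proof. by rewrite /thead (tnth_nth x). Qed.

Lemma tbehead_tcons n (x : mR) (t : n.-tuple mR) : tbehead (tcons (x, t)) = t.
Proof. exact/val_inj. Qed.

Lemma measurable_tcons n : measurable_fun setT (@tcons n).
Proof. by apply: measurable_cons; [exact: measurable_fst|exact: measurable_snd]. Qed.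

Lemma measurable_thead n :
  measurable_fun setT (fun t : n.+1.-tuple mR => thead t).
Proof. exact: (@measurable_tnth _ mR n.+1 ord0). Qed.

Lemma measurable_tbehead n : measurable_fun setT (@tbehead n).
Proof. exact: measurable_behead. Qed.

Lemma measurableT_preimage d d' (T : measurableType d) (U : measurableType d')
  (f : T -> U) A : measurable_fun setT f -> measurable A -> measurable (f @^-1` A).
Proof. by move=> mf mA; rewrite -[X in measurable X]setTI; exact: mf. Qed.

(** The product with [lebesgue_measure] is a measure only when the measure of the tail is
    sigma-finite, so the measure structure and sigma-finiteness have to go through one induction. *)
Lemma lebesgue_tuple_measure n :
  exists mu : {sigma_finite_measure set (n.-tuple mR) -> \bar R},
    mu = @lebesgue_tuple R n :> (_ -> _).
Proof.
elim: n => [|n [mu muE]] /=.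
  by exists (dirac ([tuple] : 0.-tuple mR)).
rewrite -muE.
pose mm := measure_function_pushforward__canonical__measure_function_Measure
  (lebesgue_measure \x mu)%E (@measurable_tcons n).
have sf : sigma_finite setT mm.
  have /sigma_finiteP[F [TF ndF Foo]] := sigma_finiteT (@lebesgue_measure R).
  have /sigma_finiteP[F' [TG ndG Goo]] := sigma_finiteT mu.
  exists (fun k => (fun t : n.+1.-tuple mR => thead t) @^-1` F k `&` @tbehead n @^-1` F' k).
    apply/seteqP; split => // t _ /=.
    have : setT (thead t) by []. rewrite TF => -[i _ Fi].
    have : setT (tbehead t) by []. rewrite TG => -[j _ Fj].
    exists (maxn i j) => //=; split.
    - by move: Fi; exact/subsetPset/ndF/leq_maxl.
    - by move: Fj; exact/subsetPset/ndG/leq_maxr.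
  move=> k; have [mF Fk] := Foo k; have [mF' Fk'] := Goo k.
  split.
    apply: measurableI; apply: measurableT_preimage => //.
      exact: measurable_thead.
    exact: measurable_tbehead.
  rewrite /mm /= /pushforward [X in product_measure1 _ _ X](_ : _ = F k `*` F' k).
    by rewrite product_measure1E// lte_mul_pinfty// ge0_fin_numE.
  by apply/seteqP; split => -[x t] /=; rewrite thead_tcons tbehead_tcons.
pose mms := HB.pack_for {sigma_finite_measure set _ -> \bar R} (Measure.sort mm) mm
  (Measure_isSigmaFinite.Build _ _ _ mm sf).
by exists mms.
Qed.

Lemma lebesgue_tuple0 n : @lebesgue_tuple R n set0 = 0%E.
Proof. by have [mu <-] := lebesgue_tuple_measure n; exact: measure0. Qed.

Lemma lebesgue_tuple_ge0 n A : (0 <= @lebesgue_tuple R n A)%E.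
Proof. by have [mu <-] := lebesgue_tuple_measure n; exact: measure_ge0. Qed.

Lemma lebesgue_tuple_sigma_additive n : semi_sigma_additive (@lebesgue_tuple R n).
Proof.
by have [mu <-] := lebesgue_tuple_measure n; exact: measure_semi_sigma_additive.
Qed.

HB.instance Definition _ n := isMeasure.Build _ _ _ (@lebesgue_tuple R n)
  (lebesgue_tuple0 n) (@lebesgue_tuple_ge0 n) (@lebesgue_tuple_sigma_additive n).

Lemma lebesgue_tuple_sigma_finite n : sigma_finite setT (@lebesgue_tuple R n).
Proof. by have [mu <-] := lebesgue_tuple_measure n; exact: sigma_finiteT. Qed.

HB.instance Definition _ n := Measure_isSigmaFinite.Build _ _ _
  (@lebesgue_tuple R n) (@lebesgue_tuple_sigma_finite n).

Lemma lebesgue_tupleS n (A : set (n.+1.-tuple mR)) :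
  @lebesgue_tuple R n.+1 A =
  (\int[lebesgue_measure]_x @lebesgue_tuple R n [set t | A (tcons (x, t))])%E.
Proof.
rewrite /= /pushforward /product_measure1; apply: eq_integral => x _ /=.
congr lebesgue_tuple; apply/seteqP; split => t; rewrite /xsection /= ?inE//.
Qed.

Definition tbox n (A : 'I_n -> set mR) : set (n.-tuple mR) :=
  [set t | forall i, A i (tnth t i)].

Lemma measurable_tbox n (A : 'I_n -> set mR) :
  (forall i, measurable (A i)) -> measurable (tbox A).
Proof.
move=> mA.
have -> : tbox A = \bigcap_(i in [set: 'I_n]) ((@tnth n mR)^~ i @^-1` A i).
  by apply/seteqP; split => t /=; [move=> h i _; exact: h|move=> h i; apply: h].
apply: fin_bigcap_measurable => [|i _]; first exact: finite_finset.
by apply: measurableT_preimage => //; exact: measurable_tnth.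
Qed.

Lemma tboxS n (A : 'I_n.+1 -> set mR) :
  @tcons n @^-1` tbox A = A ord0 `*` tbox (fun i => A (lift ord0 i)).
Proof.
apply/seteqP; split => -[x t] /=.
  move=> h; split; first by have := h ord0; rewrite (tnth_nth x).
  by move=> i; have := h (lift ord0 i); rewrite !(tnth_nth x).
move=> [h0 h1] i; case: (unliftP ord0 i) => [j ->|->].
  by have := h1 j; rewrite !(tnth_nth x).
by rewrite (tnth_nth x).
Qed.

Lemma lebesgue_tbox n (A : 'I_n -> set mR) : (forall i, measurable (A i)) ->
  @lebesgue_tuple R n (tbox A) = (\prod_(i < n) lebesgue_measure (A i))%E.
Proof.
elim: n A => [|n IH] A mA.
  rewrite big_ord0 /= diracE (_ : _ \in _ = true)//.
  by apply/mem_set => -[].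
rewrite big_ord_recl -IH// -product_measure1E//; last exact: measurable_tbox.
by rewrite -tboxS.
Qed.

(** Boxes form a pi-system that generates the sigma-algebra, and the boxes with sides [-k, k]
    exhaust the space with finite measure. *)
Lemma lebesgue_tuple_unique n (m1 m2 : {measure set (n.-tuple mR) -> \bar R}) :
  (forall A : 'I_n -> set mR, (forall i, measurable (A i)) ->
    m1 (tbox A) = (\prod_(i < n) lebesgue_measure (A i))%E) ->
  (forall A : 'I_n -> set mR, (forall i, measurable (A i)) ->
    m2 (tbox A) = (\prod_(i < n) lebesgue_measure (A i))%E) ->
  forall A, measurable A -> m1 A = m2 A.
Proof.
move=> h1 h2 A mA.
pose G : set (set (n.-tuple mR)) :=
  [set B | exists2 A, (forall i, measurable (A i)) & B = tbox A].
have itvm k : measurable (`[(- k%:R)%R, k%:R] : set mR).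
  exact: measurable_itv.
pose g (k : nat) : set (n.-tuple mR) := tbox (fun _ => `[(- k%:R)%R, k%:R]%classic).
apply: (@measure_unique _ R (n.-tuple mR) G g) => //.
- apply/seteqP; split; last first.
    apply: smallest_sub; first exact: sigma_algebra_measurable.
    by move=> _ [B mB ->]; exact: measurable_tbox.
  rewrite [X in X `<=` _]/measurable /=.
  apply: smallest_sub; first exact: smallest_sigma_algebra.
  rewrite -bigcup_seq => B [i _ [C mC <-]].
  apply: sub_sigma_algebra.
  exists (fun j => if j == i then C else setT); first by move=> j; case: ifP.
  apply/seteqP; split => t /=.
    by move=> [_ Ct] j; case: eqP => // ->.
  by move=> h; split => //; have := h i; rewrite eqxx.
- move=> _ _ [X mX ->] [Y mY ->].
  exists (fun i => X i `&` Y i); first by move=> i; exact: measurableI.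
  apply/seteqP; split => t /=; first by move=> [hX hY] i; split; auto.
  by move=> h; split => i; have [] := h i.
- by move=> k; exists (fun _ => `[(- k%:R)%R, k%:R]%classic).
- apply/seteqP; split => // t _.
  pose M := \sum_(i < n) `|tnth t i : R|.
  exists (Num.truncn M).+1 => // i /=; rewrite in_itv /= -ler_norml.
  apply: le_trans (ltW (truncnS_gt _)).
  by rewrite /M (bigD1 i)//= lerDl sumr_ge0.
- by move=> _ [B mB ->]; rewrite h1// h2.
- move=> k; rewrite h1//.
  suff /andP[] : (0 <= \prod_(i < n) @lebesgue_measure R `[(- k%:R)%R, k%:R%R]%classic < +oo)%E by [].
  apply: (big_ind (fun x : \bar R => 0 <= x < +oo)%E) => //.
  - by rewrite lee_fin ler01 ltry.
  - move=> x y /andP[x0 xoo] /andP[y0 yoo]; rewrite mule_ge0//=.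
    by rewrite lte_mul_pinfty// ge0_fin_numE.
  - move=> i _; rewrite measure_ge0/= lebesgue_measure_itv/=.
    by case: ifP => _; rewrite ?ltry// -EFinD ltry.
Qed.

End LebesgueTuple.

(** * Scaling of the measure under linear maps *)

Section LinearImage.
Local Open Scope classical_set_scope.
Local Open Scope ring_scope.
Variable R : realType.
Local Notation mR := (measurableTypeR R).
Local Notation lam := (@lebesgue_measure R).

Lemma lebesgue_measure_shift (c : R) (A : set mR) : measurable A ->
  lam [set x | A (x + c : R)] = lam A.
Proof.
move=> mA.
have mf : measurable_fun setT (fun x : mR => x + c : mR).
  exact: measurable_funD.
pose m := measure_function_pushforward__canonical__measure_function_Measure lam mf.
apply/esym; rewrite (_ : lam [set x | _] = m A)//.
apply: lebesgue_measure_unique => //= _ [[a b]] _ <-.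
rewrite /pushforward [X in _ = lebesgue_measure X](_ : _ = `]a - c, b - c]%classic).
  rewrite !lebesgue_measure_itv/= !lte_fin ltrD2r.
  by case: ifP => // _; rewrite -!EFinB; congr EFin; ring.
by apply/seteqP; split => x /=; rewrite !in_itv/= ltrBlDr lerBrDr.
Qed.

Lemma lebesgue_measure_scale (a : R) (A : set mR) : a != 0 -> measurable A ->
  lam [set x | A (x * a : R)] = (`|a|^-1%:E * lam A)%E.
Proof.
move=> a0 mA.
have mf b : measurable_fun setT (fun x : mR => x * b : mR).
  exact: measurable_funM.
have key b B : 0 < b -> measurable B -> lam [set x | B (x * b : R)] = (b^-1%:E * lam B)%E.
  move=> b0 mB.
  have b0' : 0 <= b by exact: ltW.
  pose m := measure_function_pushforward__canonical__measure_function_Measure lam (mf b).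
  pose m' := mscale (NngNum b0') m.
  suff -> : lam B = m' B.
    by rewrite /m' /mscale /= muleA -EFinM mulVf ?gt_eqF// mul1e.
  apply: lebesgue_measure_unique => //= _ [[u v]] _ <-.
  rewrite /mscale /= /pushforward.
  rewrite [X in _ = (_ * lebesgue_measure X)%E](_ : _ = `]u / b, v / b]%classic).
    rewrite !lebesgue_measure_itv/= !lte_fin ltr_pM2r ?invr_gt0//.
    case: ifP => // _; last by rewrite mule0.
    by rewrite -!EFinB -EFinM; congr EFin; field; rewrite gt_eqF.
  by apply/seteqP; split => x /=; rewrite !in_itv/= ltr_pdivrMr// ler_pdivlMr.
have [a_gt0|a_lt0|/eqP] := ltgtP a 0; last by rewrite (negbTE a0).
  rewrite ltr0_norm//.
  rewrite -(lebesgue_measureN mA) -(key (- a) ((-%R : mR -> mR) @^-1` A)) ?oppr_gt0//.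
    by congr lebesgue_measure; apply/seteqP; split => x /=; rewrite mulrN opprK.
  by apply: measurableT_preimage => //; exact: oppr_measurable.
by rewrite gtr0_norm// key.
Qed.

Definition to_row n (t : n.-tuple mR) : 'rV[R]_n := \row_i (tnth t i : R).

Definition of_row n (x : 'rV[R]_n) : n.-tuple mR := [tuple (x ord0 i : mR) | i < n].

Lemma of_rowK n : cancel (@of_row n) (@to_row n).
Proof. by move=> x; apply/rowP => i; rewrite mxE tnth_mktuple. Qed.

Definition lmap n (A : 'M[R]_n) (t : n.-tuple mR) := of_row (to_row t *m A).

Lemma to_row_lmap n (A : 'M[R]_n) t : to_row (lmap A t) = to_row t *m A.
Proof. by rewrite of_rowK. Qed.

Lemma tnth_lmap n (A : 'M[R]_n) (t : n.-tuple mR) i :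
  tnth (lmap A t) i = (\sum_j (tnth t j : R) * A j i : R).
Proof. by rewrite tnth_mktuple !mxE; apply: eq_bigr => j _; rewrite mxE. Qed.

Lemma measurable_lmap n (A : 'M[R]_n) : measurable_fun setT (@lmap n A).
Proof.
apply/measurable_fun_tnthP => i.
rewrite (_ : _ \o _ = fun t => \sum_j (tnth t j : R) * A j i); last first.
  by apply/funext => t /=; rewrite tnth_lmap.
apply: measurable_sum => j; apply: measurable_funM => //.
exact: measurable_tnth.
Qed.

Lemma lmapM n (A B : 'M[R]_n) t : lmap (A *m B) t = lmap B (lmap A t).
Proof. by rewrite /lmap of_rowK mulmxA. Qed.

Definition shiftt n (c : 'rV[R]_n) (t : n.-tuple mR) := of_row (to_row t + c).

Lemma tnth_shiftt n (c : 'rV[R]_n) t i :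
  tnth (shiftt c t) i = ((tnth t i : R) + c ord0 i : R).
Proof. by rewrite tnth_mktuple !mxE. Qed.

Lemma measurable_shiftt n (c : 'rV[R]_n) : measurable_fun setT (@shiftt n c).
Proof.
apply/measurable_fun_tnthP => i.
rewrite (_ : _ \o _ = fun t => (tnth t i : R) + c ord0 i); last first.
  by apply/funext => t /=; rewrite tnth_shiftt.
by apply: measurable_funD => //; exact: measurable_tnth.
Qed.

Lemma lebesgue_tuple_shift n (c : 'rV[R]_n) (B : set (n.-tuple mR)) :
  measurable B -> lebesgue_tuple (shiftt c @^-1` B) = lebesgue_tuple B.
Proof.
move=> mB.
pose m := measure_function_pushforward__canonical__measure_function_Measure
  (@lebesgue_tuple R n) (@measurable_shiftt n c).
rewrite (_ : lebesgue_tuple _ = m B)//.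
apply: lebesgue_tuple_unique => // A mA /=; last exact: lebesgue_tbox.
rewrite /pushforward (_ : _ @^-1` _ = tbox (fun i => [set x | A i (x + c ord0 i : R)])).
  rewrite lebesgue_tbox => [|i]; last first.
    by apply: (@measurableT_preimage _ _ mR mR (fun x => x + c ord0 i)) => //; exact: measurable_funD.
  by apply: eq_bigr => i _; rewrite lebesgue_measure_shift.
by apply/seteqP; split => t h i; have := h i; rewrite /= tnth_shiftt.
Qed.

(** Phrased with preimages, which preserve measurability and make both sides measures in [B], to be
    compared on boxes. *)
Definition lin_scaled n (A : 'M[R]_n) := forall B : set (n.-tuple mR), measurable B ->
  (`|\det A|%:E * lebesgue_tuple (lmap A @^-1` B) = lebesgue_tuple B)%E.

Lemma lin_scaledM n (A B : 'M[R]_n) :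
  lin_scaled A -> lin_scaled B -> lin_scaled (A *m B).
Proof.
move=> hA hB C mC; rewrite det_mulmx normrM EFinM -muleA.
have -> : lmap (A *m B) @^-1` C = lmap A @^-1` (lmap B @^-1` C).
  by apply/seteqP; split => t; rewrite /= lmapM.
rewrite muleCA hA ?hB//.
by apply: measurableT_preimage => //; exact: measurable_lmap.
Qed.

Lemma lin_scaled_perm n (s : 'S_n) : lin_scaled (perm_mx s).
Proof.
move=> B mB; rewrite det_perm normrX normrN1 expr1n mul1e.
pose m := measure_function_pushforward__canonical__measure_function_Measure
  (@lebesgue_tuple R n) (@measurable_lmap n (perm_mx s)).
rewrite (_ : lebesgue_tuple _ = m B)//.
apply: lebesgue_tuple_unique => // A mA /=; last exact: lebesgue_tbox.
have e t i : tnth (lmap (perm_mx s) t) (s i) = tnth t i.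
  rewrite tnth_lmap (bigD1 i)//= !mxE eqxx mulr1 big1 ?addr0// => j ji.
  by rewrite !mxE (inj_eq perm_inj) (negbTE ji) mulr0.
rewrite /pushforward (_ : _ @^-1` _ = tbox (fun i => A (s i))).
  by rewrite lebesgue_tbox// [RHS](reindex_inj (@perm_inj _ s)).
apply/seteqP; split => t /= h i; first by have := h (s i); rewrite e.
by have := h ((s^-1)%g i); rewrite permKV -(permKV s i) e permK.
Qed.

Lemma lin_scaled_diag n (d : 'rV[R]_n) : (forall i, d ord0 i != 0) ->
  lin_scaled (diag_mx d).
Proof.
move=> d0 B mB.
pose m := measure_function_pushforward__canonical__measure_function_Measure
  (@lebesgue_tuple R n) (@measurable_lmap n (diag_mx d)).
pose m' := mscale (NngNum (normr_ge0 (\det (diag_mx d)))) m.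
rewrite (_ : (_ * _)%E = m' B)//.
apply: lebesgue_tuple_unique => // A mA /=; last exact: lebesgue_tbox.
have e t i : tnth (lmap (diag_mx d) t) i = ((tnth t i : R) * d ord0 i : R).
  rewrite tnth_lmap (bigD1 i)//= !mxE eqxx mulr1n big1 ?addr0// => j ji.
  by rewrite !mxE (negbTE ji) mulr0n mulr0.
rewrite /mscale /= /pushforward.
rewrite (_ : _ @^-1` _ = tbox (fun i => [set x | A i (x * d ord0 i : R)])).
  rewrite lebesgue_tbox => [|i]; last first.
    by apply: (@measurableT_preimage _ _ mR mR (fun x => x * d ord0 i)) => //; exact: measurable_funM.
  rewrite det_diag normr_prod (big_morph EFin (@EFinM R) erefl) -big_split/=; apply: eq_bigr => i _.
  by rewrite lebesgue_measure_scale// muleA -EFinM divff ?normr_eq0// mul1e.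
by apply/seteqP; split => t h i; have := h i; rewrite /= e.
Qed.

(** The first coordinate x is kept. For fixed x the others undergo the smaller unitriangular map
    followed by the translation by x u, where u is the rest of the first row. *)
Lemma lin_scaled_uunitrig n (A : 'M[R]_n) :
  (forall i j : 'I_n, (j <= i)%N -> A i j = (i == j)%:R) -> lin_scaled A.
Proof.
elim: n A => [|n IH] A hA B mB.
  rewrite det_mx00 normr1 mul1e; congr lebesgue_tuple.
  by apply/seteqP; split => t /=; rewrite [lmap _ _]tuple0 [t]tuple0.
have detA : \det A = 1.
  rewrite -det_tr det_trig; last first.
    by apply/is_trig_mxP => i j ij; rewrite mxE hA ?(ltnW ij)// -val_eqE gtn_eqF.
  by rewrite big1// => i _; rewrite mxE hA ?eqxx.
rewrite detA normr1 mul1e !lebesgue_tupleS; apply: eq_integral => x _.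
pose A' : 'M[R]_n := drsubmx (A : 'M[R]_(1 + n)).
pose u : 'rV[R]_n := ursubmx (A : 'M[R]_(1 + n)).
have hA' (i j : 'I_n) : (j <= i)%N -> A' i j = (i == j)%:R.
  by move=> ij; rewrite mxE [LHS]mxE hA //= (inj_eq (@rshift_inj 1 n)).
have detA' : \det A' = 1.
  rewrite -det_tr det_trig; last first.
    by apply/is_trig_mxP => i j ij; rewrite mxE hA' ?(ltnW ij)// -val_eqE gtn_eqF.
  by rewrite big1// => i _; rewrite mxE hA' ?eqxx.
have mBx : measurable [set t | B (tcons (x, t))].
  pose f (t : n.-tuple mR) : n.+1.-tuple mR := tcons (x, t).
  apply: (@measurableT_preimage _ _ _ _ f B _ mB).
  apply: (measurableT_comp (@measurable_tcons R n)).
  exact: pair1_measurable.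
rewrite -(lebesgue_tuple_shift (x *: u) mBx).
rewrite -(IH A' hA' _ (measurableT_preimage (@measurable_shiftt n _) mBx)).
rewrite detA' normr1 mul1e; congr lebesgue_tuple; apply/seteqP.
suff e t : lmap A (tcons (x, t)) = tcons (x, shiftt (x *: u) (lmap A' t)).
  by split => t /=; rewrite e.
apply/eq_from_tnth => i; rewrite tnth_lmap big_ord_recl.
have tc0 (y : mR) (z : n.-tuple mR) : tnth (tcons (y, z)) ord0 = y by rewrite (tnth_nth y).
have tcS (y : mR) (z : n.-tuple mR) j : tnth (tcons (y, z)) (lift ord0 j) = tnth z j.
  by rewrite !(tnth_nth y).
case: (unliftP ord0 i) => [j ->|->].
  rewrite tcS tnth_shiftt tnth_lmap tc0 addrC; congr (_ + _).
    apply: eq_bigr => k _; rewrite tcS; congr (_ * _).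
    by rewrite !mxE; congr (A _ _); apply/val_inj.
  by rewrite !mxE; congr (_ * A _ _); apply/val_inj.
rewrite !tc0 hA// eqxx mulr1 big1 ?addr0// => j _.
by rewrite hA// mulr0.
Qed.

(** The LUP decomposition reduces the claim to permutations, diagonal matrices and unitriangular
    ones. *)
Lemma lin_scaled_unit n (A : 'M[R]_n) : \det A != 0 -> lin_scaled A.
Proof.
case: n A => [|n] A A0.
  by apply: lin_scaled_uunitrig => -[].
have := cormen_lup_perm A; have := cormen_lup_correct A.
have := @cormen_lup_lower R n A; have := @cormen_lup_upper R n A.
case: cormen_lup => [[Q L] U] /= hU hL QA /is_perm_mxP[s sE].
pose r : 'S_n.+1 := perm rev_ord_inj.
(* Reversing the order of the coordinates turns the lower unitriangular factor into an upper one. *)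
have hL' : L = perm_mx r *m (perm_mx r *m L *m perm_mx r) *m perm_mx r.
  rewrite -!mulmxA -perm_mxM (mulmxA _ (perm_mx r)) -perm_mxM.
  suff -> : (r * r)%g = 1%g by rewrite perm_mx1 mul1mx mulmx1.
  by apply/permP => i; rewrite permM !permE rev_ordK.
have lL : lin_scaled L.
  rewrite hL'; apply: lin_scaledM; last exact: lin_scaled_perm.
  apply: lin_scaledM; first exact: lin_scaled_perm.
  apply: lin_scaled_uunitrig => i j ji.
  have rr : (r^-1 = r)%g.
    apply/permP => k; apply: (@perm_inj _ r); rewrite permKV.
    by rewrite !permE rev_ordK.
  rewrite -[X in _ *m perm_mx X]rr -col_permE -row_permE !mxE hL.
    by rewrite (inj_eq perm_inj).
  by rewrite !permE /=; lia.
have detL : \det L = 1.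
  rewrite det_trig; last first.
    by apply/is_trig_mxP => i j ij; rewrite hL ?(ltnW ij)// -val_eqE ltn_eqF.
  by rewrite big1// => i _; rewrite hL ?eqxx.
have detU : \det U = \prod_i U i i.
  rewrite -det_tr det_trig; last by apply/is_trig_mxP => i j ij; rewrite mxE hU.
  by apply: eq_bigr => i _; rewrite mxE.
have U0 i : U i i != 0.
  have : \det U != 0.
    have : \det (Q * A) != 0 by rewrite det_mulmx mulf_neq0// sE det_perm signr_eq0.
    by rewrite QA det_mulmx detL mul1r.
  by rewrite detU => /prodf_neq0; apply.
have lU : lin_scaled U.
  pose d : 'rV[R]_n.+1 := \row_i U i i.
  rewrite (_ : U = diag_mx d *m \matrix_(i, j) ((U i i)^-1 * U i j)).
    apply: lin_scaledM; first by apply: lin_scaled_diag => i; rewrite mxE.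
    apply: lin_scaled_uunitrig => i j ij; rewrite mxE.
    have [<-|ne] := eqVneq i j; first by rewrite mulVf.
    have -> : U i j = 0 by apply: hU; rewrite ltn_neqAle ij andbT eq_sym.
    by rewrite mulr0.
  apply/matrixP => i j; rewrite mul_diag_mx !mxE mulrA divff// mul1r.
  done.
rewrite (_ : A = perm_mx s^-1%g *m (L *m U)).
  by apply: lin_scaledM; [exact: lin_scaled_perm|exact: lin_scaledM].
rewrite -[L *m U]QA sE mulmxA -perm_mxM mulVg perm_mx1.
by rewrite mul1mx.
Qed.

End LinearImage.

(** * Volume of sets of row vectors *)

Section LebesgueRow.
Local Open Scope classical_set_scope.
Local Open Scope ring_scope.
Variable R : realType.
Local Notation mR := (measurableTypeR R).
Local Notation lam := (@lebesgue_measure R).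
Local Notation mu := (@lebesgue_rV R _).

Definition rV_measurable n (A : set 'rV[R]_n) := measurable (@to_row R n @^-1` A).

Lemma lebesgue_rVE n (A : set 'rV[R]_n) :
  mu A = lebesgue_tuple (@to_row R n @^-1` A).
Proof. by []. Qed.

Lemma lebesgue_rV_ge0 n (A : set 'rV[R]_n) : (0 <= mu A)%E.
Proof. exact: lebesgue_tuple_ge0. Qed.

(** Holds without measurability: the integral of a non-negative function is a supremum over the
    simple functions below it. This makes the volume monotone on arbitrary sets. *)
Lemma integral_mono (f g : mR -> \bar R) : (forall x, 0 <= f x)%E ->
  (forall x, f x <= g x)%E ->
  (\int[lam]_x f x <= \int[lam]_x g x)%E.
Proof.
move=> f0 fg; have g0 x : (0 <= g x)%E by exact: le_trans (fg x).
rewrite !ge0_integralTE//; apply: le_ereal_sup => _ [h hf <-].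
by exists h => // x; exact: le_trans (fg x).
Qed.

Lemma lebesgue_tuple_mono n (A B : set (n.-tuple mR)) :
  A `<=` B -> (lebesgue_tuple A <= lebesgue_tuple B)%E.
Proof.
elim: n A B => [|n IH] A B AB.
  rewrite /= /dirac !indicE lee_fin ler_nat.
  by case: (boolP (_ \in A)) => // /set_mem /AB /mem_set ->.
rewrite !lebesgue_tupleS; apply: integral_mono => x; first exact: lebesgue_tuple_ge0.
by apply: IH => t /=; exact: AB.
Qed.

Lemma lebesgue_rV_mono n (A B : set 'rV[R]_n) : A `<=` B -> (mu A <= mu B)%E.
Proof. by move=> AB; apply: lebesgue_tuple_mono => t; exact: AB. Qed.

Lemma rV_measurableU n (A B : set 'rV[R]_n) :
  rV_measurable A -> rV_measurable B -> rV_measurable (A `|` B).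
Proof. by move=> mA mB; rewrite /rV_measurable preimage_setU; exact: measurableU. Qed.

Lemma lebesgue_rVU n (A B : set 'rV[R]_n) :
  rV_measurable A -> rV_measurable B -> (mu (A `|` B) <= mu A + mu B)%E.
Proof. by move=> mA mB; rewrite lebesgue_rVE preimage_setU; exact: measureU2. Qed.

Lemma lebesgue_rVU_disj n (A B : set 'rV[R]_n) :
  rV_measurable A -> rV_measurable B -> A `&` B = set0 ->
  (mu (A `|` B) = mu A + mu B)%E.
Proof.
move=> mA mB AB; rewrite lebesgue_rVE preimage_setU measureU//.
by rewrite -preimage_setI AB preimage_set0.
Qed.

Lemma lebesgue_rV0 n : mu (@set0 'rV[R]_n) = 0%E.
Proof. by rewrite lebesgue_rVE preimage_set0 measure0. Qed.

Lemma rV_measurable0 n : rV_measurable (@set0 'rV[R]_n).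
Proof. by rewrite /rV_measurable preimage_set0. Qed.

Lemma rV_measurable_bigcup n (I : eqType) (r : seq I) (F : I -> set 'rV[R]_n) :
  (forall i, rV_measurable (F i)) -> rV_measurable (\big[setU/set0]_(i <- r) F i).
Proof.
move=> mF; elim: r => [|i r IH]; first by rewrite big_nil; exact: rV_measurable0.
by rewrite big_cons; exact: rV_measurableU.
Qed.

Lemma lebesgue_rV_bigcup n (I : eqType) (r : seq I) (F : I -> set 'rV[R]_n) :
  (forall i, rV_measurable (F i)) ->
  (mu (\big[setU/set0]_(i <- r) F i) <= \sum_(i <- r) mu (F i))%E.
Proof.
move=> mF; elim: r => [|i r IH]; first by rewrite !big_nil lebesgue_rV0.
rewrite !big_cons (le_trans (lebesgue_rVU _ _))//; last by rewrite leeD2l.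
exact: rV_measurable_bigcup.
Qed.

Lemma lebesgue_rV_bigcup_disj n (I : eqType) (r : seq I) (F : I -> set 'rV[R]_n) :
  uniq r -> (forall i, rV_measurable (F i)) ->
  (forall i j, i != j -> F i `&` F j = set0) ->
  (mu (\big[setU/set0]_(i <- r) F i) = \sum_(i <- r) mu (F i))%E.
Proof.
move=> + mF dF; elim: r => [|i r IH] /=; first by rewrite !big_nil lebesgue_rV0.
move=> /andP[ir ur]; rewrite !big_cons -IH// lebesgue_rVU_disj//.
  exact: rV_measurable_bigcup.
rewrite big_distrr/= big_seq big1// => j jr; apply: dF.
by apply: contraNneq ir => ->.
Qed.

Lemma open_rV_measurable n (U : set 'rV[R]_n) : open U -> rV_measurable U.
Proof.
move=> oU.
pose Bx (p : 'rV[rat]_n * nat) : set 'rV[R]_n :=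
  [set x | forall i, `|x ord0 i - ratr (p.1 ord0 i)| < (p.2.+1%:R^-1 : R)].
pose D := [set p | Bx p `<=` U].
have -> : U = \bigcup_(p in D) Bx p.
  apply/seteqP; split => [x Ux|x [p Dp]]; last exact: Dp.
  have /nbhs_ballP[e /= e0 eU] : nbhs x U by exact: open_nbhs_nbhs.
  (* Two points within 1 / (k + 1) of the same rational point, coordinatewise, differ by less than 2
     / (k + 1) < e; so U is a countable union of rational boxes. *)
  pose k := Num.truncn (2 / e).
  have ke : k.+1%:R^-1 < e / 2.
    rewrite -[e / 2]invrK ltf_pV2 ?posrE ?invr_gt0 ?divr_gt0//.
    by rewrite invf_div truncnS_gt.
  have /choice [q qE] : forall i, exists q : rat, `|x ord0 i - ratr q| < k.+1%:R^-1.
    move=> i; have : x ord0 i < x ord0 i + k.+1%:R^-1 by rewrite ltrDl invr_gt0.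
    move=> /rat_in_itvoo[q]; rewrite in_itv/= => /andP[q1 q2]; exists q.
    by rewrite distrC ger0_norm ?subr_ge0 ?ltW// ltrBlDl.
  exists (\row_i q i, k) => /=; last by move=> i; rewrite mxE.
  move=> y /= yq; apply: eU; split => // i j; rewrite (ord1 i).
  have := yq j; rewrite /= mxE /ball/= => h.
  rewrite (splitr e) (le_lt_trans (ler_distD (ratr (q j)) _ _))//.
  apply: ltrD; first exact: lt_trans (qE j) ke.
  by rewrite distrC (lt_trans h).
rewrite /rV_measurable preimage_bigcup.
rewrite bigcup_mkcond; apply: countable_bigcupT_measurable => [|p]; first exact: countableP.
case: ifP => _ //.
rewrite (_ : _ @^-1` _ = tbox (fun i => [set x : mR | `|(x : R) - ratr (p.1 ord0 i)| < (p.2.+1%:R^-1 : R)])).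
  apply: measurable_tbox => i; apply: open_measurable.
  rewrite (_ : mkset _ = ball (ratr (p.1 ord0 i) : R) (p.2.+1%:R^-1 : R)).
    by apply: ball_open; rewrite invr_gt0.
  by apply/seteqP; split => x; rewrite /ball/= distrC.
by apply/seteqP; split => t /= h i; have := h i; rewrite /= mxE.
Qed.

Lemma closed_rV_measurable n (U : set 'rV[R]_n) : closed U -> rV_measurable U.
Proof.
rewrite -openC => /open_rV_measurable; rewrite /rV_measurable preimage_setC.
by move=> /measurableC; rewrite setCK.
Qed.

Lemma compact_rV_measurable n (U : set 'rV[R]_n) : compact U -> rV_measurable U.
Proof. by move=> /(compact_closed (@norm_hausdorff _ _)); exact: closed_rV_measurable. Qed.

Lemma lebesgue_rV_linear_preimage n (A : 'M[R]_n) (B : set 'rV[R]_n) :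
  \det A != 0 -> rV_measurable B ->
  (`|\det A|%:E * mu [set x | B (x *m A)] = mu B)%E.
Proof.
move=> A0 mB; rewrite [RHS]lebesgue_rVE -(lin_scaled_unit A0 mB).
congr (_ * lebesgue_tuple _)%E; apply/seteqP.
by split => t /=; rewrite to_row_lmap.
Qed.

Lemma lebesgue_rV_linear n (A : 'M[R]_n) (B : set 'rV[R]_n) :
  \det A != 0 -> rV_measurable B ->
  (mu [set x *m A | x in B] = `|\det A|%:E * mu B)%E.
Proof.
move=> A0 mB; have uA : A \in unitmx by rewrite unitmxE unitfE.
rewrite -(@lebesgue_rV_linear_preimage _ (invmx A) B)//; last first.
  by rewrite det_inv invr_eq0.
rewrite muleA -EFinM det_inv normfV divff ?normr_eq0// mul1e.
congr lebesgue_rV; apply/seteqP; split => x /=.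
  by move=> [y By <-]; rewrite mulmxK.
by move=> Bx; exists (x *m invmx A) => //; rewrite mulmxKV.
Qed.

Lemma lebesgue_rV_shift n (c : 'rV[R]_n) (B : set 'rV[R]_n) : rV_measurable B ->
  mu [set c + x | x in B] = mu B.
Proof.
move=> mB; rewrite lebesgue_rVE -[RHS](lebesgue_tuple_shift (- c) mB).
congr lebesgue_tuple; apply/seteqP; split => t /=; rewrite /shiftt of_rowK.
  by move=> [x Bx <-]; rewrite addrAC subrr add0r.
by move=> Bt; exists (to_row t - c) => //; rewrite addrC subrK.
Qed.

Definition cube n (c : 'rV[R]_n) (r : R) : set 'rV[R]_n :=
  [set x | forall i, `|x ord0 i - c ord0 i| <= r].

Lemma cube_compact n (c : 'rV[R]_n) r : compact (cube c r).
Proof.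
rewrite (_ : cube c r = [set v | forall i,
    `[c ord0 i - r, c ord0 i + r]%classic (v ord0 i)]).
  by apply: (@rV_compact _ _ (fun i => `[c ord0 i - r, c ord0 i + r]%classic)) => i;
    exact: segment_compact.
by apply/seteqP; split => x /= h i; have := h i; rewrite in_itv/= ler_distl.
Qed.

Lemma lebesgue_cube n (c : 'rV[R]_n) r : 0 <= r -> mu (cube c r) = ((2 * r) ^+ n)%:E.
Proof.
move=> r0; rewrite lebesgue_rVE.
rewrite (_ : _ @^-1` _ = tbox (fun i => `[c ord0 i - r, c ord0 i + r]%classic)); last first.
  by apply/seteqP; split => t /= h i; have := h i; rewrite /= in_itv/= ler_distl mxE.
rewrite lebesgue_tbox => [|i]; last exact: measurable_itv.
rewrite (eq_bigr (fun=> (2 * r)%:E)) => [|i _].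
  rewrite -(big_morph EFin (@EFinM R) erefl) prodr_const card_ord//.
rewrite lebesgue_measure_itv/= lte_fin; case: ltP => h.
  by rewrite -EFinB; congr EFin; ring.
by congr EFin; lra.
Qed.

Lemma continuous_row m n (f : 'rV[R]_m -> 'rV[R]_n) :
  (forall j, continuous (fun x => f x ord0 j)) -> continuous f.
Proof.
move=> hf x A /nbhs_ballP[e /= e0 eA].
have : \forall y \near x, forall j, `|f x ord0 j - f y ord0 j| < e.
  apply: (@filter_forall _ _ (fun j y => `|f x ord0 j - f y ord0 j| < e) (nbhs x)) => j.
  by have /cvgrPdist_lt/(_ e e0) := hf j x.
apply: filterS => y h; apply: eA; split => // i j; rewrite (ord1 i).
exact: h.
Qed.

Lemma continuous_mulmx m n (A : 'M[R]_(m, n)) :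
  continuous (fun x : 'rV[R]_m => x *m A).
Proof.
apply: continuous_row => j.
have -> : (fun x : 'rV[R]_m => (x *m A) ord0 j) = (fun x => \sum_i x ord0 i * A i j).
  by apply/funext => x; rewrite mxE.
apply: (@continuous_big R _ +%R) => [|i _]; first exact: add_continuous.
move=> x; apply: (@cvgM R _ (nbhs x) _ (fun y : 'rV[R]_m => y ord0 i) (cst (A i j))).
  exact: (@coord_continuous R 1 m ord0 i x).
exact: cvg_cst.
Qed.

End LebesgueRow.

(** * Volume of zonotopes *)

Section Zonotope.
Local Open Scope classical_set_scope.
Local Open Scope ring_scope.
Variable R : realType.
Local Notation mR := (measurableTypeR R).
Local Notation lam := (@lebesgue_measure R).
Local Notation mu := (@lebesgue_rV R _).

(** [T] adds a unit segment beyond the supremum and one below the infimum. Points strictly between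
    the two bounds are in [S] by convexity, whether or not [S] contains its ends. *)
Lemma interval_thickening (S : set R) : (forall x y z, S x -> S y -> x <= z <= y -> S z) ->
  (exists M, forall x, S x -> `|x| <= M) -> measurable (S : set mR) ->
  S !=set0 ->
  exists2 T : set R, measurable (T : set mR) &
    (forall x y, S x -> `|y - x| <= 1 -> T y) /\ (lam T <= lam S + 2%:E)%E.
Proof.
move=> cS [M bS] mS [x0 Sx0].
have ubS : has_sup S by split; [exists x0|exists M => x /bS; rewrite ler_norml => /andP[]].
have lbS : has_inf S.
  by split; [exists x0|exists (- M) => x /bS; rewrite ler_norml => /andP[]].
pose I1 : set mR := `[sup S, sup S + 1]%classic.
pose I2 : set mR := `[inf S - 1, inf S]%classic.
have mI1 : measurable I1 by exact: measurable_itv.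
have mI2 : measurable I2 by exact: measurable_itv.
exists (S `|` I1 `|` I2); first by apply: measurableU => //; exact: measurableU.
split=> [x y Sx|].
  rewrite ler_distl => /andP[y1 y2].
  have xs : x <= sup S by apply: sup_upper_bound.
  have xi : inf S <= x by apply: ge_inf => //; case: lbS.
  have [ys|ys] := leP (sup S) y; first by left; right; rewrite /I1/= in_itv/=; lra.
  have [yi|yi] := leP y (inf S); first by right; rewrite /I2/= in_itv/=; lra.
  left; left.
  have /(sup_adherent (eps := sup S - y)) : 0 < sup S - y by lra.
  move=> /(_ S ubS)[u Su yu].
  have /(inf_adherent (eps := y - inf S)) : 0 < y - inf S by lra.
  move=> /(_ S lbS)[v Sv yv].
  by apply: (cS v u) => //; lra.
apply: (@le_trans _ _ (lam (S `|` I1) + lam I2)%E).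
  by apply: measureU2 => //; exact: measurableU.
have -> : lam I2 = 1%:E.
  by rewrite lebesgue_measure_itv/= lte_fin ifT -?EFinB; [congr EFin; ring|lra].
have l1 : lam I1 = 1%:E.
  by rewrite lebesgue_measure_itv/= lte_fin ifT -?EFinB; [congr EFin; ring|lra].
rewrite (_ : 2%:E = 1%:E + 1%:E)%E ?addeA; last by rewrite -EFinD.
by rewrite leeD2r// -l1; exact: measureU2.
Qed.

(** The recursive definition has the first coordinate as the outer variable. Sections along e_0 need
    the opposite order, which uniqueness of the product measure allows on measurable sets. *)
Lemma lebesgue_rV_fubini n (B : set 'rV[R]_n.+1) : rV_measurable B ->
  (mu B = \int[@lebesgue_tuple R n]_t lam [set x | B (to_row (tcons (x, t)))])%E.
Proof.
move=> mB; rewrite lebesgue_rVE.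
have mC : measurable (@tcons R n @^-1` (@to_row R n.+1 @^-1` B)).
  exact: (measurableT_preimage (@measurable_tcons R n) mB).
pose m2 := lebesgue_integral_fubini_product_measure2__canonical__measure_function_Measure
  lam (@lebesgue_tuple R n).
transitivity (m2 (@tcons R n @^-1` (@to_row R n.+1 @^-1` B))).
  rewrite /=; apply: product_measure_unique => // C D mD mE.
  by rewrite /m2/= product_measure2E.
apply: eq_integral => t _ /=; congr lebesgue_measure.
by apply/seteqP; split => x; rewrite /ysection /= ?inE//.
Qed.

Definition e0 n : 'rV[R]_n.+1 := delta_mx 0 0.

Lemma to_row_tcons_shift n (x y : R) (t : n.-tuple mR) :
  to_row (tcons (y, t)) = to_row (tcons (x, t)) + (y - x) *: e0 n.
Proof.
apply/rowP => i; rewrite !mxE eqxx /=; case: (unliftP ord0 i) => [j ->|->].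
  by rewrite !(tnth_nth x)/= mulr0 addr0.
by rewrite !(tnth_nth x)/= mulr1 addrC subrK.
Qed.

Lemma col'0_to_row n (x : R) (t : n.-tuple mR) :
  col' ord0 (to_row (tcons (x, t))) = to_row t.
Proof. by apply/rowP => i; rewrite !mxE !(tnth_nth x). Qed.

(** On a line parallel to e_0, [B] lies in the 1-neighbourhood of the interval cut out of [B'],
    hence exceeds its length by at most 2. A line that misses [B'] misses [B], and the lines that
    meet [B'] project into [D]. *)
Lemma lebesgue_rV_thickening n (B B' : set 'rV[R]_n.+1) (D : set 'rV[R]_n) :
  compact B -> compact B' -> compact D ->
  (forall x y u, B' x -> B' y -> 0 <= u <= 1 -> B' (x + u *: (y - x))) ->
  (forall x, B' x -> D (col' ord0 x)) ->
  (forall x, B x -> exists t, `|t| <= 1 /\ B' (x + t *: e0 n)) ->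
  (mu B <= mu B' + 2%:E * mu D)%E.
Proof.
move=> cB cB' cD conv pD BB'.
have mB := compact_rV_measurable cB; have mB' := compact_rV_measurable cB'.
have mD := compact_rV_measurable cD.
pose D' := @to_row R n @^-1` D.
have msec (C : set 'rV[R]_n.+1) (t : n.-tuple mR) : rV_measurable C ->
    measurable [set x : mR | C (to_row (tcons (x, t)))].
  move=> mC; pose f (x : mR) : n.+1.-tuple mR := tcons (x, t).
  apply: (@measurableT_preimage _ _ _ _ f (@to_row R n.+1 @^-1` C) _ mC).
  apply: (measurableT_comp (@measurable_tcons R n)).
  exact: pair2_measurable.
have mint (C : set 'rV[R]_n.+1) : rV_measurable C ->
    measurable_fun setT (fun t : n.-tuple mR => lam [set x | C (to_row (tcons (x, t)))]).
  move=> mC.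
  have mC' := measurableT_preimage (@measurable_tcons R n) mC.
  have := measurable_fun_ysection lam mC'.
  congr measurable_fun; apply/funext => t /=; congr lebesgue_measure.
  by apply/seteqP; split => x; rewrite /ysection /= ?inE.
rewrite !lebesgue_rV_fubini//.
have -> : (2%:E * mu D = \int[@lebesgue_tuple R n]_t (2%:E * (\1_D' t)%:E))%E.
  rewrite ge0_integralZl//.
  - by rewrite integral_indic ?setIT.
  - exact/measurable_EFinP/measurable_indic.
rewrite -ge0_integralD//; last 2 first.
- exact: mint.
- by apply: emeasurable_funM => //; exact/measurable_EFinP/measurable_indic.
apply: ge0_le_integral => //.
- exact: mint.
- apply: emeasurable_funD; first exact: mint.
  by apply: emeasurable_funM => //; exact/measurable_EFinP/measurable_indic.
move=> t _.
set S := [set x | B' (to_row (tcons (x, t)))].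
have [S0|S0] := pselect (S !=set0); last first.
  rewrite (_ : [set x | B _] = set0) ?measure0.
    by rewrite adde_ge0// mule_ge0// lee_fin.
  apply/seteqP; split => // x /= /BB'[s [_ Bs]].
  have : S (x + s) by rewrite /S/= (to_row_tcons_shift x) (addrC x) addrK.
  by move=> Ss; apply: S0; exists (x + s).
have tD : t \in D'.
  by apply/mem_set; have [x Sx] := S0; have := pD _ Sx; rewrite col'0_to_row.
rewrite indicE tD mule1.
have [||||T mT [hT lT]] := @interval_thickening S.
- move=> x y z Sx Sy /andP[xz zy].
  have [xy|xy] := eqVneq x y; first by have -> : z = x by lra.
  have xy' : x < y by rewrite lt_neqAle xy (le_trans xz).
  have := conv _ _ ((z - x) / (y - x)) Sx Sy.
  rewrite (to_row_tcons_shift x y) addrAC subrr add0r scalerA divfK; last first.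
    by rewrite subr_eq0 gt_eqF.
  rewrite -to_row_tcons_shift; apply.
  by rewrite divr_ge0 ?subr_ge0 ?(le_trans xz)//= ler_pdivrMr ?subr_gt0// mul1r lerB.
- have /compact_bounded[M [_ hM]] := cB'.
  have MM : M < M + 1 by rewrite ltrDl.
  exists (M + 1) => x Sx; apply: le_trans (hM _ MM _ Sx).
  rewrite [leRHS]/Num.norm/= mx_normrE.
  apply/bigmax_geP; right; exists (ord0, ord0) => //=.
  by rewrite mxE (tnth_nth x).
- exact: msec.
- exact: S0.
apply: le_trans lT; apply: le_measure; rewrite ?inE//; first exact: msec.
move=> x /= /BB'[s [s1 Bs]]; apply: (hT (x + s)).
  by rewrite /S/= (to_row_tcons_shift x) (addrC x) addrK.
by rewrite opprD addrA subrr sub0r normrN.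
Qed.

Definition zonotope m n (V : 'M[R]_(m, n)) : set 'rV[R]_n :=
  [set s *m V | s in cube 0 1].

Lemma zonotope_compact m n (V : 'M[R]_(m, n)) : compact (zonotope V).
Proof.
apply: continuous_compact; last exact: cube_compact.
by apply: continuous_subspaceT; exact: continuous_mulmx.
Qed.

Lemma zonotope_mulmx m n p (V : 'M[R]_(m, n)) (A : 'M[R]_(n, p)) :
  zonotope (V *m A) = [set x *m A | x in zonotope V].
Proof.
apply/seteqP; split => x /=.
  by move=> [s hs <-]; exists (s *m V); [exists s|rewrite mulmxA].
by move=> [_ [s hs <-] <-]; exists s => //; rewrite mulmxA.
Qed.

Lemma zonotope_convex m n (V : 'M[R]_(m, n)) x y u :
  zonotope V x -> zonotope V y -> 0 <= u <= 1 -> zonotope V (x + u *: (y - x)).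
Proof.
move=> [s hs <-] [t ht <-] /andP[u0 u1]; exists (s + u *: (t - s)); last first.
  by rewrite mulmxDl -scalemxAl mulmxBl.
move=> i; have := hs i; have := ht i; rewrite !mxE !subr0 !ler_norml.
by move=> /andP[a b] /andP[c d]; apply/andP; split; nra.
Qed.

Lemma zonotopeS m n (V : 'M[R]_(m.+1, n)) x :
  zonotope V x -> exists t, `|t| <= 1 /\ zonotope (row' ord0 V) (x + t *: row ord0 V).
Proof.
move=> [s hs <-]; exists (- s ord0 ord0); split.
  by have := hs ord0; rewrite !mxE subr0 normrN.
exists (col' ord0 s); first by move=> i; have := hs (lift ord0 i); rewrite !mxE.
apply/rowP => j; rewrite !mxE big_ord_recl mulNr addrAC subrr add0r.
by apply: eq_bigr => i _; rewrite !mxE.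
Qed.

(** Summing over maps rather than over sets of rows counts each n x n minor n! times, maps with a
    repeated value giving 0. Orderings then need no normal form; the price is the n! in the zonotope
    bound. *)
Definition minors_sum m n (V : 'M[R]_(m, n)) : R :=
  \sum_(f : {ffun 'I_n -> 'I_m}) `|\det (rowsub f V)|.

Lemma minors_sum_mulmx m n (V : 'M[R]_(m, n)) (A : 'M[R]_n) :
  minors_sum (V *m A) = minors_sum V * `|\det A|.
Proof.
rewrite /minors_sum mulr_suml; apply: eq_bigr => f _.
by rewrite -normrM -det_mulmx mul_rowsub_mx.
Qed.

End Zonotope.

Lemma ler_sum_inj (R : realType) (T U : finType) (h : T -> U) (a : U -> R) :
  injective h -> (forall u, 0 <= a u) -> \sum_x a (h x) <= \sum_u a u.
Proof.
move=> hI a0; rewrite [leRHS](bigID (mem [set h x | x in T]%SET))/=.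
rewrite big_imset/=; last by move=> x y _ _; exact: hI.
by rewrite lerDl sumr_ge0.
Qed.

Section ZonotopeVolume.
Local Open Scope classical_set_scope.
Local Open Scope ring_scope.
Variable R : realType.
Local Notation mu := (@lebesgue_rV R _).

Lemma minors_sum_row' m n (V : 'M[R]_(m.+1, n)) :
  minors_sum (row' ord0 V) <= minors_sum V.
Proof.
rewrite /minors_sum.
pose h (g : {ffun 'I_n -> 'I_m}) := [ffun i => lift ord0 (g i)].
rewrite (eq_bigr (fun g => `|\det (rowsub (h g) V)|)); last first.
  move=> g _; congr (`|\det _|); apply/matrixP => i j.
  by rewrite !mxE ffunE.
apply: (ler_sum_inj (a := fun f : {ffun 'I_n -> 'I_m.+1} => `|\det (rowsub f V)|)) => //.
move=> f g /ffunP fg; apply/ffunP => i; have := fg i; rewrite !ffunE.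
exact: lift_inj.
Qed.

(** The map [h] embeds two kinds of selections: those avoiding row 0, and those using it at exactly
    one position k. In the second kind, expansion along the row e_0 leaves a minor of the projection
    along e_0, the same family for each of the n + 1 positions. *)
Lemma minors_sum_e0 m n (W : 'M[R]_(m.+1, n.+1)) : row ord0 W = e0 R n ->
  minors_sum (row' ord0 W) + n.+1%:R * minors_sum (col' ord0 (row' ord0 W)) <=
  minors_sum W.
Proof.
move=> W0.
pose a (f : {ffun 'I_n.+1 -> 'I_m.+1}) := `|\det (rowsub f W)|.
pose h (x : {ffun 'I_n.+1 -> 'I_m} + 'I_n.+1 * {ffun 'I_n -> 'I_m}) :=
  match x with
  | inl g => [ffun i => lift ord0 (g i)]
  | inr kg => [ffun i => if unlift kg.1 i is Some j then lift ord0 (kg.2 j) else ord0]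
  end.
have hI : injective h.
  have ne0 j : (lift ord0 j == ord0 :> 'I_m.+1) = false.
    by apply/negbTE; rewrite eq_sym; exact: neq_lift.
  move=> [g|[k g]] [g'|[k' g']] /= /ffunP e.
  - by congr inl; apply/ffunP => i; have := e i; rewrite !ffunE => /lift_inj.
  - by have := e k'; rewrite !ffunE/= unlift_none => /eqP; rewrite ne0.
  - by have := e k; rewrite !ffunE/= unlift_none => /eqP; rewrite eq_sym ne0.
  - have kk : k = k'.
      apply/eqP/negPn/negP => ne; have := e k; rewrite !ffunE/= unlift_none.
      by rewrite eq_sym in ne; have [j ->] := unlift_some ne => -> /eqP; rewrite eq_sym ne0.
    rewrite -{}kk in e *; congr (inr (_, _)); apply/ffunP => j.
    by have := e (lift k j); rewrite !ffunE/= liftK => /lift_inj.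
have a_ge0 f : 0 <= a f by rewrite /a.
apply: le_trans (ler_sum_inj hI a_ge0).
rewrite big_sumType/= lerD//.
  rewrite [leLHS](_ : _ = \sum_g a (h (inl g)))//; apply: eq_bigr => g _.
  by congr (`|\det _|); apply/matrixP => i j; rewrite !mxE ffunE.
rewrite -(pair_bigA _ (fun k g => a (h (inr (k, g)))))/=.
rewrite (eq_bigr (fun=> minors_sum (col' ord0 (row' ord0 W)))) => [|k _].
  by rewrite sumr_const card_ord mulr_natl.
apply: eq_bigr => g _; rewrite /a (expand_det_row _ k) (bigD1 ord0)//= big1 ?addr0.
  rewrite !mxE ffunE unlift_none.
  have -> : W ord0 ord0 = 1.
    by have /rowP/(_ ord0) := W0; rewrite !mxE eqxx.
  rewrite mul1r /cofactor normrM normrX normrN1 expr1n mul1r.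
  congr (`|\det _|); apply/matrixP => i j; rewrite !mxE ffunE liftK.
  done.
move=> j j0; rewrite !mxE ffunE unlift_none.
by have /rowP/(_ j) := W0; rewrite !mxE (negbTE j0) andbF => ->; rewrite mul0r.
Qed.

Lemma exists_unit_to_e0 n (v : 'rV[R]_n.+1) : v != 0 ->
  exists A : 'M[R]_n.+1, \det A != 0 /\ v *m A = e0 R n.
Proof.
move=> v0; have r1 : \rank v = 1%N by rewrite rank_rV v0.
have := mulmx_ebase v; rewrite r1 => ve.
have uc := col_ebase_unit v; have ur := row_ebase_unit v.
pose c := col_ebase v ord0 ord0.
have cE : col_ebase v = c%:M by rewrite [LHS]mx11_scalar.
have c0 : c != 0 by move: uc; rewrite unitmxE cE det_scalar1 unitfE.
exists (c^-1 *: invmx (row_ebase v)); split.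
  rewrite detZ det_inv mulf_neq0 ?expf_neq0 ?invr_eq0//.
  by rewrite unitmxE unitfE in ur.
rewrite -{1}ve cE -scalemxAr mulmxK// mul_scalar_mx scalerA mulVf// scale1r.
by apply/rowP => j; rewrite !mxE eqxx andbT eq_sym /=.
Qed.

(* Once the first generator is e_0, adding it lengthens every section in this
   direction by 2, which costs twice the volume of the projection along e_0. *)
Theorem zonotope_volume m n (V : 'M[R]_(m, n)) :
  (mu (zonotope V) <= (2 ^+ n / n`!%:R * minors_sum V)%:E)%E.
Proof.
elim: m n V => [|m IH] [|n] V.
- rewrite (_ : zonotope V = cube 0 0); last first.
    apply/seteqP; split => x _; first by move=> [].
    by exists 0; [move=> []|apply/rowP => -[]].
  rewrite lebesgue_cube// !expr0 fact0 divr1 mul1r lee_fin /minors_sum.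
  rewrite (bigD1 [ffun i : 'I_0 => match i with Ordinal _ p => False_rect _ (notF p) end])//=.
  by rewrite det_mx00 normr1 lerDl sumr_ge0.
- apply: (@le_trans _ _ 0%:E); last first.
    by rewrite lee_fin mulr_ge0 ?sumr_ge0// divr_ge0.
  have := @lebesgue_cube R n.+1 0 0 (lexx 0); rewrite mulr0 expr0n/= => <-.
  apply: lebesgue_rV_mono => x [s _ <-] i.
  by rewrite !mxE big_ord0 subr0 normr0.
- apply: (@le_trans _ _ 1%:E).
    have := @lebesgue_cube R 0 0 0 (lexx 0); rewrite expr0 => <-.
    by apply: lebesgue_rV_mono => x _ [].
  rewrite expr0 fact0 divr1 mul1r lee_fin /minors_sum.
  rewrite (bigD1 [ffun=> ord0])//=.
  by rewrite det_mx00 normr1 lerDl sumr_ge0.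
have [v0|v0] := eqVneq (row ord0 V) 0.
  apply: (@le_trans _ _ (mu (zonotope (row' ord0 V)))).
    apply: lebesgue_rV_mono => x /zonotopeS[t [_]].
    by rewrite v0 scaler0 addr0.
  apply: le_trans (IH _ _) _; rewrite lee_fin; apply: ler_wpM2l; first by rewrite divr_ge0.
  exact: minors_sum_row'.
have [A [A0 vA]] := exists_unit_to_e0 v0.
pose W := V *m A.
have W0 : row ord0 W = e0 R n by rewrite -vA row_mul.
(* A linear change of coordinates multiplies the volume and every minor by |det A|, so the first
   generator may be taken to be e_0. *)
suff hW : (mu (zonotope W) <= (2 ^+ n.+1 / n.+1`!%:R * minors_sum W)%:E)%E.
  have mV := compact_rV_measurable (@zonotope_compact R _ _ V).
  move: hW; rewrite /W zonotope_mulmx lebesgue_rV_linear//.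
  rewrite minors_sum_mulmx mulrA [X in (_ <= X%:E)%E]mulrC EFinM lee_pmul2l//.
  by rewrite lte_fin normr_gt0.
apply: (@le_trans _ _ (mu (zonotope (row' ord0 W)) +
    2%:E * mu (zonotope (col' ord0 (row' ord0 W))))%E).
  apply: lebesgue_rV_thickening; try exact: zonotope_compact.
  - by move=> x y u; exact: zonotope_convex.
  - move=> x [s hs <-]; exists s => //.
    apply/rowP => j; rewrite !mxE; apply: eq_bigr => i _.
    by rewrite !mxE.
  - by move=> x /zonotopeS[t]; rewrite W0 => ?; exists t.
apply: (@le_trans _ _ ((2 ^+ n.+1 / n.+1`!%:R * minors_sum (row' ord0 W))%:E +
   2%:E * (2 ^+ n / n`!%:R * minors_sum (col' ord0 (row' ord0 W)))%:E)%E).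
  by rewrite leeD ?IH// lee_pmul2l// ?lte_fin.
rewrite -EFinM -EFinD lee_fin.
have c0 : 0 <= 2 ^+ n.+1 / n.+1`!%:R :> R by rewrite divr_ge0.
apply: le_trans (ler_wpM2l c0 (minors_sum_e0 W0)).
(* The n + 1 positions of e_0 in a selection reduce (n + 1)! to n!, and the 2 from the thickening
   completes the power of 2. *)
rewrite mulrDr lerD2l factS natrM exprS.
have key (x y p s : R) : x != 0 -> y != 0 -> 2 * p / (x * y) * (x * s) = 2 * (p / y * s).
  by move=> h1 h2; field; rewrite h1 h2.
by rewrite key// pnatr_eq0// -lt0n fact_gt0.
Qed.

End ZonotopeVolume.

(** * The class calH *)

Section FunctionalSubgraphs.
Variables (R : realType) (N : nat) (G : wdigraph R N).
Implicit Types (phi psi : 'I_N -> 'I_N) (V : {set 'I_N}) (A : {set 'I_N * 'I_N}).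

Definition fm phi V : 'M[R]_N :=
  fmx (fun v => weight G v (phi v)) (fun v => weight G (phi v) v) phi V.

Lemma fm_ext phi psi V : {in V, phi =1 psi} -> fm phi V = fm psi V.
Proof.
move=> e; apply/matrixP => v u; rewrite !mxE; case: ifP => // vV.
by rewrite e.
Qed.

(* A consists, up to orientation, of the pairs {v, phi v} with v in V, and
   these pairs are distinct. *)
Definition fun_arcs phi V A : Prop :=
  [/\ forall v, v \in V -> (v, phi v) \in A,
      forall x y, ((x, y) \in A) || ((y, x) \in A) =
        (x \in V) && (phi x == y) || (y \in V) && (phi y == x),
      forall v, v \in V -> phi v != v &
      forall v, v \in V -> phi v \in V -> phi (phi v) != v].

Lemma edges_neq x y : (x, y) \in edges G -> y != x.
Proof. by apply: contraTneq => ->; exact: edges_loopless. Qed.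

Lemma graph_weight_ge0 (H : graph N) : 0 <= graph_weight G H.
Proof.
apply: prodr_ge0 => -[x y] _ /=.
have [/weight_gt0/ltW//|/weight_eq0 ->//] := boolP ((x, y) \in edges G).
Qed.

Lemma fconnect_2cycle phi v r : phi (phi v) = v -> fconnect phi v r -> r = v \/ r = phi v.
Proof.
move=> pp /iter_findex <-; elim: (findex _ _ _) => [|k IH] /=; first by left.
by case: IH => ->; [right|rewrite pp; left].
Qed.

Lemma ditree_fun_arcs r T : ditree_rooted G r T ->
  [/\ fun_arcs (outf T) (verts T :\ r) (arcs T),
      forall v, v \in verts T -> outf T v \in verts T,
      forall v, v \in verts T -> fconnect (outf T) v r,
      outf T r = r &
      graph_weight G T = \prod_(v in verts T :\ r) weight G v (outf T v)].
Proof.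
move=> tr; have [pr arcsE cl conn arc] := ditree_rooted_out tr.
have [[sG _] _ rT _ _] := tr.
split => //; last by rewrite /graph_weight arcsE big_arcs_fun.
split.
- by move=> v; rewrite !inE => /andP[vr vT]; exact: arc.
- move=> x y; have mem a b : ((a, b) \in arcs T) = (a \in verts T :\ r) && (outf T a == b).
    rewrite {1}arcsE; apply/imsetP/andP; first by move=> [v vT [-> ->]].
    by move=> [aT /eqP <-]; exists a.
  by rewrite !mem.
- move=> v; rewrite !inE => /andP[vr vT]; apply: edges_neq.
  by apply: (fintype.subsetP sG); exact: arc.
- move=> v; rewrite !inE => /andP[vr vT] /andP[pr' _]; apply/eqP => pp.
  by have [rv|rv] := fconnect_2cycle pp (conn v vT); [rewrite -rv eqxx in vr|rewrite -rv eqxx in pr'].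
Qed.

Lemma next_next_neq (c : seq 'I_N) v : uniq c -> (2 < size c)%N -> v \in c ->
  next c (next c v) != v.
Proof.
move=> uc sc vc; have [i s rs] := rot_to vc.
rewrite -!(next_rot i uc) rs.
have : uniq (v :: s) by rewrite -rs rot_uniq.
have : (2 < size (v :: s))%N by rewrite -rs size_rot.
case: s {rs} => [//|y [//|z s]] _ /=; rewrite !inE !negb_or.
move=> /andP[/and3P[vy vz _] /andP[/andP[yz _] _]].
by rewrite eqxx [y == v]eq_sym (negbTE vy) eqxx eq_sym.
Qed.

Lemma next_neq (c : seq 'I_N) v : uniq c -> (2 < size c)%N -> v \in c ->
  next c v != v.
Proof.
move=> uc sc vc; have := next_next_neq uc sc vc.
by apply: contraNneq => e; rewrite !e.
Qed.

(** Both types of rings fit one formula: for a single cycle some reversed arc is not an edge of [G],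
    so it has weight 0 and the backward product vanishes. *)
Lemma is_ringP Q wQ : is_ring G Q wQ -> exists c : seq 'I_N,
  [/\ uniq c, (2 < size c)%N, verts Q = [set x in c]%SET,
      forall x y, ((x, y) \in arcs Q) || ((y, x) \in arcs Q) =
        (x \in c) && (next c x == y) || (y \in c) && (next c y == x) &
      (forall x, x \in c -> (x, next c x) \in arcs Q) /\
      wQ = `|\prod_(x in c) weight G x (next c x) - \prod_(x in c) weight G (next c x) x| ].
Proof.
have gw C c : uniq c -> arcs C = [set (x, next c x) | x in c]%SET ->
  graph_weight G C = \prod_(x in c) weight G x (next c x).
  by move=> uc aC; rewrite /graph_weight aC big_imset//= => x y _ _ [].
have gwr C c : uniq c -> arcs C = [set (x, next c x) | x in c]%SET ->
  graph_weight G (reverse C) = \prod_(x in c) weight G (next c x) x.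
  move=> uc aC; rewrite /graph_weight /reverse /arcs /= -/(arcs C) aC -imset_comp.
  by rewrite big_imset//= => x y _ _ [].
have memC (C : graph N) c : arcs C = [set (x, next c x) | x in c]%SET ->
    forall x y, ((x, y) \in arcs C) = (x \in c) && (next c x == y).
  move=> aC x y; rewrite aC; apply/imsetP/andP; first by move=> [v vT [-> ->]].
  by move=> [aT /eqP <-]; exists x.
have memR (C : graph N) x y : ((x, y) \in arcs (reverse C)) = ((y, x) \in arcs C).
  apply/imsetP/idP; first by move=> [[a b] ab [-> ->]].
  by move=> yx; exists (y, x).
case=> [C [c [uc sc vC aC]] [sub _] nsub|C [c [uc sc vC aC]] _ _]; exists c; split => //.
- by move=> x y; rewrite !(memC C c aC).
- split; first by move=> x xc; rewrite (memC C c aC) xc eqxx.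
  rewrite (gw C c)// -(gwr C c)//.
  suff -> : graph_weight G (reverse C) = 0.
    by rewrite subr0 ger0_norm// -(gw C c)// graph_weight_ge0.
  have /subsetPn[e eC eG] : ~~ (arcs (reverse C) \subset edges G).
    apply/negP => sR; apply: nsub; split => // -[x y].
    rewrite memR (memC C c aC) /verts/= -/(verts C) vC => /andP[yc /eqP <-].
    by rewrite !inE mem_next.
  rewrite /graph_weight (bigD1 e)//=; case: e eC eG => x y _ /weight_eq0 /= ->.
  by rewrite mul0r.
- by rewrite /gunion /reverse /verts/= finset.setUid.
- move=> x y; have gU a b : ((a, b) \in arcs (gunion C (reverse C))) =
    ((a, b) \in arcs C) || ((b, a) \in arcs C) by rewrite finset.in_setU memR.
  rewrite !gU !(memC C c aC).
  by case: (_ && _); case: (_ && _).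
- split; first by move=> x xc; rewrite /gunion /arcs/= -/(arcs C) finset.in_setU (memC C c aC) xc eqxx.
  by rewrite (gw C c)// (gwr C c).
Qed.

(** [phi] goes around the ring and follows the tree arcs elsewhere. It never leads from the ring
    into the trees, so the determinant splits into a cycle part, which is the ring weight up to
    sign, and an acyclic part, the product of the tree weights. *)
Lemma ring_trees_fun K wK : ring_trees G K wK -> exists phi,
  [/\ fun_arcs phi (verts K) (arcs K),
      forall v, v \in verts K -> phi v \in verts K &
      wK = `|\det (fm phi (verts K))| ].
Proof.
move=> [Q [wQ [Tr [ring tr disj KE wE]]]].
have [c [uc sc vQ aQ [aQ' wQE]]] := is_ringP ring.
have memQ x : (x \in verts Q) = (x \in c) by rewrite vQ inE.
have trr r : r \in c -> ditree_rooted G r (Tr r) by rewrite -memQ => /tr[].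
have trQ r x : r \in c -> x \in c -> x \in verts (Tr r) -> x = r.
  rewrite -!memQ => rQ xQ xT; have [_ /setP/(_ x)] := tr r rQ.
  by rewrite !inE xT xQ => /esym/eqP.
have trU r s x : r \in c -> s \in c -> x \in verts (Tr r) -> x \in verts (Tr s) -> r = s.
  rewrite -!memQ => rQ sQ xr xs; apply/eqP/negPn/negP => rs.
  by have := disj r s rQ sQ rs; rewrite /vdisjoint => /disjointFr/(_ xr); rewrite xs.
have rTr r : r \in c -> r \in verts (Tr r) by move=> /trr[].
pose rt v := if [pick r | (r \in c) && (v \in verts (Tr r))] is Some r then r else v.
have rtE r v : r \in c -> v \in verts (Tr r) -> rt v = r.
  move=> rc vr; rewrite /rt; case: pickP => [s /andP[sc' vs]|/(_ r)].
    exact: (trU s r v).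
  by rewrite rc vr.
pose phi v := if v \in c then next c v else outf (Tr (rt v)) v.
have phic v : v \in c -> phi v = next c v by rewrite /phi => ->.
have phit r v : r \in c -> v \in verts (Tr r) :\ r -> phi v = outf (Tr r) v.
  move=> rc; rewrite !inE => /andP[vr vT]; rewrite /phi (rtE r v)//.
  by case: ifP => // vc; rewrite (trQ r v) ?eqxx in vr.
(* The tree vertices without their roots, which are counted with the ring. *)
pose W := \bigcup_(r in verts Q) (verts (Tr r) :\ r).
have VK : verts K = [set x in c]%SET :|: W.
  rewrite KE /verts/= -/(verts Q) vQ; apply/setP => x; rewrite !inE.
  have [//|xc] := boolP (x \in c); rewrite /=.
  apply/bigcupP/bigcupP => -[r]; rewrite inE => rc.
    move=> xr; exists r; rewrite ?inE ?memQ// xr andbT.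
    by apply: contraNneq xc => ->.
  by rewrite memQ in rc; rewrite !inE => /andP[_ xr]; exists r; rewrite ?inE.
have inW v : v \in W -> exists2 r, r \in c & v \in verts (Tr r) :\ r.
  by move=> /bigcupP[r rQ vr]; exists r; rewrite // -memQ.
have Win r v : r \in c -> v \in verts (Tr r) :\ r -> v \in W.
  by move=> rc vr; apply/bigcupP; exists r; rewrite // memQ.
have WC v : v \in W -> v \notin c.
  move=> /inW[r rc]; rewrite !inE => /andP[vr vT]; apply: contra vr => vc.
  by rewrite (trQ r v).
have VKin r v : r \in c -> v \in verts (Tr r) -> v \in verts K.
  move=> rc vr; rewrite VK !inE; have [->|ne] := eqVneq v r; first by rewrite rc.
  by rewrite (Win r) ?orbT// !inE ne.
have cl v : v \in verts K -> phi v \in verts K.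
  rewrite VK !inE => /orP[vc|/inW[r rc vT]].
    by rewrite phic// mem_next vc.
  have [_ clT _ _ _] := ditree_fun_arcs (trr r rc).
  have := VKin r (phi v) rc; rewrite VK !inE; apply; rewrite (phit r)// clT//.
  by move: vT; rewrite !inE => /andP[].
have arcsK x y : ((x, y) \in arcs K) = ((x, y) \in arcs Q) ||
    [exists r in c, (x, y) \in arcs (Tr r)].
  rewrite KE {1}/arcs/= -/(arcs Q) finset.in_setU; congr (_ || _).
  apply/bigcupP/existsP => -[r].
    by rewrite memQ => rc ra; exists r; rewrite rc.
  by move=> /andP[rc ra]; exists r; rewrite ?memQ.
exists phi; split => //.
- split.
  + move=> v; rewrite VK !inE arcsK => /orP[vc|/inW[r rc vT]].
      by rewrite phic// aQ'.
    apply/orP; right; apply/existsP; exists r; rewrite rc (phit r)//=.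
    by have [[h _ _ _] _ _ _ _] := ditree_fun_arcs (trr r rc); exact: h.
  + move=> x y; rewrite !arcsK.
    have treeE a b : [exists r in c, (a, b) \in arcs (Tr r)] ||
        [exists r in c, (b, a) \in arcs (Tr r)] =
        (a \in W) && (phi a == b) || (b \in W) && (phi b == a).
      apply/idP/idP.
        move=> /orP[]/existsP[r /andP[rc ab]];
        have [[_ h _ _] _ _ _ _] := ditree_fun_arcs (trr r rc).
          have := h a b; rewrite ab/= => /esym/orP[]/andP[aT ea].
            by rewrite (Win r)// (phit r)// ea.
          by rewrite (Win r b)// (phit r b)// ea orbT.
        have := h a b; rewrite ab/= orbT => /esym/orP[]/andP[aT ea].
          by rewrite (Win r)// (phit r)// ea.
        by rewrite (Win r b)// (phit r b)// ea orbT.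
      move=> /orP[]/andP[/inW[r rc vT]] /eqP <-; rewrite (phit r)//;
      have [[h _ _ _] _ _ _ _] := ditree_fun_arcs (trr r rc).
        by apply/orP; left; apply/existsP; exists r; rewrite rc h.
      by apply/orP; right; apply/existsP; exists r; rewrite rc h.
    rewrite orbACA aQ treeE VK !inE.
    have [xc|xc] := boolP (x \in c); have [yc|yc] := boolP (y \in c); rewrite /= ?(phic x xc) ?(phic y yc).
    * by rewrite (contraTF (@WC x)) ?negbK// (contraTF (@WC y)) ?negbK//= orbF.
    * by rewrite (contraTF (@WC x)) ?negbK//= orbF.
    * by rewrite (contraTF (@WC y)) ?negbK//= orbF orbC.
    * by [].
  + move=> v; rewrite VK !inE => /orP[vc|/inW[r rc vT]].
      by rewrite phic// next_neq.
    by rewrite (phit r)//; have [[_ _ h _] _ _ _ _] := ditree_fun_arcs (trr r rc); exact: h.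
  + move=> v; rewrite VK !inE => /orP[vc|/inW[r rc vT]].
      by rewrite phic// !phic ?mem_next// next_next_neq.
    have [[_ _ _ h] clT _ _ _] := ditree_fun_arcs (trr r rc).
    have pv : phi v \in verts (Tr r).
      by rewrite (phit r)// clT//; move: vT; rewrite !inE => /andP[].
    have [pr|pr] := eqVneq (phi v) r => _.
      rewrite pr phic//; apply: contraTneq vT => <-.
      rewrite !inE; apply/negP => /andP[ne nT]; move: ne.
      by rewrite (trQ r (next c r)) ?mem_next ?eqxx.
    have pT : phi v \in verts (Tr r) :\ r by rewrite !inE pr pv.
    rewrite (phit r (phi v))//; move: pT; rewrite (phit r)// => pT.
    exact: h.
- rewrite VK /fm fmxU.
  + rewrite det_mulmx normrM wE wQE; congr (_ * _).
      rewrite det_fmx_cycle//; last 2 first.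
      * have h := cycle_next uc.
        by apply: (sub_in_cycle (P := mem c)) h; [move=> x y xc _ /eqP <-; rewrite /= phic|apply/allP].
      * by case: (c) sc.
      congr (`|_ - _|); apply: eq_bigr => x xc; by rewrite phic.
    rewrite det_fmx_acyclic; last first.
      move=> v /inW[r rc]; rewrite inE => /andP[_ vT].
      have [_ clT conn _ _] := ditree_fun_arcs (trr r rc).
      have := iter_findex (conn v vT).
      move: (findex _ _ _) => k; elim: k v vT => [|k IH] v vT /=.
        by move=> ->; exists 0%N => /=; apply: contraL rc => /WC.
      rewrite -iterS iterSr => h.
      have [->|vr] := eqVneq v r.
        by exists 0%N => /=; apply: contraL rc => /WC.
      have [k' hk'] := IH _ (clT v vT) h.
      by exists k'.+1; rewrite iterSr (phit r) ?inE ?vr.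
    rewrite [X in _ = `|X|](partition_big rt (fun r => r \in verts Q)) /=; last first.
      by move=> v /inW[r rc]; rewrite inE => /andP[_ vT]; rewrite (rtE r)// memQ.
    rewrite ger0_norm; last first.
      by apply: prodr_ge0 => r _; apply: prodr_ge0 => v _; have [/weight_gt0/ltW//|/weight_eq0 ->//] := boolP ((v, phi v) \in edges G).
    apply: eq_bigr => r; rewrite memQ => rc.
    have [_ _ _ _ ->] := ditree_fun_arcs (trr r rc).
    apply: eq_big => v; last by move=> vT; rewrite (phit r).
    apply/idP/andP; first by move=> vT; rewrite (Win r)//; split => //; apply/eqP/(rtE r) => //; move: vT; rewrite !inE => /andP[].
    move=> [/inW[s sc' vT] /eqP rv]; move: (vT); rewrite inE => /andP[_ vs].
    by rewrite -rv (rtE s).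
  + rewrite -finset.setI_eq0; apply/eqP/setP => x; rewrite !inE.
    by apply/negP => /andP[xc /WC]; rewrite xc.
  + by move=> v; rewrite inE => vc; rewrite phic//; apply/negP => /WC; rewrite mem_next vc.
Qed.

End FunctionalSubgraphs.

Section Gluing.
Variables (R : realType) (N : nat) (G : wdigraph R N).

Lemma det_fm_bigcup (phi : 'I_N -> 'I_N) (r : seq (graph N)) : uniq r ->
  {in r &, forall K L, K != L -> vdisjoint K L} ->
  (forall K v, K \in r -> v \in verts K -> phi v \in verts K) ->
  \det (fm G phi (\bigcup_(K <- r) verts K)) = \prod_(K <- r) \det (fm G phi (verts K)).
Proof.
elim: r => [|K r IH] /=; first by move=> _ _ _; rewrite !big_nil /fm fmx_set0 det1.
move=> /andP[Kr ur] disj cl; rewrite !big_cons.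
have dK : [disjoint verts K & \bigcup_(L <- r) verts L].
  rewrite -finset.setI_eq0; apply/eqP/setP => v; rewrite !inE.
  apply/negP => /andP[vK]; rewrite finset.bigcup_seq => /bigcupP[L Lr vL].
  have KL : K != L by apply: contraNneq Kr => ->.
  have := disj K L; rewrite !inE eqxx Lr orbT => /(_ isT isT KL).
  by rewrite /vdisjoint => /disjointFr/(_ vK); rewrite vL.
rewrite /fm fmxU//; last first.
  by move=> v vK; rewrite (disjointFr dK)// (cl K)// inE eqxx.
rewrite det_mulmx -/(fm G phi _) -/(fm G phi _) IH//.
- by move=> A B Ar Br; apply: disj; rewrite inE ?Ar ?Br orbT.
- by move=> A v Ar; apply: cl; rewrite inE Ar orbT.
Qed.

(** Turns a weight read off from an arbitrary decomposition of [H] into a determinant. Comparing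
    this determinant with a minor later makes the value independent of the decomposition. The vertex
    i is the root of the tree without ring. *)
Lemma tree_rings_fun H w : tree_rings G H w -> exists i phi,
  [/\ fun_arcs phi (~: [set i]) (arcs H), forall u, (i, u) \notin arcs H &
      w = `|\det (fm G phi (~: [set i]))| ].
Proof.
move=> [T [Ks [wK [[i tr] hK disj HE [HT wE]]]]].
have /boolp.choice[phiK hphi] K : exists phi, K \in Ks ->
  [/\ fun_arcs phi (verts K) (arcs K),
      forall v, v \in verts K -> phi v \in verts K &
      wK K = `|\det (fm G phi (verts K))| ].
  have [KKs|] := boolP (K \in Ks); last by exists id.
  by have [/ring_trees_fun[phi hphi] _] := hK K KKs; exists phi.
pose kf v := [pick K | (K \in Ks) && (v \in verts K)].
pose phi v := if v \in verts T then outf T v else if kf v is Some K then phiK K v else v.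
have phiT v : v \in verts T -> phi v = outf T v by rewrite /phi => ->.
have TK K v : K \in Ks -> v \in verts T -> v \notin verts K.
  by move=> /hK[_]; rewrite /vdisjoint => /disjointFr h /h ->.
have phiKE K v : K \in Ks -> v \in verts K -> phi v = phiK K v.
  move=> KKs vK; rewrite /phi; case: ifP => [/(TK K v KKs)|_]; first by rewrite vK.
  rewrite /kf; case: pickP => [L /andP[LKs vL]|/(_ K)]; last by rewrite KKs vK.
  have [->//|LK] := eqVneq L K.
  by have := disj _ _ LKs KKs LK; rewrite /vdisjoint => /disjointFr/(_ vL); rewrite vK.
have cover v : v \in verts T \/ exists2 K, K \in Ks & v \in verts K.
  have : v \in verts H by rewrite HT inE.
  rewrite HE finset.in_setU => /orP[|/bigcupP[K KKs vK]]; first by left.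
  by right; exists K.
have arcsH x y : ((x, y) \in arcs H) = ((x, y) \in arcs T) || [exists K in Ks, (x, y) \in arcs K].
  rewrite HE {1}/arcs/= -/(arcs T) finset.in_setU; congr (_ || _).
  by apply/bigcupP/exists_inP.
have [fT clT connT pr wT] := ditree_fun_arcs tr.
have [_ _ iT o0 _] := tr.
have endK K x y : K \in Ks -> (x, y) \in arcs K -> x \in verts K.
  move=> KKs xy; have [[_ h _ _] cl _] := hphi K KKs.
  by have := h x y; rewrite xy => /esym/orP[/andP[]//|/andP[yK /eqP <-]]; exact: cl.
exists i, phi; split.
- split.
  + move=> v; rewrite !inE => vi; rewrite arcsH.
    have [vT|[K KKs vK]] := cover v.
      by rewrite phiT//; have [-> //] := fT; rewrite !inE vi.
    by apply/orP; right; apply/exists_inP; exists K; rewrite // (phiKE K)//; have [[-> //]] := hphi K KKs.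
  + move=> x y; rewrite !arcsH orbACA !inE.
    have -> : ((x, y) \in arcs T) || ((y, x) \in arcs T) =
       (x \in verts T :\ i) && (phi x == y) || (y \in verts T :\ i) && (phi y == x).
      have [_ -> _ _] := fT; congr (_ || _).
        by have [xT|//] := boolP (x \in verts T :\ i); rewrite phiT//; move: xT; rewrite !inE => /andP[].
      by have [xT|//] := boolP (y \in verts T :\ i); rewrite phiT//; move: xT; rewrite !inE => /andP[].
    have -> : [exists K in Ks, (x, y) \in arcs K] || [exists K in Ks, (y, x) \in arcs K] =
       (x \notin verts T) && (phi x == y) || (y \notin verts T) && (phi y == x).
      have aux K a b : K \in Ks -> (a, b) \in arcs K ->
         (a \notin verts T) && (phi a == b) || (b \notin verts T) && (phi b == a).
        move=> KKs ab; have [[_ h _ _] _ _] := hphi K KKs.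
        have := h a b; rewrite ab/= => /esym/orP[]/andP[aK]; rewrite -(phiKE K)// => ->.
          by rewrite andbT (contraL (TK K a KKs)).
        by rewrite andbT (contraL (TK K b KKs))// orbT.
      have aux2 a : a \notin verts T -> [exists K in Ks, (a, phi a) \in arcs K].
        move=> aT; have [|[K KKs aK]] := cover a; first by rewrite (negbTE aT).
        by apply/exists_inP; exists K; rewrite // (phiKE K)//; have [[-> //]] := hphi K KKs.
      apply/idP/idP.
        move=> /orP[]/exists_inP[K KKs ab]; first exact: aux ab.
        by rewrite orbC; exact: aux ab.
      by move=> /orP[]/andP[/aux2 + /eqP e]; rewrite e => ->; rewrite ?orbT.
    rewrite !inE; have aux (a : 'I_N) : (a != i) = (a != i) && (a \in verts T) || (a \notin verts T).
      have [->|_] /= := eqVneq a i; first by rewrite iT.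
      by case: (a \in verts T).
    rewrite [in RHS](aux x) [in RHS](aux y) !andb_orl.
    by rewrite orbACA.
  + move=> v; rewrite !inE => vi; have [vT|[K KKs vK]] := cover v.
      by rewrite phiT//; have [_ _ -> //] := fT; rewrite !inE vi.
    by rewrite (phiKE K)//; have [[_ _ -> //]] := hphi K KKs.
  + move=> v; rewrite !inE => vi pvi; have [vT|[K KKs vK]] := cover v.
      have pT := clT v vT; rewrite phiT// in pvi *; rewrite phiT//.
      by have [_ _ _ -> //] := fT; rewrite !inE ?vi ?pvi.
    have [[_ _ _ h] cl _] := hphi K KKs; have pK := cl v vK.
    by rewrite (phiKE K v)// (phiKE K)// h.
- move=> u; rewrite arcsH negb_or (outdeg0 u o0)/=.
  by apply/exists_inP => -[K KKs /(endK K _ _ KKs)]; apply/negP; exact: TK.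
- have -> : ~: [set i] = (\bigcup_(K <- enum Ks) verts K) :|: (verts T :\ i).
    apply/setP => v; rewrite !inE big_enum.
    have [vT|[K KKs vK]] := cover v.
      rewrite vT andbT; have [->|] := eqVneq v i; last by rewrite orbT.
      by rewrite orbF; apply/esym/bigcupP => -[K KKs]; apply/negP; exact: TK.
    have vi : v != i by apply: contraTneq vK => ->; exact: TK.
    by rewrite vi; apply/esym/orP; left; apply/bigcupP; exists K.
  rewrite /fm fmxU -/(fm G phi _) -/(fm G phi _); last 2 first.
  + rewrite -finset.setI_eq0; apply/eqP/setP => v; rewrite !inE big_enum.
    apply/negP => /andP[/bigcupP[K KKs vK] /andP[_ vT]].
    by have := TK K v KKs vT; rewrite vK.
  + move=> v; rewrite big_enum => /bigcupP[K KKs vK]; rewrite !inE negb_and.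
    have [_ cl _] := hphi K KKs.
    by rewrite (phiKE K)// (contraL (TK K _ KKs)) ?orbT// cl.
  rewrite det_mulmx normrM wE mulrC; congr (_ * _).
    rewrite det_fm_bigcup ?enum_uniq//; last 2 first.
    + by move=> K L; rewrite !mem_enum; exact: disj.
    + move=> K v; rewrite mem_enum => KKs vK; have [_ cl _] := hphi K KKs.
      by rewrite (phiKE K)// cl.
    rewrite big_enum normr_prod; apply: eq_bigr => K KKs.
    have [_ _ ->] := hphi K KKs; congr (`|\det _|); apply: fm_ext => v vK.
    by rewrite (phiKE K).
  rewrite /fm det_fmx_acyclic; last first.
    move=> v; rewrite inE => /andP[_ vT]; have := iter_findex (connT v vT).
    move: (findex _ _ _) => k; elim: k v vT => [|k IH] v vT /=.
      by move=> ->; exists 0%N => /=; rewrite !inE eqxx.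
    rewrite -iterS iterSr => /(IH _ (clT v vT))[k' hk'].
    by exists k'.+1; rewrite iterSr phiT.
  rewrite ger0_norm; last first.
    by apply: prodr_ge0 => v _; have [/weight_gt0/ltW//|/weight_eq0 ->//] := boolP ((v, phi v) \in edges G).
  by rewrite wT; apply: eq_bigr => v; rewrite inE => /andP[_ vT]; rewrite phiT.
Qed.

End Gluing.

(** * From a functional graph to an element of [calH] *)

Section Decomposition.
Variables (R : realType) (N : nat) (G : wdigraph R N) (i : 'I_N) (phi : 'I_N -> 'I_N).
Hypotheses (phi_i : phi i = i) (phiE : forall v, v != i -> (v, phi v) \in edges G)
  (phi2 : forall v, v != i -> phi (phi v) != v).

(* per v: v lies on a cycle of phi.  Cutting the cycles, every vertex reaches one
   of their vertices under psi. *)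
Let per v := fconnect phi (phi v) v.
Let psi v := if per v then v else phi v.

Let psi_per r : per r -> psi r = r. Proof. by rewrite /psi => ->. Qed.

Let exists_per v : exists2 r, per r & fconnect psi v r.
Proof.
suff [k pk] : exists k, per (iter k phi v).
  elim: k v pk => [|k IH] v pk; first by exists v.
  have [pv|pv] := boolP (per v); first by exists v.
  rewrite iterSr in pk; have [r pr cr] := IH _ pk; exists r => //.
  have pvE : phi v = psi v by rewrite /psi (negbTE pv).
  by apply: connect_trans cr; rewrite pvE fconnect1.
(* Pigeonhole on N + 1 iterates: two of them agree, and the earlier one is periodic. *)
have [j [k [jk e]]] : exists j k, (j < k)%N /\ iter j phi v = iter k phi v.
  have : ~~ injectiveb (fun k : 'I_N.+1 => iter k phi v).
    apply/injectiveP => /leq_card; rewrite !card_ord ltnn.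
    by [].
  move=> /injectivePn[j [k jk e]].
  case: (ltngtP j k) => h; first by exists j, k.
    by exists k, j.
  by rewrite (val_inj h) eqxx in jk.
exists j; rewrite /per [X in fconnect _ _ X]e -iterS.
by rewrite -(subnK jk) iterD fconnect_iter.
Qed.

Let tree r : graph N := ([set v | fconnect psi v r],
  [set (v, psi v) | v in [set v | fconnect psi v r] :\ r]).

Let verts_tree r v : (v \in verts (tree r)) = fconnect psi v r.
Proof. by rewrite inE. Qed.

Let per_i : per i. Proof. by rewrite /per phi_i connect0. Qed.

Let psi_inj v r s : per r -> per s -> fconnect psi v r -> fconnect psi v s -> r = s.
Proof. by move=> pr ps; apply: fconnect_fixed; exact: psi_per. Qed.

Let tree_nper r v : per r -> v != r -> fconnect psi v r -> ~~ per v.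
Proof.
move=> pr vr vc; apply: contra vr => pv; apply/eqP.
by apply: (psi_inj pv pr (connect0 _ _) vc).
Qed.

Let ditree_tree r : per r -> ditree_rooted G r (tree r).
Proof.
move=> pr; apply: ditree_rooted_fun.
- by rewrite inE connect0.
- move=> v; rewrite !inE => vc vr; split; first exact: fconnect_next.
  have nv := tree_nper pr vr vc; rewrite /psi (negbTE nv); apply: phiE.
  by apply: contraNneq nv => ->.
- by move=> v; rewrite inE.
Qed.

Let orb r := [set y | fconnect phi r y].
Let cyc (O : {set 'I_N}) : graph N := (O, [set (y, phi y) | y in O]).
(** Where [G] contains the reversed cycle a single ring is not allowed, so it is added. This is why
    the arcs of the resulting graph match those of [phi] only up to orientation. *)
Let ring (O : {set 'I_N}) : graph N :=
  if arcs (reverse (cyc O)) \subset edges G then gunion (cyc O) (reverse (cyc O))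
  else cyc O.
(** Indexed by the vertex set of the cycle rather than by a representative, so that all vertices of
    a cycle give the same component. *)
Let comp (O : {set 'I_N}) : graph N :=
  (verts (ring O) :|: \bigcup_(r in verts (ring O)) verts (tree r),
   arcs (ring O) :|: \bigcup_(r in verts (ring O)) arcs (tree r)).

Let verts_ring O : verts (ring O) = O.
Proof. by rewrite /ring; case: ifP => _ //; rewrite /gunion /reverse /verts/= finset.setUid. Qed.

Let per_cycle r : per r -> fcycle phi (fingraph.orbit phi r).
Proof. by rewrite /per fconnect_f. Qed.

Let orb_per r s : per r -> s \in orb r -> per s /\ fconnect phi s r.
Proof.
move=> /per_cycle c; rewrite inE => rs.
have so : s \in fingraph.orbit phi r by rewrite -fconnect_orbit.
have po : phi s \in fingraph.orbit phi r.
  by rewrite -fconnect_orbit; apply: connect_trans rs _; exact: fconnect1.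
by split; apply: (connect_cycle c) => //; exact: fingraph.in_orbit.
Qed.

Let orb_eq r s : per r -> s \in orb r -> orb r = orb s.
Proof.
move=> pr so; have [_ sr] := orb_per pr so; rewrite inE in so.
apply/setP => y; rewrite !inE; apply/idP/idP; exact: connect_trans.
Qed.

Let orb_neq_i r s : per r -> r != i -> s \in orb r -> s != i.
Proof.
move=> pr ri so; apply: contra ri => /eqP si; have [_ sr] := orb_per pr so.
have /iter_findex := sr; rewrite si => <-.
by elim: (findex _ _ _) => //= k /eqP ->; rewrite phi_i.
Qed.

Let is_ring_ring r : per r -> r != i -> exists w, is_ring G (ring (orb r)) w.
Proof.
move=> pr ri; have oi s : s \in orb r -> s != i by exact: orb_neq_i.
have sub : is_subgraph G (cyc (orb r)).
  split.
    by apply/fintype.subsetP => e /imsetP[y yo ->]; apply: phiE; exact: oi.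
  move=> e /imsetP[y yo ->] /=; split => //; move: yo; rewrite !inE => yo.
  by apply: connect_trans yo _; exact: fconnect1.
have cc := per_cycle pr.
have di : dicycle (cyc (orb r)).
  exists (fingraph.orbit phi r); split.
  - exact: fingraph.orbit_uniq.
  - have op : (0 < fingraph.order phi r)%N by exact: fingraph.order_gt0.
    have := iter_order_cycle cc (fingraph.in_orbit _ _) (fingraph.in_orbit _ _).
    rewrite size_orbit; case: (fingraph.order phi r) op => [//|[|[|//]]] _ /= e.
      by have := edges_neq (phiE ri); rewrite e eqxx.
    by have := phi2 ri; rewrite e eqxx.
  - by apply/setP => y; rewrite !inE -fconnect_orbit.
  - have nextE y : y \in fingraph.orbit phi r -> next (fingraph.orbit phi r) y = phi y.
      by move=> yo; apply/esym/eqP; exact: (next_cycle cc yo).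
    rewrite /cyc /arcs/=; apply/setP => -[a b]; apply/imsetP/imsetP => -[y yo [-> ->]].
      by move: yo; rewrite inE fconnect_orbit => yo; exists y; rewrite ?nextE.
    by exists y; rewrite ?nextE// inE fconnect_orbit.
rewrite /ring; case: ifP => rsub.
  have sr : is_subgraph G (reverse (cyc (orb r))).
    split => // e /imsetP[e' e'C ->] /=.
    by have [_ /(_ _ e'C)[]] := sub.
  by eexists; exact: ring_double di sub sr.
eexists; apply: ring_single => //.
by move=> [h _]; rewrite h in rsub.
Qed.

Let ring_trees_comp r : per r -> r != i -> exists w, ring_trees G (comp (orb r)) w.
Proof.
move=> pr ri; have [wQ rQ] := is_ring_ring pr ri.
exists (wQ * \prod_(s in verts (ring (orb r))) graph_weight G (tree s)).
exists (ring (orb r)), wQ, tree; split => //.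
- move=> s; rewrite verts_ring => so; have [ps _] := orb_per pr so.
  split; first exact: ditree_tree.
  apply/setP => v; rewrite finset.in_setI verts_tree finset.in_set1.
  apply/andP/eqP => [[vc vo]|->]; last by rewrite connect0.
  have [pv _] := orb_per pr vo.
  exact: (psi_inj pv ps (connect0 _ _) vc).
- move=> s t; rewrite verts_ring => so to st; rewrite /vdisjoint.
  have [ps _] := orb_per pr so; have [pt _] := orb_per pr to.
  rewrite -finset.setI_eq0; apply/eqP/setP => v; rewrite finset.in_setI !verts_tree inE.
  by apply/negP => /andP[vs vt]; move: st; rewrite (psi_inj ps pt vs vt) eqxx.
Qed.

Let verts_comp r v : per r -> v \in verts (comp (orb r)) ->
  exists2 s, s \in orb r & fconnect psi v s.
Proof.
move=> pr; rewrite finset.in_setU verts_ring.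
move=> /orP[vo|/bigcupP[s so]]; first by exists v.
by rewrite /tree /verts/= inE => vs; exists s.
Qed.

Let in_comp r v : per r -> fconnect psi v r -> v \in verts (comp (orb r)).
Proof.
move=> pr vr; rewrite finset.in_setU verts_ring.
apply/orP; right; apply/bigcupP; exists r; first by rewrite inE connect0.
by rewrite /verts/= inE.
Qed.

(** The fixed point i becomes the root of the tree without ring. Every other cycle has at least 3
    vertices: the graph has no loops, and 2-cycles are excluded by hypothesis. *)
Lemma functional_graph_calH : exists2 H, calH G H &
  fun_arcs phi (~: [set i]) (arcs H) /\ forall u, (i, u) \notin arcs H.
Proof.
pose Ks := [set comp (orb r) | r in [set r | per r & r != i]].
have inKs K : K \in Ks -> exists r, [/\ per r, r != i & K = comp (orb r)].
  by move=> /imsetP[r]; rewrite inE => /andP[pr ri] ->; exists r.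
pose H : graph N := (verts (tree i) :|: \bigcup_(K in Ks) verts K,
             arcs (tree i) :|: \bigcup_(K in Ks) arcs K).
have cases v : fconnect psi v i \/ exists r, [/\ per r, r != i & fconnect psi v r].
  have [r pr vr] := exists_per v; have [<-|ri] := eqVneq r i; first by left.
  by right; exists r.
have VH : verts H = [set: 'I_N].
  apply/setP => v; rewrite [RHS]inE finset.in_setU verts_tree.
  have [vi|[r [pr ri vr]]] := cases v; first by rewrite vi.
  apply/orP; right; apply/bigcupP; exists (comp (orb r)); last exact: in_comp.
  by apply/imsetP; exists r; rewrite // inE pr.
have wKE K : exists w, K \in Ks -> ring_trees G K w.
  have [/inKs[r [pr ri ->]]|_] := boolP (K \in Ks); last by exists 0.
  by have [w hw] := ring_trees_comp pr ri; exists w.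
have /boolp.choice[wK hwK] := wKE.
have HH : calH G H.
  exists (graph_weight G (tree i) * \prod_(K in Ks) wK K).
  exists (tree i), Ks, wK; split => //.
  - by exists i; exact: ditree_tree.
  - move=> K KKs; split; first exact: hwK.
    have [r [pr ri ->]] := inKs K KKs; rewrite /vdisjoint -finset.setI_eq0.
    apply/eqP/setP => v; rewrite finset.in_setI verts_tree finset.in_set0.
    apply/negP => /andP[vi /(verts_comp pr)[s so vs]].
    have [ps _] := orb_per pr so; have := orb_neq_i pr ri so.
    by rewrite (psi_inj ps per_i vs vi) eqxx.
  - move=> K L /inKs[r [pr ri ->]] /inKs[s [ps si ->]] ne.
    rewrite /vdisjoint -finset.setI_eq0; apply/eqP/setP => v.
    rewrite finset.in_setI finset.in_set0; apply/negP => /andP[/(verts_comp pr)[a ar va] /(verts_comp ps)[b bs vb]].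
    have [pa _] := orb_per pr ar; have [pb _] := orb_per ps bs.
    have ab := psi_inj pa pb va vb; move: ne.
    by rewrite (orb_eq pr ar) (orb_eq ps bs) ab eqxx.
exists H => //.
have arcsH x y : ((x, y) \in arcs H) -> (x != i) && ((phi x == y) || ((y != i) && (phi y == x))).
  have treeA r a b : per r -> (a, b) \in arcs (tree r) -> a != i /\ phi a == b.
    move=> pr /imsetP[v]; rewrite !inE => /andP[vr vc] [-> ->].
    have nv := tree_nper pr vr vc; rewrite /psi (negbTE nv); split => //.
    by apply: contraNneq nv => ->.
  rewrite finset.in_setU => /orP[/(treeA i x y per_i)[-> ->] //|].
  move=> /bigcupP[K /inKs[r [pr ri ->]]].
  rewrite finset.in_setU => /orP[|/bigcupP[s]].
    have oi z : z \in orb r -> z != i by exact: orb_neq_i.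
    have C a b : (a, b) \in arcs (cyc (orb r)) -> [/\ a != i, b != i & phi a == b].
      move=> /imsetP[z zO [-> ->]]; split => //; apply: oi => //; move: zO.
      by rewrite !inE => zO; apply: connect_trans zO _; exact: fconnect1.
    rewrite -/(arcs (ring _)) /ring; case: ifP => _; last by move=> /C[-> _ ->].
    rewrite finset.in_setU => /orP[/C[-> _ ->] //|/imsetP[[a b] /C /= [ai bi ab] [-> ->]]].
    by rewrite bi ai ab orbT.
  rewrite verts_ring => so; have [ps _] := orb_per pr so.
  by move=> /(treeA s x y ps)[-> ->].
have Harcs v : v != i -> (v, phi v) \in arcs H.
  move=> vi; rewrite finset.in_setU.
  have [vc|[r [pr ri vr]]] := cases v.
    have nv := tree_nper per_i vi vc.
    apply/orP; left; apply/imsetP; exists v; first by rewrite !inE vi.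
    by rewrite /psi (negbTE nv).
  apply/orP; right; apply/bigcupP; exists (comp (orb r)).
    by apply/imsetP; exists r; rewrite // inE pr.
  rewrite finset.in_setU -/(arcs (ring _)).
  have [e|ne] := eqVneq v r.
    have c : (v, phi v) \in arcs (cyc (orb r)).
      by apply/imsetP; exists v; rewrite // e inE connect0.
    by apply/orP; left; rewrite /ring; case: ifP => _; rewrite // finset.in_setU c.
  apply/orP; right; apply/bigcupP; exists r; first by rewrite verts_ring inE connect0.
  apply/imsetP; exists v; first by rewrite !inE ne.
  by rewrite /psi (negbTE (tree_nper pr ne vr)).
split; last by move=> u; apply/negP => /arcsH; rewrite eqxx.
split.
- by move=> v; rewrite finset.in_setC1 => /Harcs.
- move=> x y; rewrite !finset.in_setC1; apply/idP/idP.
    move=> /orP[]/arcsH/andP[-> /=]; first by move=> /orP[->|->]; rewrite ?orbT.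
    by move=> /orP[->|->]; rewrite ?orbT.
  by move=> /orP[]/andP[/Harcs + /eqP <-] => ->; rewrite ?orbT.
- by move=> v; rewrite !inE => /phiE /edges_neq.
- by move=> v; rewrite !inE => /phi2 h _; exact: h.
Qed.

End Decomposition.

(** * Minors of the pair vectors and their number *)

Section Counting.
Variables (R : realType) (n : nat) (G : wdigraph R n.+1).
Local Notation V := 'I_n.+1.
Local Notation E := (V * V)%type.
Local Notation w := (weight G).

(* The edges x -> y and y -> x together contribute sin(theta_x - theta_y) times
   [pair_vec (x, y)] to [gmap G theta], for x < y. *)
Definition pair_vec (e : E) : 'rV[R]_n.+1 :=
  if (e.1 < e.2)%N then w e.1 e.2 *: delta_mx 0 e.1 - w e.2 e.1 *: delta_mx 0 e.2 else 0.

Definition pair_mx (f : {ffun 'I_n -> E}) : 'M[R]_(n, n.+1) :=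
  \matrix_(k, j) pair_vec (f k) 0 j.

Definition sorted_pair (x y : V) : E := if (x < y)%N then (x, y) else (y, x).

Lemma sorted_pair_vec (x y : V) j : x != y ->
  pair_vec (sorted_pair x y) 0 j =
  (if (x < y)%N then 1 else -1) * (w x y *+ (x == j) - w y x *+ (y == j)).
Proof.
move=> xy; rewrite /sorted_pair /pair_vec.
case: (ltnP x y) => h /=.
  by rewrite h !mxE /= mul1r !mulr_natr ![j == _]eq_sym.
have yx : (y < x)%N by rewrite ltn_neqAle h andbT eq_sym.
by rewrite yx !mxE /= mulN1r opprB !mulr_natr ![j == _]eq_sym.
Qed.

(** Pairs are sorted, so an arc and its reverse are listed together. An element of [calH] has
    exactly n such pairs, hence an injective [f] lists all of them. *)
Definition enumerates (f : {ffun 'I_n -> E}) (A : {set E}) : Prop :=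
  injective f /\ forall k, ((f k).1 < (f k).2)%N /\
    ((f k \in A) || (((f k).2, (f k).1) \in A)).

Lemma fun_arcs_sorted (i : V) phi A (e : E) : fun_arcs phi (~: [set i]) A ->
  (e.1 < e.2)%N -> ((e \in A) || ((e.2, e.1) \in A)) ->
  exists2 v, v != i & e = sorted_pair v (phi v).
Proof.
case: e => x y [_ h _ _] /= xy; rewrite h !finset.in_setC1 => /orP[]/andP[vi /eqP e].
  by exists x; rewrite // e /sorted_pair xy.
by exists y; rewrite // e /sorted_pair ltnNge (ltnW xy).
Qed.

Lemma sorted_pair_inj (i : V) phi A u v : fun_arcs phi (~: [set i]) A ->
  u != i -> v != i -> sorted_pair u (phi u) = sorted_pair v (phi v) -> u = v.
Proof.
move=> [_ _ _ h] ui vi; rewrite /sorted_pair.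
have key : u = phi v -> phi u = v -> u = v.
  move=> uv vu; have := h v; rewrite !finset.in_setC1 vi -uv => /(_ isT ui).
  by rewrite vu eqxx.
by case: ifP => _; case: ifP => _ [] // a b; apply: key.
Qed.

Lemma det_fm_root (i : V) phi :
  \det (fm G phi (~: [set i])) = \det (row' i (col' i (fm G phi (~: [set i])))).
Proof.
rewrite (expand_det_row _ i) (bigD1 i)//= big1 ?addr0 => [|j ji]; last first.
  by rewrite !mxE !inE eqxx /= eq_sym (negbTE ji) mul0r.
rewrite !mxE !inE !eqxx /= mul1r /cofactor addnn -signr_odd odd_double expr0 mul1r.
by congr (\det _); apply/matrixP => x y; rewrite !mxE.
Qed.

(** Up to the order of the rows and signs from sorting, the rows of [pair_mx f] are the rows of
    [fm G phi] other than row i. *)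
Lemma det_pair_mx (i : V) phi A f : fun_arcs phi (~: [set i]) A -> enumerates f A ->
  `|\det (col' i (pair_mx f))| = `|\det (fm G phi (~: [set i]))|.
Proof.
move=> fA [fI fE]; have [_ _ pne _] := fA.
have /fin_all_exists[s sE] k : exists j : 'I_n, f k = sorted_pair (lift i j) (phi (lift i j)).
  have [lt mem] := fE k; have [v vi e] := fun_arcs_sorted fA lt mem.
  by rewrite eq_sym in vi; have [j vj _] := unlift_some vi; exists j; rewrite -vj.
have sI : injective s by move=> k l kl; apply: fI; rewrite !sE kl.
pose sg k : R := if (lift i (s k) < phi (lift i (s k)))%N then 1 else -1.
have -> : col' i (pair_mx f) = diag_mx (\row_k sg k) *m
    row_perm (perm sI) (row' i (col' i (fm G phi (~: [set i])))).
  apply/matrixP => k j; rewrite mul_diag_mx !mxE sE permE !inE.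
  rewrite [lift i (s k) == i]eq_sym neq_lift /= sorted_pair_vec//.
  by rewrite eq_sym; apply: pne; rewrite finset.in_setC1 eq_sym neq_lift.
rewrite det_mulmx normrM det_diag normr_prod big1 ?mul1r => [|k _]; last first.
  by rewrite mxE /sg; case: ifP; rewrite ?normrN normr1.
by rewrite row_permE det_mulmx det_perm normrM normrX normrN1 expr1n mul1r -det_fm_root.
Qed.

(** A non-zero term of the Leibniz formula assigns to each pair one of its endpoints, using every
    vertex but i once, and the non-zero coefficient is the weight of an edge from this endpoint to
    the other one. These edges define [phi]; a 2-cycle would list the same pair twice. *)
Lemma det_pair_mx_neq0 (i : V) f : \det (col' i (pair_mx f)) != 0 ->
  exists2 H, calH G H & enumerates f (arcs H) /\ forall u, (i, u) \notin arcs H.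
Proof.
move=> d0.
have fI : injective f.
  move=> k l kl; apply/eqP/negPn/negP => ne; move: d0.
  by rewrite (determinant_alternate ne) ?eqxx// => j; rewrite !mxE kl.
have [s sN] : exists s : 'S_n, \prod_k col' i (pair_mx f) k (s k) != 0.
  apply/existsP; apply: contraR d0; rewrite negb_exists => /forallP h.
  rewrite /determinant big1// => s _.
  by have := h s; rewrite negbK => /eqP ->; rewrite mulr0.
move: sN => /prodf_neq0 sN.
have lt k : ((f k).1 < (f k).2)%N.
  have := sN k isT; rewrite !mxE /pair_vec; case: ifP => // _.
  by rewrite mxE eqxx.
pose vx k := lift i (s k).
pose oth k := if vx k == (f k).1 then (f k).2 else (f k).1.
have vE k : [/\ (vx k, oth k) \in edges G & f k = sorted_pair (vx k) (oth k)].
  have := sN k isT; rewrite !mxE /pair_vec lt !mxE /= -/(vx k).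
  have ltk := lt k; have ne : (f k).1 != (f k).2.
    by apply: contraTneq ltk => ->; rewrite ltnn.
  rewrite /oth; have [->|n1] := eqVneq (vx k) (f k).1.
    rewrite (negbTE ne) mulr1 mulr0 subr0 => w0; split; last first.
      by rewrite /sorted_pair ltk -surjective_pairing.
    by apply: contraNT w0 => /weight_eq0 ->.
  rewrite mulr0 sub0r; have [->|n2] := eqVneq (vx k) (f k).2; last by rewrite mulr0 oppr0 eqxx.
  rewrite mulr1 oppr_eq0 => w0; split; last first.
    by rewrite /sorted_pair ltnNge (ltnW ltk) /= -surjective_pairing.
  by apply: contraNT w0 => /weight_eq0 ->.
pose phi v := if unlift i v is Some j then oth ((s^-1)%g j) else i.
have phiv k : phi (vx k) = oth k by rewrite /phi /vx liftK permK.
have vxs v : v != i -> exists k, v = vx k.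
  by rewrite eq_sym => /unlift_some[j -> _]; exists ((s^-1)%g j); rewrite /vx permKV.
have vxi k : vx k != i by rewrite /vx eq_sym neq_lift.
have phi_i : phi i = i by rewrite /phi unlift_none.
have phiE v : v != i -> (v, phi v) \in edges G.
  by move=> /vxs[k ->]; rewrite phiv; have [] := vE k.
have phi2 v : v != i -> phi (phi v) != v.
  move=> vi; apply/eqP => pp.
  have pi : phi v != i by apply: contraNneq vi => e; rewrite -pp e phi_i.
  have [k vk] := vxs v vi; have [l pl] := vxs _ pi.
  have kl : f k = f l.
    have [_ ->] := vE k; have [_ ->] := vE l; rewrite -!phiv -pl -vk pp.
    rewrite /sorted_pair; case: (ltngtP v (phi v)) => // e.
    have := edges_neq (phiE v vi); rewrite (_ : phi v = v) ?eqxx//.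
    exact/esym/val_inj.
  have := edges_neq (phiE v vi); rewrite pl vk (fI _ _ kl) eqxx.
  done.
have [H HH [fA ni]] := functional_graph_calH phi_i phiE phi2.
exists H => //; split => //; split => // k; split => //.
have [h _ _ _] := fA; have [_ fk] := vE k.
have := h (vx k); rewrite finset.in_setC1 vxi phiv => /(_ isT).
by rewrite fk /sorted_pair; case: ifP => _ /= ->; rewrite ?orbT.
Qed.

Lemma calH_weightP H : calH G H -> tree_rings G H (calH_weight G H).
Proof. by move=> [w0 hw]; exact: (@xgetPex _ 0 [set w | tree_rings G H w]%classic (ex_intro _ w0 hw)). Qed.

Lemma calH_weight_ge0 H : calH G H -> 0 <= calH_weight G H.
Proof. by move=> /calH_weightP/tree_rings_fun[i [phi [_ _ ->]]]. Qed.

(** The root of any decomposition is the only vertex without an out-arc, so it must be i. The minor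
    on the right does not mention the decomposition chosen by [xget]. *)
Lemma calH_weight_det i f H : calH G H -> enumerates f (arcs H) ->
  (forall u, (i, u) \notin arcs H) ->
  calH_weight G H = `|\det (col' i (pair_mx f))|.
Proof.
move=> /calH_weightP/tree_rings_fun[j [phi [fA jH ->]]] fE iH.
have ij : i = j.
  apply/eqP/negPn/negP => ne; have [h _ _ _] := fA.
  by have := h i; rewrite finset.in_setC1 ne => /(_ isT); rewrite (negbTE (iH _)).
by rewrite -(det_pair_mx fA fE) ij.
Qed.

(** Non-zero minors are sorted by the element H that they produce. H determines the omitted vertex,
    and [f] is an injection into the n sorted pairs of H, which leaves at most n! choices. *)
Lemma sum_minors_calH :
  \sum_(f : {ffun 'I_n -> E}) \sum_i `|\det (col' i (pair_mx f))| <=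
  n`!%:R * \sum_(H in calH G) calH_weight G H.
Proof.
rewrite pair_big /=.
pose d (p : {ffun 'I_n -> E} * V) := \det (col' p.2 (pair_mx p.1)).
have /boolp.choice[h hP] (p : {ffun 'I_n -> E} * V) : exists H, d p != 0 ->
    calH G H /\ (enumerates p.1 (arcs H) /\ forall u, (p.2, u) \notin arcs H).
  have [|] := boolP (d p != 0); last by exists (finset.set0, finset.set0).
  by move=> /det_pair_mx_neq0[H ? ?]; exists H.
rewrite -/(d _) (bigID (fun p => d p == 0))/= big1 ?add0r => [|p /eqP]; last first.
  by rewrite /d => ->; rewrite normr0.
rewrite (partition_big h (fun H => H \in calH G))/=; last first.
  by move=> p /hP[pH _]; exact: mem_set.
rewrite mulr_sumr; apply: ler_sum => H /set_mem HH.
rewrite (eq_bigr (fun=> calH_weight G H)) => [|p /andP[/hP[_ [e ni]] /eqP pH]]; last first.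
  by rewrite -/(d p) /d; rewrite pH in e ni; rewrite (calH_weight_det HH e ni).
rewrite sumr_const -[leLHS]mulr_natl ler_wpM2r ?calH_weight_ge0// ler_nat.
set F := (X in #|X|).
have [i0 [phi [fA iH _]]] := tree_rings_fun (calH_weightP HH).
pose S : {set E} := [set sorted_pair v (phi v) | v in ~: [set i0]].
have cS : #|S| = n.
  rewrite card_in_imset ?cardsC1 ?card_ord// => u v.
  by rewrite !finset.in_setC1; exact: sorted_pair_inj fA.
have Fp p : p \in F -> p.2 = i0 /\ enumerates p.1 (arcs H).
  move=> pF; have /andP[/hP[_ [e ni]] /eqP pH] : (d p != 0) && (h p == H) by exact: pF.
  rewrite pH in e ni; split => //.
  apply/eqP/negPn/negP => ne; have [h' _ _ _] := fA.
  by have := h' p.2; rewrite finset.in_setC1 ne => /(_ isT); rewrite (negbTE (ni _)).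
have -> : #|F| = #|[set p.1 | p in F]|.
  rewrite card_in_imset// => -[f i] [g j] /Fp[/= -> _] /Fp[/= -> _] ->.
  done.
have -> : n`! = (#|S| ^_ #|'I_n|)%N by rewrite cS card_ord ffactnn.
rewrite -card_inj_ffuns_on; apply: subset_leq_card; apply/fintype.subsetP => f.
move=> /imsetP[p /Fp[_ [fI fE]] ->]; rewrite inE; apply/andP; split.
  apply/ffun_onP => k; have [lt mem] := fE k.
  have [v vi ->] := fun_arcs_sorted fA lt mem.
  by apply/imsetP; exists v; rewrite // finset.in_setC1.
exact/injectiveP.
Qed.

End Counting.

(** * Upper bounds *)

Section UpperZonotope.
Variables (R : realType) (n : nat) (G : wdigraph R n.+1).
Variable P : 'M[R]_(n, n.+1).
Hypothesis hP : @orthonormal_projection R n.+1 P.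
Local Notation V := 'I_n.+1.
Local Notation E := (V * V)%type.
Local Notation w := (weight G).

Lemma weight_diag i : w i i = 0.
Proof. by rewrite weight_eq0// edges_loopless. Qed.

Lemma weight_ge0 i j : 0 <= w i j.
Proof. by have [/weight_gt0/ltW//|/weight_eq0 ->] := boolP ((i, j) \in edges G). Qed.

Lemma total_weight_ge0 : 0 <= \sum_a \sum_b w a b.
Proof. by rewrite sumr_ge0// => a _; rewrite sumr_ge0// => b _; exact: weight_ge0. Qed.

Lemma row_weight_le a : \sum_b w a b <= \sum_a \sum_b w a b.
Proof.
rewrite [leRHS](bigD1 a)//= lerDl sumr_ge0// => b _.
by rewrite sumr_ge0// => d _; exact: weight_ge0.
Qed.

Lemma gmapE (theta : 'rV[R]_n.+1) i :
  gmap G theta ord0 i = \sum_j w i j * sin (theta ord0 i - theta ord0 j).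
Proof.
rewrite mxE [RHS](bigD1 i)//= weight_diag mul0r add0r.
by apply: eq_bigl => j.
Qed.

Lemma gmap_pair_vec (theta : 'rV[R]_n.+1) :
  gmap G theta = \sum_(e : E) sin (theta ord0 e.1 - theta ord0 e.2) *: pair_vec G e.
Proof.
apply/rowP => i; rewrite gmapE summxE.
rewrite -(pair_bigA _ (fun x y => (sin (theta ord0 x - theta ord0 y) *: pair_vec G (x, y)) ord0 i))/=.
have sumE (F : V -> R) : \sum_x F x *+ (x == i) = F i.
  by rewrite (bigD1 i)//= eqxx big1 ?addr0// => x /negbTE ->.
have -> : \sum_x \sum_y (sin (theta ord0 x - theta ord0 y) *: pair_vec G (x, y)) ord0 i =
  \sum_x (\sum_y (sin (theta ord0 x - theta ord0 y) * w x y) *+ (x < y)%N) *+ (x == i) -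
  \sum_y (\sum_x (sin (theta ord0 x - theta ord0 y) * w y x) *+ (x < y)%N) *+ (y == i).
  under [X in _ - X]eq_bigr do rewrite -sumrMnl.
  rewrite [X in _ - X]exchange_big/= -sumrB; apply: eq_bigr => x _.
  rewrite -sumrMnl -sumrB; apply: eq_bigr => y _.
  rewrite mxE /pair_vec /=; case: ltnP => _; last by rewrite mxE mulr0 !mulr0n !mul0rn subr0.
  rewrite !mxE /= !mulr1n ![_ == i]eq_sym mulrBr !mulrA.
  by congr (_ - _); case: (i == _); rewrite ?mulr1 ?mulr0.
rewrite !sumE -sumrB; apply: eq_bigr => j _.
case: (ltngtP i j) => [ij|ij|/val_inj ->].
- by rewrite subr0 mulr1n mulrC.
- by rewrite sub0r mulr1n -mulNr -sinN opprB mulrC.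
- by rewrite weight_diag mul0r !mulr0n subr0.
Qed.

Lemma lee_locked_upper : (Vol_locked G P <= (Vol_upper G)%:E)%E.
Proof.
pose Z : 'M[R]_(#|{: E}|, n) := \matrix_(k, j) (pair_vec G (enum_val k) *m P^T) ord0 j.
apply: (@le_trans _ _ (lebesgue_rV (zonotope Z))).
  apply: lebesgue_rV_mono => _ [_ [theta _ <-] <-].
  exists (\row_k sin (theta ord0 (enum_val k).1 - theta ord0 (enum_val k).2)).
    by move=> k; rewrite !mxE subr0; exact: sin_max.
  rewrite gmap_pair_vec mulmx_suml; apply/rowP => j; rewrite mxE summxE.
  rewrite [RHS](reindex (@enum_val E (pred_of_simpl predT)))/=; last first.
    by apply: onW_bij; exact: enum_val_bij.
  by apply: eq_bigr => k _; rewrite -scalemxAl !mxE.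
apply: le_trans (zonotope_volume Z) _; rewrite lee_fin /Vol_upper /=.
have s0 : 0 < Num.sqrt n.+1%:R :> R by rewrite sqrtr_gt0.
(* Bordering by ones expresses a minor of the projected vectors through the n + 1 minors that omit
   one vertex; the triangle inequality drops their alternating signs. *)
have hm : minors_sum Z <= (n`!%:R * \sum_(H in calH G) calH_weight G H) / Num.sqrt n.+1%:R.
  apply: le_trans (ler_wpM2r _ (sum_minors_calH G)); last by rewrite invr_ge0 ltW.
  pose h (f : {ffun 'I_n -> 'I_(#|{: E}|)}) : {ffun 'I_n -> E} := [ffun k => enum_val (f k)].
  pose a (f : {ffun 'I_n -> E}) : R := `|\det (pair_mx G f *m P^T)|.
  apply: (@le_trans _ _ (\sum_f a f)).
    rewrite /minors_sum (eq_bigr (fun f => a (h f))) => [|f _]; last first.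
      congr (`|\det _|); apply/matrixP => k j; rewrite !mxE; apply: eq_bigr => l _.
      by rewrite !mxE ffunE.
    apply: ler_sum_inj => [f g /ffunP fg|f]; last exact: normr_ge0.
    by apply/ffunP => k; have := fg k; rewrite !ffunE => /enum_val_inj.
  rewrite mulr_suml; apply: ler_sum => f _; rewrite /a (det_projection hP).
  by apply: ler_wpM2r; [rewrite invr_ge0 ltW|exact: det_ones_le].
apply: le_trans (ler_wpM2l _ hm) _; first by rewrite divr_ge0.
have f0 : n`!%:R != 0 :> R by rewrite pnatr_eq0 -lt0n fact_gt0.
set S := \sum_(H in calH G) _.
rewrite le_eqVlt; apply/orP; left; apply/eqP.
have key (p f s x : R) : f != 0 -> p / f * (f * x / s) = p / s * x.
  by move=> ?; rewrite -!mulrA (mulrA f^-1) mulVf// mul1r (mulrC x).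
exact: key.
Qed.

End UpperZonotope.

Lemma sum_mul_delta (R : pzSemiRingType) (I : finType) (F : I -> R) c :
  \sum_x F x * (c == x)%:R = F c.
Proof.
rewrite (bigD1 c)//= eqxx mulr1 big1 ?addr0// => x.
by rewrite eq_sym => /negbTE ->; rewrite mulr0.
Qed.

(** * Linearization of the frequency map *)

Section SineEstimates.
Variable R : realType.
Implicit Types u v c r : R.

Lemma sin_sub_mvt u v : v <= u -> exists2 z, v <= z <= u & sin u - sin v = cos z * (u - v).
Proof.
move=> vu; have dsin x : x \in `]v, u[ -> is_derive x 1 sin (cos x).
  by move=> _; exact: is_derive_sin.
have [|z + e] := MVT_segment vu dsin.
  by apply: continuous_subspaceT => x; exact: continuous_sin.
by rewrite in_itv /= => zuv; exists z.
Qed.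

Lemma cos_sub_le u v : `|cos u - cos v| <= `|u - v|.
Proof.
wlog vu : u v / v <= u.
  by move=> h; have [/h//|/ltW/h] := leP v u; rewrite distrC (distrC v).
have dcos x : x \in `]v, u[ -> is_derive x 1 cos ((fun x => - sin x) x).
  by move=> _; exact: is_derive_cos.
have [|z _ ->] := MVT_segment vu dcos.
  by apply: continuous_subspaceT => x; exact: continuous_cos.
by rewrite normrM normrN ler_piMl// sin_max.
Qed.

(** The mean value point lies between u and v, hence within r of c, where the cosine differs from
    cos c by at most r. *)
Lemma sin_linear_error u v c r : `|u - c| <= r -> `|v - c| <= r ->
  `|sin u - sin v - cos c * (u - v)| <= r * `|u - v|.
Proof.
wlog vu : u v / v <= u.
  move=> h uc vc; have [/h ->//|/ltW/h/(_ vc uc)] := leP v u.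
  rewrite (distrC v u) (_ : sin v - sin u - _ = - (sin u - sin v - cos c * (u - v))) ?normrN//.
  by ring.
move=> uc vc; have [z /andP[vz zu] ->] := sin_sub_mvt vu.
rewrite -mulrBl normrM ler_wpM2r//; apply: le_trans (cos_sub_le _ _) _.
by move: uc vc; rewrite !ler_norml => /andP[? ?] /andP[? ?]; apply/andP; split; lra.
Qed.

End SineEstimates.

Section Linearization.
Variables (R : realType) (n : nat) (G : wdigraph R n.+1).
Variable P : 'M[R]_(n, n.+1).
Hypothesis hP : @orthonormal_projection R n.+1 P.
Local Notation V := 'I_n.+1.
Local Notation w := (weight G).

(* Every phase vector has this form modulo (1, ..., 1). *)
Definition pin (i : V) (x : 'rV[R]_n) : 'rV[R]_n.+1 :=
  \row_a if unlift i a is Some j then x ord0 j else 0.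

Definition lapl (theta : 'rV[R]_n.+1) : 'M[R]_n.+1 :=
  laplacian (fun a b => w a b * cos (theta ord0 a - theta ord0 b)).

Definition pgmap (i : V) (x : 'rV[R]_n) : 'rV[R]_n := gmap G (pin i x) *m P^T.

(** The Jacobian of [pgmap], acting on row vectors from the right; removing row i freezes the pinned
    phase. *)
Definition Dpgmap (i : V) (x : 'rV[R]_n) : 'M[R]_n := row' i (lapl (pin i x))^T *m P^T.

(** By the matrix-tree theorem this is, up to sign, sqrt N times the Jacobian determinant of
    [pgmap], for every choice of the pinned vertex. *)
Definition tree_sum (theta : 'rV[R]_n.+1) : R :=
  \sum_(T in ST G) \prod_(e in arcs T)
    (w e.1 e.2 * cos (theta ord0 e.1 - theta ord0 e.2)).

Lemma pin_lift i x j : pin i x ord0 (lift i j) = x ord0 j.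
Proof. by rewrite mxE liftK. Qed.

Lemma pin_pin i x : pin i x ord0 i = 0.
Proof. by rewrite mxE unlift_none. Qed.

Lemma pinE i (x : 'rV[R]_n) (A : 'M[R]_(n.+1)) : pin i x *m A = x *m row' i A.
Proof.
apply/rowP => b; rewrite !mxE (bigD1_ord i)//= pin_pin mul0r add0r.
by apply: eq_bigr => j _; rewrite pin_lift !mxE.
Qed.

Lemma pinB i x y : pin i (x - y) = pin i x - pin i y.
Proof. by apply/rowP => a; rewrite !mxE; case: unlift => [j|]; rewrite ?mxE ?subrr. Qed.

Lemma lapl_row (c v : 'rV[R]_n.+1) a : (v *m (lapl c)^T) ord0 a =
  \sum_b w a b * cos (c ord0 a - c ord0 b) * (v ord0 a - v ord0 b).
Proof.
rewrite mxE; under eq_bigr do rewrite !mxE mulr_sumr.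
rewrite exchange_big/=; apply: eq_bigr => b _.
rewrite mulrBr !(mulrC _ (v _ _)) -(sum_mul_delta (v ord0) a) -(sum_mul_delta (v ord0) b) !mulr_suml -sumrB.
by apply: eq_bigr => x _; ring.
Qed.

Lemma gmap_linear_error (c u v : 'rV[R]_n.+1) r m a :
  (forall b, `|u ord0 b - c ord0 b| <= r) -> (forall b, `|v ord0 b - c ord0 b| <= r) ->
  (forall b, `|u ord0 b - v ord0 b| <= m) ->
  `|(gmap G u - gmap G v - (u - v) *m (lapl c)^T) ord0 a| <=
  4 * (\sum_b w a b) * r * m.
Proof.
move=> ur vr uv; rewrite [X in `|X|]mxE [X in X + _]mxE [X in _ + X + _]mxE [X in _ + X]mxE.
rewrite lapl_row !gmapE -sumrB -sumrB.
apply: le_trans (ler_norm_sum _ _ _) _.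
rewrite (_ : 4 * _ * r * m = \sum_b w a b * (4 * r * m)); last first.
  by rewrite -mulr_suml; ring.
apply: ler_sum => b _.
rewrite !mxE -!mulrA -!mulrBr normrM (ger0_norm (weight_ge0 _ _ _)).
apply: ler_wpM2l; first exact: weight_ge0.
have D (x y z t p : R) : `|x - y| <= p -> `|z - t| <= p -> `|x - z - (y - t)| <= 2 * p.
  by rewrite !ler_norml => /andP[? ?] /andP[? ?]; apply/andP; split; lra.
have e : u ord0 a - v ord0 a - (u ord0 b - v ord0 b) =
  u ord0 a - u ord0 b - (v ord0 a - v ord0 b) by ring.
rewrite e; apply: le_trans (sin_linear_error (D _ _ _ _ _ (ur a) (ur b)) (D _ _ _ _ _ (vr a) (vr b))) _.
have r0 : 0 <= r by exact: le_trans (ur a).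
have := D _ _ _ _ _ (uv a) (uv b); rewrite -e => h.
have := ler_wpM2l (mulr_ge0 (ler0n R 2) r0) h.
move=> /le_trans; apply; rewrite le_eqVlt; apply/orP; left; apply/eqP; ring.
Qed.

(** The 4 is 2 * 2: passing to phase differences doubles both the radius and the increment. The last
    factor bounds the effect of the projection. *)
Definition lin_const : R :=
  4 * (\sum_a \sum_b w a b) * (\sum_a \sum_j `|P j a|).

Lemma lin_const_ge0 : 0 <= lin_const.
Proof.
by rewrite !mulr_ge0// !sumr_ge0// => a _; rewrite sumr_ge0// => b _; exact: weight_ge0.
Qed.

Lemma pin_bound i (x c : 'rV[R]_n) r : 0 <= r -> (forall j, `|x ord0 j - c ord0 j| <= r) ->
  forall b, `|pin i x ord0 b - pin i c ord0 b| <= r.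
Proof.
by move=> r0 h b; rewrite !mxE; case: unlift => [j|//]; rewrite ?subrr ?normr0.
Qed.

(** The radius r and the distance m are kept apart: r = m gives the error over a whole cell, and
    arbitrary m gives the Lipschitz estimate for the contraction. *)
Lemma pgmap_linear_error i (c x y : 'rV[R]_n) r m : 0 <= r -> 0 <= m ->
  cube c r x -> cube c r y -> (forall j, `|x ord0 j - y ord0 j| <= m) ->
  forall j, `|(pgmap i x - pgmap i y - (x - y) *m Dpgmap i c) ord0 j| <= lin_const * r * m.
Proof.
move=> r0 m0 cx cy xy j.
rewrite /pgmap /Dpgmap mulmxA -pinE pinB -!mulmxBl.
set e := (X in (X *m _)).
have he a : `|e ord0 a| <= 4 * (\sum_a \sum_b w a b) * r * m.
  apply: le_trans (gmap_linear_error a (pin_bound i r0 cx) (pin_bound i r0 cy) (pin_bound i m0 xy)) _.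
  by rewrite !ler_wpM2r// ler_wpM2l//; exact: row_weight_le.
rewrite mxE; apply: le_trans (ler_norm_sum _ _ _) _.
apply: (@le_trans _ _ (\sum_a (4 * (\sum_a \sum_b w a b) * r * m) * `|P j a|)).
  by apply: ler_sum => a _; rewrite normrM [_^T _ _]mxE ler_wpM2r.
rewrite -mulr_sumr /lin_const.
have := total_weight_ge0 G; set W := \sum_a \sum_b _ => W0.
have hs : \sum_a `|P j a| <= \sum_a \sum_j `|P j a|.
  by apply: ler_sum => a _; rewrite (bigD1 j)//= lerDl sumr_ge0.
have := ler_wpM2l (mulr_ge0 (mulr_ge0 (mulr_ge0 (ler0n R 4) W0) r0) m0) hs.
by move=> /le_trans; apply; rewrite le_eqVlt; apply/orP; left; apply/eqP; ring.
Qed.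

Lemma det_projected_lapl i theta :
  `|\det (row' i (lapl theta)^T *m P^T)| = `|tree_sum theta| / Num.sqrt n.+1%:R.
Proof.
rewrite (det_projection hP) det_ones_col1 normrM normrX normrN1 expr1n mul1r.
congr (`|_| / _); rewrite /lapl det_laplacian_col1.
pose F a b := w a b * cos (theta ord0 a - theta ord0 b).
by apply: (@sum_rooted_fun _ _ G F) => a b ab; rewrite /F weight_eq0// mul0r.
Qed.

Lemma det_Dpgmap i x : `|\det (Dpgmap i x)| = `|tree_sum (pin i x)| / Num.sqrt n.+1%:R.
Proof. exact: det_projected_lapl. Qed.

Lemma tree_sum_le theta : `|tree_sum theta| <= \sum_(T in ST G) graph_weight G T.
Proof.
apply: le_trans (ler_norm_sum _ _ _) _; apply: ler_sum => T _.
rewrite normr_prod; apply: ler_prod => e _; rewrite normr_ge0 normrM/=.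
by rewrite (ger0_norm (weight_ge0 _ _ _)) ler_piMr ?weight_ge0// cos_max.
Qed.

Definition Dbound : R := (2 * \sum_a \sum_b w a b) * (\sum_a \sum_j `|P j a|).

Lemma Dpgmap_le i x j k : `|Dpgmap i x j k| <= Dbound.
Proof.
have h a b : `|lapl (pin i x) a b| <= 2 * \sum_a \sum_b w a b.
  rewrite mxE; apply: le_trans (ler_norm_sum _ _ _) _.
  apply: (@le_trans _ _ (\sum_b w a b * 2)).
    apply: ler_sum => d _; rewrite !normrM (ger0_norm (weight_ge0 _ _ _)) -mulrA.
    apply: ler_wpM2l; first exact: weight_ge0.
    rewrite -[leRHS]mul1r; apply: ler_pM => //; first exact: cos_max.
    by case: (_ == _); case: (_ == _); rewrite ?subrr ?normr0 ?subr0 ?sub0r ?normrN ?normr1//; lra.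
  by rewrite -mulr_suml mulrC ler_wpM2l//; exact: row_weight_le.
rewrite mxE; apply: le_trans (ler_norm_sum _ _ _) _.
apply: (@le_trans _ _ (\sum_a (2 * (\sum_a \sum_b w a b)) * `|P k a|)).
  by apply: ler_sum => a _; rewrite normrM [P^T _ k]mxE ler_wpM2r// [row' _ _ _ _]mxE [_^T _ _]mxE h.
rewrite -mulr_sumr ler_wpM2l//.
  by apply: mulr_ge0 => //; exact: total_weight_ge0.
by apply: ler_sum => a _; rewrite (bigD1 k)//= lerDl sumr_ge0.
Qed.

End Linearization.

Section MinorsPerturbation.
Variables (R : realType) (n : nat).

Lemma det_le_row (A : 'M[R]_n) (b kappa : R) k0 : 1 <= b ->
  (forall j k, `|A j k| <= b) -> (forall k, `|A k0 k| <= kappa) ->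
  `|\det A| <= n`!%:R * (kappa * b ^+ n).
Proof.
move=> b1 Ab Ak; have b0 : 0 <= b by exact: le_trans b1.
rewrite /determinant; apply: le_trans (ler_norm_sum _ _ _) _.
apply: (@le_trans _ _ (\sum_(s : 'S_n) kappa * b ^+ n)).
  apply: ler_sum => s _; rewrite normrM normrX normrN1 expr1n mul1r normr_prod.
  rewrite (bigD1 k0)//=; apply: ler_pM => //; first exact: prodr_ge0.
  apply: (@le_trans _ _ (\prod_(i < n | i != k0) b)).
    by apply: ler_prod => i _; rewrite normr_ge0 Ab.
  rewrite prodr_const; apply: ler_weXn2l => //.
  by rewrite -[leqRHS](card_ord n) max_card.
by rewrite sumr_const -[_ *+ _]mulr_natl card_Sn.
Qed.

Lemma minors_sum_square (A : 'M[R]_n) : minors_sum A <= n`!%:R * `|\det A|.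
Proof.
rewrite /minors_sum (bigID (fun f : {ffun 'I_n -> 'I_n} => injectiveb f))/=.
rewrite [X in _ + X]big1 ?addr0 => [|f /injectivePn[x [y xy fxy]]]; last first.
  by rewrite (determinant_alternate xy) ?normr0// => j; rewrite !mxE fxy.
rewrite (eq_bigr (fun=> `|\det A|)) => [|f /injectiveP fI]; last first.
  have -> : rowsub f A = perm_mx (perm fI) *m A.
    by rewrite -row_permE; apply/matrixP => i j; rewrite !mxE permE.
  by rewrite det_mulmx det_perm normrM normrX normrN1 expr1n mul1r.
rewrite sumr_const -[_ *+ _]mulr_natl ler_wpM2r// ler_nat.
have := card_inj_ffuns 'I_n 'I_n; rewrite !card_ord ffactnn => <-.
by apply: eq_leq; apply: eq_card => f; rewrite !inE.
Qed.

Definition perturbation_const (b : R) : R :=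
  #|{ffun 'I_n -> 'I_(n + n)}|%:R * (n`!%:R * b ^+ n).

Lemma perturbation_const_ge0 (b : R) : 0 <= b -> 0 <= perturbation_const b.
Proof. by move=> b0; rewrite /perturbation_const !mulr_ge0// exprn_ge0. Qed.

(** Selections inside [A] give n! |det A|. Every other selection contains a row of kappa times the
    identity, so its minor is of order kappa, and their number is bounded crudely. *)
Lemma minors_sum_perturbation (A : 'M[R]_n) (b kappa : R) : 1 <= b ->
  (forall j k, `|A j k| <= b) -> 0 <= kappa <= b ->
  minors_sum (col_mx A (kappa%:M : 'M[R]_n)) <=
  n`!%:R * `|\det A| + kappa * perturbation_const b.
Proof.
move=> b1 Ab /andP[k0 kb]; have b0 : 0 <= b by exact: le_trans b1.
set B := col_mx _ _.
pose left (f : {ffun 'I_n -> 'I_(n + n)}) := [forall k, (f k < n)%N].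
rewrite /minors_sum (bigID left)/= lerD//.
  apply: le_trans (minors_sum_square A); rewrite /minors_sum.
  pose h (f : {ffun 'I_n -> 'I_(n + n)}) : {ffun 'I_n -> 'I_n} :=
    [ffun k => if fintype.split (f k) is inl j then j else k].
  have hE f : left f -> forall k, f k = lshift n (h f k).
    move=> /forallP lf k; rewrite ffunE; have := lf k.
    case: fintype.splitP => [j e _|//]; exact/val_inj.
  have hI : {in left &, injective h}.
    move=> f g lf lg fg; apply/ffunP => k.
    by rewrite (hE f lf) (hE g lg) fg.
  rewrite (eq_bigr (fun f => `|\det (rowsub (h f) A)|)) => [|f lf]; last first.
    congr (`|\det _|); apply/matrixP => k j.
    by rewrite [LHS]mxE (hE f lf) col_mxEu !mxE.
  pose F (f : {ffun 'I_n -> 'I_n}) : R := `|\det (rowsub f A)|.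
  rewrite -(big_imset F hI)/= -/F.
  by rewrite [leRHS](bigID (fun f => f \in [set h x | x in left]))/= lerDl sumr_ge0.
have entries j k : `|B j k| <= b.
  rewrite /B -(fintype.splitK j); case: (fintype.split j) => l; rewrite ?col_mxEu ?col_mxEd//.
  rewrite mxE; case: (_ == _); rewrite ?mulr1n ?mulr0n ?normr0// ger0_norm//.
apply: (@le_trans _ _ (\sum_(f : {ffun 'I_n -> 'I_(n + n)} | ~~ left f)
    n`!%:R * (kappa * b ^+ n))).
  apply: ler_sum => f; rewrite negb_forall => /existsP[k kn].
  apply: (@det_le_row _ b kappa k) => //; first by move=> j l; rewrite mxE.
  move=> l; rewrite mxE; rewrite -leqNgt in kn.
  have [r ->] : exists r, f k = rshift n r.
    have := kn; case: (fintype.splitP (f k)) => [r e|r e _]; first by rewrite e leqNgt ltn_ord.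
    by exists r; exact/val_inj.
  by rewrite col_mxEd mxE; case: (_ == _); rewrite ?mulr1n ?mulr0n ?normr0// ger0_norm.
rewrite sumr_const -[_ *+ _]mulr_natl /perturbation_const.
rewrite [leRHS](_ : _ = #|{ffun 'I_n -> 'I_(n + n)}|%:R * (n`!%:R * (kappa * b ^+ n))); last first.
  by rewrite !(mulrCA kappa).
rewrite ler_wpM2r//; first by rewrite !mulr_ge0// exprn_ge0.
by rewrite ler_nat max_card.
Qed.

End MinorsPerturbation.

(** * Covering the range by images of torus cells *)

Section UpperTorus.
Variables (R : realType) (n : nat) (G : wdigraph R n.+1).
Variable P : 'M[R]_(n, n.+1).
Hypothesis hP : @orthonormal_projection R n.+1 P.
Local Notation V := 'I_n.+1.
Local Notation mu := (@lebesgue_rV R _).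
Local Notation K := (lin_const G P).
Local Notation b := (Dbound G P + K + 1).

Lemma Dbound_ge0 : 0 <= Dbound G P.
Proof.
rewrite /Dbound !mulr_ge0 ?sumr_ge0// => a _; rewrite sumr_ge0// => d _.
exact: weight_ge0.
Qed.

Lemma shift_compact (c : 'rV[R]_n) (A : set 'rV[R]_n) : compact A ->
  compact [set c + x | x in A]%classic.
Proof.
apply: continuous_compact; apply: continuous_subspaceT => x.
exact: (@cvgD _ _ _ (nbhs x) _ (fun=> c) id c x (cvg_cst _) cvg_id).
Qed.

(* The linearization error on the cell is absorbed by a small cube. *)
Definition cell_cover (i : V) (c : 'rV[R]_n) (rho : R) : set 'rV[R]_n :=
  [set pgmap G P i c + z |
    z in zonotope (rho *: col_mx (Dpgmap G P i c) ((K * rho)%:M : 'M[R]_n))]%classic.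

Lemma cell_coverP i c rho x : 0 < rho -> cube c rho x ->
  cell_cover i c rho (pgmap G P i x).
Proof.
move=> r0 cx; have r0' := ltW r0.
pose err := pgmap G P i x - pgmap G P i c - (x - c) *m Dpgmap G P i c.
have cc : cube c rho c by move=> j; rewrite subrr normr0.
have herr j : `|err ord0 j| <= K * rho * rho.
  exact: (pgmap_linear_error G P i r0' r0' cx cc cx).
exists (pgmap G P i x - pgmap G P i c); last by rewrite addrC subrK.
(* The first block has coefficients (x - c) / rho, the second err / (K rho^2); both are in
   [-1, 1]. *)
exists (row_mx (rho^-1 *: (x - c)) ((K * rho * rho)^-1 *: err)).
  move=> j; rewrite [X in _ - X]mxE subr0 -(fintype.splitK j); case: (fintype.split j) => l /=.
    rewrite row_mxEl mxE normrM normfV (gtr0_norm r0) mulrC ler_pdivrMr// mul1r.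
    by have := cx l; rewrite !mxE.
  rewrite row_mxEr mxE normrM normfV.
  have K0 : 0 <= K * rho * rho := (mulr_ge0 (mulr_ge0 (lin_const_ge0 G P) r0') r0').
  (* For K rho^2 = 0 the inverse is 0 by convention; the coefficients are then 0, and the error
     itself vanishes. *)
  rewrite (ger0_norm K0); have [->|Kn] := eqVneq (K * rho * rho) 0.
    by rewrite invr0 mul0r ler01.
  by rewrite mulrC ler_pdivrMr ?mul1r// lt_neqAle eq_sym Kn.
rewrite scale_col_mx mul_row_col -!scalemxAl -!scalemxAr scalerA mulVf ?gt_eqF// scale1r.
rewrite mul_mx_scalar !scalerA.
rewrite (_ : _ *: err = err); first by rewrite /err addrC subrK.
have [Kn|Kn] := eqVneq (K * rho * rho) 0; last first.
  move: (lin_const G P) Kn => k Kn.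
  by rewrite (_ : _ * _ = 1) ?scale1r// [rho * _]mulrC mulVf.
have -> : err = 0.
  apply/rowP => j; rewrite [RHS]mxE; apply/eqP.
  by rewrite -normr_eq0 eq_le normr_ge0 andbT -[leRHS]Kn herr.
by rewrite scaler0.
Qed.

Lemma cell_cover_measurable i c rho : rV_measurable (cell_cover i c rho).
Proof.
apply: compact_rV_measurable; apply: shift_compact; exact: zonotope_compact.
Qed.

(** Scaling takes rho^n out of every minor, and the n! from the orderings of the Jacobian rows
    cancels the one in the zonotope bound. Beyond the prediction of the determinant only a term of
    order rho remains, relative to the cell volume. *)
Lemma lebesgue_cell_cover i c rho : 0 < rho <= 1 ->
  (mu (cell_cover i c rho) <=
   ((2 * rho) ^+ n * (`|\det (Dpgmap G P i c)| + rho * (K * perturbation_const n b)))%:E)%E.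
Proof.
move=> /andP[r0 r1]; have r0' := ltW r0.
rewrite /cell_cover lebesgue_rV_shift; last first.
  by apply: compact_rV_measurable; exact: zonotope_compact.
apply: le_trans (zonotope_volume _) _; rewrite lee_fin.
set B := col_mx _ _.
have -> : minors_sum (rho *: B) = rho ^+ n * minors_sum B.
  rewrite /minors_sum mulr_sumr; apply: eq_bigr => f _.
  rewrite -{2}(ger0_norm r0') -normrX -normrM -detZ.
  by congr (`|\det _|); apply/matrixP => x y; rewrite !mxE.
have K0 : 0 <= K by exact: lin_const_ge0.
have D0 := Dbound_ge0.
have hB : minors_sum B <= n`!%:R * `|\det (Dpgmap G P i c)| + K * rho * perturbation_const n b.
  apply: minors_sum_perturbation.
  - by lra.
  - by move=> j k; apply: le_trans (Dpgmap_le G P i c j k) _; lra.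
  - rewrite mulr_ge0//=; apply: (@le_trans _ _ K); first by rewrite ler_piMr.
    by lra.
have C0 : 0 <= perturbation_const n b by apply: perturbation_const_ge0; lra.
have f0 : 0 < n`!%:R :> R by rewrite ltr0n fact_gt0.
have f1 : 1 <= n`!%:R :> R by rewrite ler1n fact_gt0.
have key (u f r m : R) : u / f * (r * m) = u * r * (m / f).
  by rewrite mulrACA (mulrC f^-1).
rewrite key -exprMn; apply: ler_wpM2l; first by rewrite exprn_ge0// mulr_ge0.
rewrite ler_pdivrMr//; apply: le_trans hB _.
have Y0 : 0 <= rho * (K * perturbation_const n b) by exact: mulr_ge0 r0' (mulr_ge0 K0 C0).
have -> : K * rho * perturbation_const n b = rho * (K * perturbation_const n b).
  by move: (perturbation_const n b) (lin_const G P) => c' k; ring.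
move: (rho * (K * _)) Y0 => Y Y0.
by rewrite mulrDl (mulrC n`!%:R) lerD2l ler_peMr.
Qed.

Lemma sin_periodic_int (x : R) (z : int) : sin (x + 2 * pi * z%:~R) = sin x.
Proof.
have nat_case (y : R) (m : nat) : sin (y + 2 * pi * m%:R) = sin y.
  rewrite -[RHS](periodicn (@sinD2pi R) m); congr sin; congr (_ + _).
  by rewrite -(mulr_natl pi 2) -(mulr_natr (2 * pi) m).
case: z => m; first exact: nat_case.
by rewrite NegzE -[LHS](nat_case _ m.+1) mulrNz mulrN subrK.
Qed.

Definition grid_point (k : nat) (h : R) (c : {ffun 'I_n -> 'I_k}) : 'rV[R]_n :=
  \row_j (((c j)%:R + 2^-1) * h).

(** The frequencies depend only on phase differences modulo 2 pi, so the phases can be taken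
    relative to vertex i and reduced to [0, 2 pi). *)
Lemma torus_cover (i : V) (k : nat) (theta : 'rV[R]_n.+1) : (0 < k)%N ->
  exists (c : {ffun 'I_n -> 'I_k}) x,
    gmap G theta = gmap G (pin i x) /\ cube (grid_point (2 * pi / k%:R) c) (pi / k%:R) x.
Proof.
move=> k0; have k0' : 0 < k%:R :> R by rewrite ltr0n.
have p0 : 0 < 2 * pi :> R by rewrite mulr_gt0// pi_gt0.
pose t a := theta ord0 a - theta ord0 i.
pose z a : int := Num.floor (t a / (2 * pi)).
pose y a := t a - 2 * pi * (z a)%:~R.
have yE a : 0 <= y a < 2 * pi.
  have := floor_itv (t a / (2 * pi)); rewrite -/(z a) => /andP[].
  rewrite intrD ler_pdivlMr// ltr_pdivrMr// mulrDl mul1r => h1 h2.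
  by rewrite /y; apply/andP; split; lra.
pose h : R := 2 * pi / k%:R.
have h0 : 0 < h by rewrite divr_gt0.
have lt a : (Num.truncn (y a / h) < k)%N.
  have /andP[ya yb] := yE a.
  have := Num.Theory.truncn_itv (divr_ge0 ya (ltW h0)) => /andP[h1 _].
  rewrite -(ltr_nat R); apply: le_lt_trans h1 _.
  by rewrite ltr_pdivrMr// /h mulrCA divff ?mulr1// gt_eqF.
exists [ffun j => Ordinal (lt (lift i j))], (\row_j y (lift i j)); split.
  have y_i : y i = 0.
    by rewrite /y /z /t subrr mul0r floor0 mulr0 subr0.
  have pinE' a : pin i (\row_j y (lift i j)) ord0 a = y a.
    by rewrite mxE; case: unliftP => [j ->|->]; rewrite ?mxE.
  apply/rowP => a; rewrite !gmapE; apply: eq_bigr => d _; congr (_ * _).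
  rewrite !pinE' -(sin_periodic_int _ (z d - z a)); congr sin.
  by rewrite /y /t intrB; ring.
move=> j; rewrite !mxE ffunE /=; set a := lift i j.
have /andP[ya yb] := yE a.
have := Num.Theory.truncn_itv (divr_ge0 ya (ltW h0)) => /andP[].
rewrite ler_pdivlMr// ltr_pdivrMr// -natr1 -/h => h1 h2.
rewrite (_ : pi / k%:R = h / 2); last by rewrite /h; field; rewrite gt_eqF.
by rewrite ler_norml; apply/andP; split; lra.
Qed.

Lemma lee_locked_upper' : (Vol_locked G P <= (Vol_upper' G)%:E)%E.
Proof.
pose M : R := \sum_(T in ST G) graph_weight G T.
pose C : R := K * perturbation_const n b.
have K0 : 0 <= K by exact: lin_const_ge0.
have D0 := Dbound_ge0.
have C0 : 0 <= C.
  by rewrite /C mulr_ge0//; apply: perturbation_const_ge0; lra.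
have p0 := @pi_gt0 R.
have pp0 : 0 < 2 * pi :> R by rewrite mulr_gt0.
have key k : pi < k%:R :> R ->
    (Vol_locked G P <= ((2 * pi) ^+ n * (M / Num.sqrt n.+1%:R + pi / k%:R * C))%:E)%E.
  move=> kp; have k0' : 0 < k%:R :> R by exact: lt_trans p0 kp.
  have k0 : (0 < k)%N by rewrite -(ltr_nat R).
  pose rho : R := pi / k%:R.
  have r0 : 0 < rho by rewrite divr_gt0.
  have r1 : rho <= 1 by rewrite ler_pdivrMr// mul1r ltW.
  pose F (c : {ffun 'I_n -> 'I_k}) := cell_cover ord0 (grid_point (2 * pi / k%:R) c) rho.
  apply: (@le_trans _ _ (mu (\big[setU/set0]_(c <- index_enum {ffun 'I_n -> 'I_k}) F c)%classic)).
    apply: lebesgue_rV_mono => _ [_ [theta _ <-] <-].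
    have [c [x [-> cx]]] := @torus_cover ord0 k theta k0.
    rewrite -bigcup_seq; exists c; first by rewrite /= mem_index_enum.
    exact: cell_coverP.
  apply: le_trans (lebesgue_rV_bigcup _ _) _; first by move=> c; exact: cell_cover_measurable.
  apply: (@le_trans _ _ (\sum_(c : {ffun 'I_n -> 'I_k})
     ((2 * rho) ^+ n * (M / Num.sqrt n.+1%:R + rho * C))%:E)%E).
    apply: lee_sum => c _; apply: le_trans (lebesgue_cell_cover _ _ _) _; first by rewrite r0.
    rewrite lee_fin ler_wpM2l//; first by rewrite exprn_ge0// mulr_ge0// ltW.
    rewrite lerD2r (det_Dpgmap _ hP) ler_wpM2r ?invr_ge0 ?sqrtr_ge0//.
    exact: tree_sum_le.
  rewrite sumEFin lee_fin sumr_const card_ffun !card_ord -[_ *+ _]mulr_natl.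
  rewrite natrX mulrA -exprMn.
  (* The k^n cells of side 2 pi / k add up to the volume (2 pi)^n of the torus. *)
  rewrite (_ : k%:R * (2 * rho) = 2 * pi)//.
  by rewrite /rho; field; rewrite gt_eqF.
apply/lee_addgt0Pr => e e0.
(* The first summand makes the error at most e once k > X; the second ensures pi < k, that is, cells
   of radius below 1. *)
pose X : R := (2 * pi) ^+ n * pi * C / e + pi.
have kX := truncnS_gt X.
set k := (Num.truncn X).+1 in kX.
have X1 : 0 <= (2 * pi) ^+ n * pi * C / e.
  apply: divr_ge0 (ltW e0); apply: mulr_ge0 C0; apply: mulr_ge0 (ltW p0).
  exact: exprn_ge0 (ltW pp0).
have kp : pi < k%:R :> R by apply: le_lt_trans kX; rewrite lerDr.
have k0 : 0 < k%:R :> R by exact: lt_trans p0 kp.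
apply: le_trans (key k kp) _; rewrite -EFinD lee_fin /Vol_upper' /= -/M mulrDr.
apply: lerD; first by rewrite mulrA mulrAC.
have key2 (x y z c : R) : x * (y / z * c) = x * y * c / z.
  by rewrite !mulrA mulrAC.
rewrite key2 ler_pdivrMr// [leRHS]mulrC -ler_pdivrMr//.
by apply: le_trans (ltW kX); rewrite /X lerDl ltW.
Qed.

End UpperTorus.

(** * Stability *)

Section MatrixNorm.
Variables (R : realType) (n : nat).

Lemma coord_le_norm (x : 'rV[R]_n) i : `|x ord0 i| <= `|x|.
Proof.
rewrite [leRHS]/Num.norm/= mx_normrE.
by apply/bigmax_geP; right; exists (ord0, i).
Qed.

Lemma norm_le_coord (x : 'rV[R]_n) r : 0 <= r -> (forall i, `|x ord0 i| <= r) -> `|x| <= r.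
Proof.
move=> r0 h; rewrite [leLHS]/Num.norm/= mx_normrE.
by apply/bigmax_leP; split => // -[i j] _ /=; rewrite (ord1 i).
Qed.

End MatrixNorm.

Section LeftEigenvector.
Variables (R : realType) (N : nat) (w : 'I_N -> 'I_N -> R).
Hypothesis w_ge0 : forall a b, 0 <= w a b.
Local Notation toC := (real_complex R).

(* Gershgorin argument in the l^1 norm: unlike the usual one in the l^oo norm it
   applies to left eigenvectors, and it is these that extend from P J P^T to J. *)
Lemma laplacian_left_eigenvalue (v : 'rV[R[i]]_N) z : v != 0 -> z != 0 ->
  v *m map_mx toC (laplacian w) = z *: v -> 0 < complex.Re z.
Proof.
move=> v0 z0 vL; rewrite ltNge; apply/negP => z_le.
pose d a : R := \sum_b w a b.
have d0 a : 0 <= d a by apply: sumr_ge0.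
have rowE b : (toC (d b) - z) * v ord0 b = \sum_a v ord0 a * toC (w a b).
  have /rowP/(_ b) := vL; rewrite !mxE => e.
  have -> : (toC (d b) - z) * v ord0 b = toC (d b) * v ord0 b - z * v ord0 b by rewrite mulrBl.
  rewrite -e; apply/eqP; rewrite subr_eq; apply/eqP; rewrite -big_split/=.
  rewrite -(sum_mul_delta (fun a => toC (d a) * v ord0 a) b); apply: eq_bigr => a _.
  rewrite !mxE -mulrDr mulrAC mulrC; congr (_ * _).
  rewrite -[b == a]eq_sym /d.
  have -> : \sum_c w a c * ((a == b)%:R - (c == b)%:R) = (\sum_c w a c) * (a == b)%:R - w a b.
    under eq_bigr do rewrite mulrBr.
    rewrite sumrB -mulr_suml; congr (_ - _).
    rewrite (bigD1 b)//= eqxx mulr1 big1 ?addr0// => x /negbTE ->.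
    by rewrite mulr0.
  by move: (\sum_c _) => S0; rewrite raddfB /= rmorphM rmorph_nat addrC subrK.
(* A non-zero z with Re z <= 0 is strictly farther from d_b >= 0 than the origin is. *)
have lt b : toC (d b) < `|toC (d b) - z|.
  rewrite normc_def ltcR; case: z z0 z_le {vL rowE} => x y z0 /= xle.
  rewrite -{1}(ger0_norm (d0 b)) -sqrtr_sqr add0r ltr_sqrt; last first.
    have [y0|y0] := eqVneq y 0; last first.
      by rewrite ltr_wpDl ?sqr_ge0// sqrrN exprn_even_gt0.
    rewrite ltr_wpDr ?sqr_ge0// exprn_even_gt0//= gt_eqF//.
    rewrite ltr_wpDl// oppr_gt0 lt_neqAle xle andbT.
    by apply: contra z0 => /eqP ->; rewrite y0 eq_complex /= !eqxx.
  have := d0 b; set D := d b => D0.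
  have [y0|y0] := eqVneq y 0.
    have x0 : x < 0.
      rewrite lt_neqAle xle andbT; apply: contra z0 => /eqP ->.
      by rewrite y0 eq_complex /= !eqxx.
    by rewrite y0; nra.
  have : 0 < y ^+ 2 by rewrite exprn_even_gt0.
  by nra.
have [b vb] : exists b, v ord0 b != 0.
  apply/existsP; rewrite -negb_forall; apply: contra v0 => /forallP h.
  by apply/eqP/rowP => b; rewrite mxE; exact/eqP.
have : \sum_b toC (d b) * `|v ord0 b| < \sum_b `|toC (d b) - z| * `|v ord0 b|.
  rewrite (bigD1 b)//= [ltRHS](bigD1 b)//=; apply: ltr_leD.
    by rewrite ltr_pM2r ?normr_gt0.
  by apply: ler_sum => a _; rewrite ler_wpM2r// ltW.
move=> /lt_geF/negbT/negP; apply.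
(* Absolute values in the eigenvector equation, summed over b and with the sums exchanged, bound the
   sum of |d_b - z| |v_b| by that of d_a |v_a|, against the strict inequality. *)
apply: (@le_trans _ _ (\sum_b \sum_a `|v ord0 a| * toC (w a b))).
  apply: ler_sum => a _; rewrite -normrM rowE.
  apply: le_trans (ler_norm_sum _ _ _) _; apply: ler_sum => c _.
  by rewrite normrM [X in _ * X <= _]normc_def/= expr0n addr0 sqrtr_sqr (ger0_norm (w_ge0 _ _)).
rewrite exchange_big/=; apply: ler_sum => a _.
by rewrite -mulr_sumr mulrC /d rmorph_sum.
Qed.

End LeftEigenvector.

Section Stability.
Variables (R : realType) (n : nat) (G : wdigraph R n.+1).
Variable P : 'M[R]_(n, n.+1).
Hypothesis hP : @orthonormal_projection R n.+1 P.
Local Notation V := 'I_n.+1.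
Local Notation w := (weight G).
Local Notation toC := (real_complex R).

Lemma diff_gmap (theta : 'rV[R]_n.+1) :
  'd (gmap G) theta = (fun h => h *m (lapl G theta)^T) :> ('rV[R]_n.+1 -> 'rV[R]_n.+1).
Proof.
apply: (@diff_unique R _ _ _ (mulmxr (lapl G theta)^T)).
  exact: continuous_mulmx.
apply/eqaddoP => _/posnumP[e].
pose C := 4 * (\sum_a \sum_b w a b) + 1.
have W0 := total_weight_ge0 G.
have C0 : 0 < C by rewrite /C; lra.
have near0 : \forall h \near (0 : 'rV[R]_n.+1), `|h| <= e%:num / C.
  by apply: nbhs0_le; rewrite divr_gt0.
near=> h.
have hC : C * `|h| <= e%:num.
  rewrite mulrC -ler_pdivlMr//; near: h.
  exact: near0.
apply: (@le_trans _ _ (C * `|h| * `|h|)); last by rewrite ler_wpM2r.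
apply: norm_le_coord => [|a].
  by rewrite !mulr_ge0// ltW.
have := @gmap_linear_error R n G theta (h + theta) theta `|h| `|h| a.
rewrite addrK => H.
have -> : (gmap G \o shift theta - (cst (gmap G theta) + mulmxr (lapl G theta)^T)) h =
    gmap G (h + theta) - gmap G theta - h *m (lapl G theta)^T.
  by rewrite -addrA -opprD.
apply: le_trans (H _ _ _) _.
- by move=> b; rewrite !mxE addrK; exact: coord_le_norm.
- by move=> b; rewrite subrr normr0.
- by move=> b; rewrite !mxE addrK; exact: coord_le_norm.
by rewrite ler_wpM2r// ler_wpM2r// /C; have := row_weight_le G a; lra.
Unshelve. all: by end_near. Qed.

Lemma JmxE (theta : 'rV[R]_n.+1) : Jmx G theta = lapl G theta.
Proof.
rewrite /Jmx /jacobian; apply/matrixP => i j; rewrite mxE mxE diff_gmap.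
by rewrite -rowE !mxE.
Qed.

Lemma projection_complement : P^T *m P = 1%:M - n.+1%:R^-1 *: (const_mx 1 : 'M[R]_n.+1).
Proof.
pose J : 'M[R]_n.+1 := const_mx 1.
apply/matrixP => i j.
have row_id (u : 'rV[R]_n.+1) : u *m (P^T *m P) = u - n.+1%:R^-1 *: (u *m J).
  have [c cE] : exists c, u - u *m (P^T *m P) = c *: const_mx 1.
    apply: (projection_ker hP).
    by rewrite mulmxBl -!mulmxA (projection_orth hP) mulmx1 subrr.
  have PJ : P *m J = 0.
    have -> : J = (const_mx 1 : 'rV[R]_n.+1)^T *m (const_mx 1 : 'rV[R]_n.+1).
      by apply/matrixP => a b; rewrite !mxE big_ord1 !mxE mulr1.
    by rewrite mulmxA (projection_ones hP) mul0mx.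
  have uJ : u *m J = c *: (n.+1%:R *: const_mx 1).
    have : (u - u *m (P^T *m P)) *m J = u *m J.
      by rewrite mulmxBl -!mulmxA PJ !mulmx0 subr0.
    rewrite cE -scalemxAl => <-; congr (_ *: _).
    apply/rowP => b; rewrite !mxE.
    under eq_bigr do rewrite !mxE mulr1.
    by rewrite sumr_const card_ord mulr1.
  rewrite uJ !scalerA mulrCA mulVf ?pnatr_eq0// mulr1 -cE.
  by rewrite opprB addrC subrK.
have := row_id (delta_mx 0 i); rewrite -!rowE => /rowP/(_ j).
rewrite !mxE => ->; congr (_ - _).
by rewrite eqxx eq_sym.
Qed.

Lemma lapl_ones theta : lapl G theta *m (const_mx 1 : 'cV[R]_n.+1) = 0.
Proof.
apply/matrixP => a b; rewrite !mxE.
rewrite -[RHS](laplacian_row_sum (fun a b => w a b * cos (theta ord0 a - theta ord0 b)) a).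
by apply: eq_bigr => u _; rewrite [X in _ * X]mxE mulr1.
Qed.

(** If u is in the left kernel, then v = uP has vL proportional to (1, ..., 1); since L annihilates
    the ones, vL = 0. Then u also kills the Jacobian of the pinned map, whose determinant is
    [tree_sum] up to a factor. *)
Lemma det_reduced_lapl theta : tree_sum G theta != 0 -> \det (P *m lapl G theta *m P^T) != 0.
Proof.
move=> t0; apply/negP => /det0P[u u0 uL].
pose L := lapl G theta; pose v := u *m P.
have vL : v *m L = 0.
  have [c cE] : exists c, v *m L = c *: (const_mx 1 : 'rV[R]_n.+1).
    by apply: (projection_ker hP); rewrite -uL /v !mulmxA.
  have : v *m L *m (const_mx 1 : 'cV[R]_n.+1) = 0 by rewrite -mulmxA lapl_ones mulmx0.
  rewrite cE => /matrixP/(_ 0 0); rewrite !mxE.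
  under eq_bigr do rewrite !mxE !mulr1.
  rewrite sumr_const card_ord => /eqP; rewrite -mulr_natr mulf_eq0 pnatr_eq0 orbF.
  by move=> /eqP ->; rewrite scale0r.
have : `|\det (row' ord0 L^T *m P^T)| != 0.
  rewrite (det_projected_lapl G hP ord0 theta).
  by rewrite mulf_neq0 ?normr_eq0 ?invr_eq0 ?sqrtr_eq0 -?ltNge.
move/negP; apply; rewrite normr_eq0 -det_tr; apply/det0P; exists u => //.
rewrite trmx_mul trmxK mulmxA -/v; apply/rowP => j; rewrite mxE.
have /rowP/(_ (lift ord0 j)) := vL; rewrite !mxE => e.
by rewrite -[RHS]e; apply: eq_bigr => k _; rewrite !mxE.
Qed.

(** An eigenvalue z of the reduced matrix is non-zero because its determinant is. A left eigenvector
    u extends to v = uP: the defect vL - zv is annihilated both by the projection and by pairing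
    with the ones, hence is 0. *)
Lemma Theta_stableP theta : tree_sum G theta != 0 ->
  (forall a b, 0 <= w a b * cos (theta ord0 a - theta ord0 b)) ->
  @Theta_stable R n.+1 G P theta.
Proof.
move=> t0 wc z; rewrite JmxE => zM.
have z0 : z != 0.
  apply/eqP => z0; move: zM; rewrite z0 -(rmorph0 toC) eigenvalue_map.
  move=> /eigenvalueP[u]; rewrite scale0r => uL u0.
  by have /det0P := det_reduced_lapl t0; apply; exists u.
have [u uM u0] := eigenvalueP zM.
pose PC := map_mx toC P; pose LC := map_mx toC (lapl G theta).
have MC : map_mx toC (P *m lapl G theta *m P^T) = PC *m LC *m PC^T.
  by rewrite !map_mxM /PC map_trmx.
have PPC : PC *m PC^T = 1%:M.
  by rewrite map_trmx -map_mxM (projection_orth hP) map_mx1.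
pose v := u *m PC.
have v0 : v != 0.
  apply: contra u0 => /eqP v0.
  by rewrite -[u]mulmx1 -PPC mulmxA -/v v0 mul0mx.
apply: (@laplacian_left_eigenvalue _ _ (fun a b => w a b * cos (theta ord0 a - theta ord0 b)) _ v z) => //.
rewrite -/(lapl G theta) -/LC; apply/eqP; rewrite -subr_eq0; apply/eqP.
set y := v *m LC - z *: v.
have yP : y *m PC^T = 0.
  by rewrite mulmxBl -scalemxAl /v -!mulmxA (mulmxA PC LC) -mulmxA PPC mulmx1 -uM MC !mulmxA subrr.
pose o : 'cV[R[i]]_n.+1 := const_mx 1.
have Po : PC *m o = 0.
  have -> : o = map_mx toC (const_mx 1 : 'cV[R]_n.+1) by rewrite map_const_mx.
  rewrite -map_mxM -trmx_const (projection_ones hP).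
  by rewrite map_mx0.
have yo : y *m o = 0.
  rewrite mulmxBl -scalemxAl -!mulmxA Po mulmx0 scaler0 subr0.
  have -> : LC *m o = 0.
    have -> : o = map_mx toC (const_mx 1 : 'cV[R]_n.+1) by rewrite map_const_mx.
    by rewrite -map_mxM lapl_ones map_mx0.
  by rewrite !mulmx0.
have yJ : y *m (const_mx 1 : 'M[R[i]]_n.+1) = 0.
  have -> : const_mx 1 = o *m (const_mx 1 : 'rV[R[i]]_n.+1).
    by apply/matrixP => a b; rewrite !mxE big_ord1 !mxE mulr1.
  by rewrite mulmxA yo mul0mx.
have e1 : 1%:M = PC^T *m PC + map_mx toC (n.+1%:R^-1 *: (const_mx 1 : 'M[R]_n.+1)).
  rewrite map_trmx -map_mxM projection_complement -map_mxD subrK.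
  by rewrite map_mx1.
rewrite -[y]mulmx1 e1 mulmxDr mulmxA yP mul0mx add0r map_mxZ map_const_mx.
by rewrite -scalemxAr /= rmorph1 yJ scaler0.
Qed.

End Stability.

(** * Lower bound *)

Section DeterminantBounds.
Variables (R : realType).

Lemma det_le m (A : 'M[R]_m) b : 1 <= b -> (forall j k, `|A j k| <= b) ->
  `|\det A| <= m`!%:R * b ^+ m.
Proof.
move=> b1 Ab; rewrite /determinant; apply: le_trans (ler_norm_sum _ _ _) _.
apply: (@le_trans _ _ (\sum_(s : 'S_m) b ^+ m)).
  apply: ler_sum => s _; rewrite normrM normrX normrN1 expr1n mul1r normr_prod.
  rewrite -[in leRHS](card_ord m) -prodr_const.
  by apply: ler_prod => i _; rewrite normr_ge0 Ab.
by rewrite sumr_const -[_ *+ _]mulr_natl card_Sn.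
Qed.

Lemma invmx_le m (A : 'M[R]_m) b e j k : 1 <= b -> (forall j k, `|A j k| <= b) ->
  0 < e <= `|\det A| -> `|invmx A j k| <= m.-1`!%:R * b ^+ m.-1 / e.
Proof.
move=> b1 Ab /andP[e0 eA].
have A0 : \det A != 0 by rewrite -normr_gt0 (lt_le_trans e0).
rewrite /invmx unitmxE unitfE A0 !mxE /cofactor mulrC !normrM normfV.
rewrite normrX normrN1 expr1n mul1r; apply: ler_pM => //.
- by apply: det_le => // j' k'; rewrite !mxE.
- by rewrite lef_pV2// posrE (lt_le_trans e0).
Qed.

End DeterminantBounds.

(** * Quantitative local surjectivity *)

Section InverseFunction.
Variables (R : realType) (n : nat).

HB.instance Definition _ := Complete.on 'rV[R]_n.

Lemma cube_closed (c : 'rV[R]_n) r : closed (cube c r).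
Proof. by apply: compact_closed; [exact: norm_hausdorff|exact: cube_compact]. Qed.

Lemma cube_center (c : 'rV[R]_n) r : 0 <= r -> cube c r c.
Proof. by move=> r0 j; rewrite subrr normr0. Qed.

(* x solves f x = f c + u *m A iff it is fixed by
   x |-> c + u - (f x - f c - (x - c) *m A) *m invmx A. *)
Lemma perturbed_linear_onto (f : 'rV[R]_n -> 'rV[R]_n) (c : 'rV[R]_n) (A : 'M[R]_n)
    (rho q a kappa : R) :
  A \in unitmx -> (forall j k, `|invmx A j k| <= a) -> 0 < rho -> 0 < q < 1 ->
  0 <= kappa -> n%:R * a * kappa <= 1 - q ->
  (forall (x y : 'rV[R]_n) (m : R), 0 <= m -> cube c rho x -> cube c rho y ->
    (forall j, `|x ord0 j - y ord0 j| <= m) ->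
    forall j, `|(f x - f y - (x - y) *m A) ord0 j| <= kappa * m) ->
  forall u, cube 0 (q * rho) u -> exists2 x, cube c rho x & f x = f c + u *m A.
Proof.
move=> Au Aa rho0 /andP[q0 q1] k0 contr ferr u hu.
pose rem x := f x - f c - (x - c) *m A.
pose T x := c + u - rem x *m invmx A.
have TB (x y : 'rV[R]_n) (m : R) : 0 <= m -> cube c rho x -> cube c rho y ->
    (forall j, `|x ord0 j - y ord0 j| <= m) ->
    forall j, `|((rem x - rem y) *m invmx A) ord0 j| <= (1 - q) * m.
  move=> m0 cx cy xy j.
  have -> : rem x - rem y = f x - f y - (x - y) *m A.
    by rewrite /rem !mulmxBl; apply/rowP => l; rewrite !mxE; ring.
  rewrite mxE; apply: le_trans (ler_norm_sum _ _ _) _.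
  apply: (@le_trans _ _ (\sum_(l < n) kappa * m * a)).
    by apply: ler_sum => l _; rewrite normrM; apply: ler_pM => //; exact: ferr.
  rewrite sumr_const card_ord -[_ *+ _]mulr_natl.
  apply: le_trans (ler_wpM2r m0 contr); rewrite le_eqVlt; apply/orP; left; apply/eqP.
  by ring.
have cc := cube_center c (ltW rho0).
have rem_c : rem c = 0 by rewrite /rem !subrr mul0mx subrr.
have funT : set_fun (cube c rho) (cube c rho) T.
  move=> x cx j; have := TB x c rho (ltW rho0) cx cc cx j.
  rewrite rem_c subr0 => h; have := hu j.
  have -> : T x ord0 j - c ord0 j = u ord0 j - (rem x *m invmx A) ord0 j.
    have key (y z t : 'rV[R]_n) : (y + z - t) ord0 j - y ord0 j = z ord0 j - t ord0 j.
      by rewrite !mxE; ring.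
    exact: key.
  rewrite [X in _ - X]mxE subr0; move: h; rewrite !ler_norml => /andP[? ?] /andP[? ?].
  by apply/andP; split; lra.
have q01 : 0 <= 1 - q by lra.
have [x cx xT] : exists2 x, cube c rho x & x = T x.
  apply: (@banach_fixed_point R 'rV[R]_n (cube c rho) (mkfun_fun funT)).
  - exists (NngNum q01); split => /=; first by lra.
    move=> [x y] [/= cx cy]; apply: norm_le_coord => [|j]; first by rewrite mulr_ge0.
    have xy l : `|x ord0 l - y ord0 l| <= `|x - y|.
      by have := coord_le_norm (x - y) l; rewrite !mxE.
    have := TB x y _ (normr_ge0 _) cx cy xy j.
    have key (p y' z : 'rV[R]_n) : `|(p - y' - (p - z)) ord0 j| = `|(y' - z) ord0 j|.
      by rewrite -[RHS]normrN; congr (`|_|); rewrite !mxE; ring.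
    by rewrite mulmxBl -(key (c + u)).
  - exact: cube_closed.
  - by exists c.
have xE : (x - c) *m A = u *m A - rem x.
  have -> : x - c = u - rem x *m invmx A.
    by rewrite [in LHS]xT /T -(addrA c) [c + _]addrC addrK.
  by rewrite mulmxBl -mulmxA mulVmx// mulmx1.
exists x => //; apply/eqP; rewrite addrC -subr_eq -(subrK ((x - c) *m A) (f x - f c)).
by rewrite -/(rem x) xE addrC subrK.
Qed.

End InverseFunction.

Section LocalSurjectivity.
Variables (R : realType) (n : nat) (G : wdigraph R n.+1).
Variable P : 'M[R]_(n, n.+1).
Hypothesis hP : @orthonormal_projection R n.+1 P.
Local Notation mu := (@lebesgue_rV R _).
Local Notation w := (weight G).
Local Notation K := (lin_const G P).

(** Times rho, this is a Lipschitz constant of the fixed-point map on a cube of radius rho. The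
    fraction bounds the entries of the inverse Jacobian by Cramer's rule when the determinant is at
    least e in absolute value. *)
Definition inverse_bound (e : R) : R :=
  n%:R * (n.-1`!%:R * (Dbound G P + 1) ^+ n.-1 / e) * K.

Lemma pgmap_cube_onto i c (rho q e : R) : 0 < rho -> 0 < q < 1 ->
  0 < e <= `|\det (Dpgmap G P i c)| -> inverse_bound e * rho <= 1 - q ->
  forall u, cube 0 (q * rho) u ->
  exists2 x, cube c rho x & pgmap G P i x = pgmap G P i c + u *m Dpgmap G P i c.
Proof.
move=> r0 q01 he hb.
pose a : R := n.-1`!%:R * (Dbound G P + 1) ^+ n.-1 / e.
have K0 : 0 <= K by exact: lin_const_ge0.
have D0 := @Dbound_ge0 R n G P.
apply: (@perturbed_linear_onto R n _ c _ rho q a (K * rho)) => //.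
- rewrite unitmxE unitfE -normr_gt0; case/andP: he => e0; exact: lt_le_trans.
- move=> j k; apply: invmx_le => //; first by lra.
  by move=> j' k'; apply: le_trans (Dpgmap_le G P i c j' k') _; lra.
- exact: mulr_ge0 K0 (ltW r0).
- apply: le_trans hb; rewrite /inverse_bound -/a le_eqVlt; apply/orP; left; apply/eqP.
  by move: (lin_const G P) a => k b; ring.
- move=> x y m m0 cx cy xy j.
  exact: (pgmap_linear_error G P i (ltW r0) m0 cx cy xy j).
Qed.

(** The image contains the parallelepiped that the Jacobian makes of the cube of radius q rho. *)
Lemma lebesgue_pgmap_cube i c (rho q e : R) : 0 < rho -> 0 < q < 1 ->
  0 < e <= `|\det (Dpgmap G P i c)| -> inverse_bound e * rho <= 1 - q ->
  (((2 * q * rho) ^+ n * `|\det (Dpgmap G P i c)|)%:E <=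
   mu [set pgmap G P i x | x in cube c rho]%classic)%E.
Proof.
move=> r0 q01 he hb; set A := Dpgmap G P i c; set p := pgmap G P i c.
have A0 : \det A != 0 by rewrite -normr_gt0; case/andP: he => e0; exact: lt_le_trans.
have qr0 : 0 <= q * rho by rewrite mulr_ge0// ltW//; case/andP: q01.
have mc : rV_measurable (cube (0 : 'rV[R]_n) (q * rho)).
  by apply: compact_rV_measurable; exact: cube_compact.
have cA : compact [set u *m A | u in cube (0 : 'rV[R]_n) (q * rho)]%classic.
  apply: continuous_compact; last exact: cube_compact.
  by apply: continuous_subspaceT; exact: continuous_mulmx.
have <- : mu [set p + z | z in [set u *m A | u in cube 0 (q * rho)]]%classic =
    ((2 * q * rho) ^+ n * `|\det A|)%:E.
  rewrite lebesgue_rV_shift; last exact: compact_rV_measurable.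
  by rewrite lebesgue_rV_linear// lebesgue_cube// -EFinM mulrC mulrA.
apply: lebesgue_rV_mono => _ [_ [u hu <-] <-].
by have [x cx <-] := pgmap_cube_onto r0 q01 he hb hu; exists x.
Qed.

Lemma continuous_pgmap i : continuous (pgmap G P i).
Proof.
have cp a : continuous (fun x : 'rV[R]_n => pin i x ord0 a).
  move=> x; rewrite (_ : (fun x => _) = if unlift i a is Some j then
      (fun x : 'rV[R]_n => x ord0 j) else (fun=> 0)).
    case: unlift => [j|]; first exact: coord_continuous.
    exact: cst_continuous.
  by apply/funext => y; rewrite mxE; case: unlift.
have cg : continuous (fun x => gmap G (pin i x)).
  apply: continuous_row => a.
  rewrite (_ : (fun x => _) = fun x => \sum_b w a b * sin (pin i x ord0 a - pin i x ord0 b)).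
    apply: (@continuous_big R _ +%R) => [|b _]; first exact: add_continuous.
    move=> x; apply: (@cvgM R _ (nbhs x) _ (cst (w a b))); first exact: cvg_cst.
    apply: (@continuous_comp _ _ _ (fun x => pin i x ord0 a - pin i x ord0 b) sin); last exact: continuous_sin.
    apply: (@cvgB _ _ _ (nbhs x) _ (fun x => pin i x ord0 a) (fun x => pin i x ord0 b)); exact: cp.
  by apply/funext => x; rewrite gmapE.
move=> x; apply: (@continuous_comp _ _ _ (fun x => gmap G (pin i x)) (mulmx^~ P^T)); first exact: cg.
exact: continuous_mulmx.
Qed.

End LocalSurjectivity.

(** * Injectivity and stability for acute phase vectors *)

Section Injectivity.
Variables (R : realType) (n : nat) (G : wdigraph R n.+1).
Variable P : 'M[R]_(n, n.+1).
Hypothesis hP : @orthonormal_projection R n.+1 P.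
Local Notation V := 'I_n.+1.
Local Notation w := (weight G).
Variables (T : graph n.+1) (r : V).
Hypothesis Tr : ditree_rooted G r T.
Hypothesis Tspan : verts T = [set: V].

Lemma span_outf_ind (S : V -> Prop) a : S a ->
  (forall v, v != r -> S v -> S (outf T v)) -> S r.
Proof.
move=> Sa hS; have [pr _ _ conn _] := ditree_rooted_out Tr.
have : fconnect (outf T) a r by apply: conn; rewrite Tspan.
move=> /iter_findex <-; elim: (findex _ _ _) => //= k IH.
have [e|kr] := eqVneq (iter k (outf T) a) r; first by rewrite e pr -e.
exact: hS.
Qed.

Lemma span_root_ind (S : V -> Prop) a : S a ->
  (forall u v, 0 < w u v -> S u -> S v) -> S r.
Proof.
move=> Sa hS; apply: span_outf_ind Sa _ => v vr; apply: hS; apply: weight_gt0.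
have [[sG _] _ _ _ _] := Tr; have [_ _ _ _ arc] := ditree_rooted_out Tr.
by apply: (fintype.subsetP sG); apply: arc; rewrite ?Tspan.
Qed.

Lemma sin_le_quarter (x y : R) : `|x| < pi / 2 -> `|y| < pi / 2 -> (sin x <= sin y) = (x <= y).
Proof.
rewrite !ltr_norml => /andP[x1 x2] /andP[y1 y2].
by rewrite !leNgt ltr_sin// in_itv/= !ltW.
Qed.

Definition acute (theta : 'rV[R]_n.+1) : Prop :=
  forall a b, `|theta ord0 a - theta ord0 b| < pi / 2.

(* Where theta - theta' is maximal, every term of gmap G theta is at least the
   corresponding term of gmap G theta'; equality propagates the maximum along the
   edges, down to the root. *)
Lemma gmap_max_principle theta theta' c : acute theta -> acute theta' ->
  gmap G theta - gmap G theta' = c *: const_mx 1 ->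
  0 <= c /\ (c = 0 -> forall a, theta ord0 a - theta' ord0 a <= theta ord0 r - theta' ord0 r).
Proof.
move=> ac ac' E; pose d a := theta ord0 a - theta' ord0 a.
have [m _ mP] : exists2 m, true & forall a, d a <= d m.
  by case: (@Order.TotalTheory.arg_maxP _ _ V r xpredT d) => // m _ h; exists m => // a; exact: h.
pose term u v := w u v * (sin (theta ord0 u - theta ord0 v) - sin (theta' ord0 u - theta' ord0 v)).
have cE u : c = \sum_v term u v.
  have /rowP/(_ u) := E; rewrite [X in _ = X -> _]mxE [X in _ * X]mxE mulr1 => <-.
  rewrite mxE [X in _ + X]mxE !gmapE -sumrB; apply: eq_bigr => v _.
  by rewrite /term mulrBr.
have term0 u v : (forall a, d a <= d u) -> 0 <= term u v.
  move=> hu; apply: mulr_ge0; first exact: weight_ge0.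
  by rewrite subr_ge0 sin_le_quarter//; have := hu v; rewrite /d; lra.
split; first by rewrite (cE m); apply: sumr_ge0 => v _; exact: term0.
move=> c0 a; apply: (@span_root_ind (fun u => forall a, d a <= d u) m) => // u v wuv hu b.
have := cE u; rewrite c0 => /esym/eqP.
rewrite psumr_eq0 => [/allP/(_ v)|x _]; last exact: term0.
rewrite mem_index_enum => /(_ isT)/=; rewrite mulf_eq0 gt_eqF//= subr_eq0 => /eqP e.
apply: le_trans (hu b) _.
have : theta ord0 u - theta ord0 v <= theta' ord0 u - theta' ord0 v by rewrite -sin_le_quarter// e.
by rewrite /d; lra.
Qed.

(** The maximum principle in both directions gives c = 0 and shows that the phase difference attains
    both its maximum and its minimum at the root. *)
Lemma gmap_inj_mod theta theta' : acute theta -> acute theta' ->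
  gmap G theta *m P^T = gmap G theta' *m P^T ->
  forall a, theta ord0 a - theta' ord0 a = theta ord0 r - theta' ord0 r.
Proof.
move=> ac ac' E.
have [c cE] : exists c, gmap G theta - gmap G theta' = c *: const_mx 1.
  by apply: (projection_ker hP); rewrite mulmxBl E subrr.
have cE' : gmap G theta' - gmap G theta = - c *: const_mx 1.
  by rewrite -opprB cE scaleNr.
have [c0 h] := gmap_max_principle ac ac' cE.
have [c0' h'] := gmap_max_principle ac' ac cE'.
have c00 : c = 0 by apply/eqP; rewrite eq_le c0 andbT -oppr_ge0.
move=> a; have := h c00 a; have : - c = 0 by rewrite c00 oppr0.
by move=> /h'/(_ a); lra.
Qed.

Lemma acute_pin i (x : 'rV[R]_n) : (forall j, 0 < x ord0 j < pi / 2) -> acute (pin i x).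
Proof.
move=> hx a b.
have p0 : 0 < pi / 2 :> R by rewrite divr_gt0// pi_gt0.
rewrite !mxE; case: unlift => [j|]; case: unlift => [k|].
- by have /andP[? ?] := hx j; have /andP[? ?] := hx k; rewrite ltr_norml; apply/andP; split; lra.
- by have /andP[? ?] := hx j; rewrite ltr_norml; apply/andP; split; lra.
- by have /andP[? ?] := hx k; rewrite ltr_norml; apply/andP; split; lra.
- by rewrite subrr normr0.
Qed.

(** All other phases are positive, so the pinned vertex is the unique one of smallest phase, and a
    common shift cannot change which vertex that is. This separates the images for different i. *)
Lemma pgmap_inj i i' (x x' : 'rV[R]_n) :
  (forall j, 0 < x ord0 j < pi / 2) -> (forall j, 0 < x' ord0 j < pi / 2) ->
  pgmap G P i x = pgmap G P i' x' -> i = i' /\ x = x'.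
Proof.
move=> hx hx' /(gmap_inj_mod (acute_pin i hx) (acute_pin i' hx')) E.
have ii' : i = i'.
  apply/eqP; apply/negPn/negP => ne.
  have [j jE] : exists j, i' = lift i j by case: (unliftP i i') ne => [j -> _|->]; [exists j|rewrite eqxx].
  have [j' jE'] : exists j, i = lift i' j by case: (unliftP i' i) ne => [l -> _|->]; [exists l|rewrite eqxx].
  have := E i; rewrite -(E i') !pin_pin {1}jE' jE !pin_lift.
  by have /andP[? ?] := hx j; have /andP[? ?] := hx' j'; lra.
split=> //; subst i'; apply/rowP => j.
by have := E (lift i j); rewrite -(E i) !pin_lift !pin_pin; lra.
Qed.

Lemma tree_sum_acute theta : acute theta -> 0 < tree_sum G theta.
Proof.
move=> ac; have cosP a b : 0 < cos (theta ord0 a - theta ord0 b).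
  by apply: cos_gt0_pihalf; have := ac a b; rewrite ltr_norml.
have term0 (H : graph n.+1) : spanning_ditree G H ->
    0 < \prod_(e in arcs H) (w e.1 e.2 * cos (theta ord0 e.1 - theta ord0 e.2)).
  move=> [[s [[sG _] _ _ _ _]] _]; apply: prodr_gt0 => -[a b] ab; apply: mulr_gt0 => //.
  by apply: weight_gt0; exact: (fintype.subsetP sG).
rewrite /tree_sum (bigD1 T)/=; last by apply/mem_set; split => //; exists r.
apply: ltr_wpDr; last by apply: term0; split => //; exists r.
by apply: sumr_ge0 => H /andP[/set_mem hH _]; exact: ltW (term0 _ hH).
Qed.

Lemma Theta_stable_acute theta : acute theta -> @Theta_stable R n.+1 G P theta.
Proof.
move=> ac; apply: (Theta_stableP hP); first by rewrite gt_eqF// tree_sum_acute.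
move=> a b; apply: mulr_ge0; first exact: weight_ge0.
by apply: ltW; apply: cos_gt0_pihalf; have := ac a b; rewrite ltr_norml.
Qed.

End Injectivity.

(** * Riemann sums and products of cosines over a tree *)

Section RiemannSum.
Variable R : realType.
Local Notation mu := (@lebesgue_measure R).

Definition csum (t : R) : R := cos t + sin t.

Lemma continuous_csum_pow d : continuous (fun t => csum t ^+ d).
Proof.
elim: d => [|d IH] t; first by under eq_fun do rewrite expr0; exact: cvg_cst.
under eq_fun do rewrite exprS.
apply: (@cvgM R _ (nbhs t) _ csum (fun t => csum t ^+ d)); last exact: IH.
apply: (@cvgD _ _ _ (nbhs t) _ cos sin); [exact: continuous_cos|exact: continuous_sin].
Qed.

Lemma csum_le t : `|csum t| <= 2.
Proof.
apply: le_trans (ler_normD _ _) _; rewrite -[2]/(1 + 1); apply: lerD; [exact: cos_max|exact: sin_max].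
Qed.

Lemma csum_lipschitz x y : `|csum x - csum y| <= 2 * `|x - y|.
Proof.
rewrite /csum (_ : _ - _ = (cos x - cos y) + (sin x - sin y)); last by ring.
apply: le_trans (ler_normD _ _) _; rewrite mulrDl mul1r; apply: lerD; first exact: cos_sub_le.
wlog yx : x y / y <= x.
  by move=> h; have [/h//|/ltW/h] := leP y x; rewrite distrC (distrC y).
have [z _ ->] := sin_sub_mvt yx.
by rewrite normrM ler_piMl// cos_max.
Qed.

Lemma csum_pow_lipschitz d : exists2 L : R, 0 <= L &
  forall x y, `|csum x ^+ d - csum y ^+ d| <= L * `|x - y|.
Proof.
elim: d => [|d [L L0 IH]].
  by exists 0 => // x y; rewrite !expr0 subrr normr0 mul0r.
exists (2 * L + 2 ^+ d * 2) => [|x y]; first by rewrite addr_ge0 ?mulr_ge0 ?exprn_ge0.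
rewrite !exprS (_ : _ - _ = csum x * (csum x ^+ d - csum y ^+ d) +
  csum y ^+ d * (csum x - csum y)); last by ring.
apply: le_trans (ler_normD _ _) _; rewrite [leRHS]mulrDl !normrM; apply: lerD.
  by rewrite -mulrA; apply: ler_pM => //; exact: csum_le.
rewrite -mulrA; apply: ler_pM => //; last exact: csum_lipschitz.
by rewrite normrX; apply: lerXn2r; rewrite ?nnegrE//; exact: csum_le.
Qed.

Definition midpoint k (m : 'I_k) : R := (m%:R + 2^-1) * (pi / 2 / k%:R).

Definition riemann_Iint k d : R :=
  2^-1 * \sum_(m < k) pi / 2 / k%:R * csum (midpoint m) ^+ d.

Lemma Iint_primitive d : exists2 F : R -> R,
  forall x, 0 <= x <= pi / 2 -> is_derive x 1 F (csum x ^+ d) &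
  Iint R d = 2^-1 * (F (pi / 2) - F 0).
Proof.
pose f t := csum t ^+ d.
(* The integral starts at -1 so that [F] has a two-sided derivative also at 0. *)
pose F (x : R) := \int[mu]_(t in `[-1, x]) f t.
have p0 : 0 < pi / 2 :> R by rewrite divr_gt0// pi_gt0.
have FD (x : R) : -1 < x -> is_derive x 1 F (f x).
  move=> x1; have [|||dF <-] := @continuous_FTC1_closed R f (-1) x (x + 1) _ _ x1.
  - by rewrite ltrDl.
  - apply: continuous_compact_integrable; first exact: segment_compact.
    by apply: continuous_subspaceT; exact: continuous_csum_pow.
  - exact: continuous_csum_pow.
  rewrite derive1E; exact: DeriveDef.
exists F => [x /andP[x0 _]|]; first by apply: FD; lra.
rewrite /Iint /Rintegral (@continuous_FTC2 R f F)//.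
- by apply: continuous_subspaceT; exact: continuous_csum_pow.
- split=> [x|/=|/=].
  + by rewrite in_itv/= => /andP[x0 _]; have [] := FD x; first lra.
  + have [/derivable1_diffP/differentiable_continuous h _] := FD 0 (ltrN10 R).
    exact: cvg_at_right_filter.
  + have /FD[/derivable1_diffP/differentiable_continuous h _] : -1 < pi / 2 :> R by lra.
    exact: cvg_at_left_filter.
- move=> x; rewrite in_itv/= => /andP[x0 _].
  have h : -1 < x by lra.
  by have := FD x h => ?; rewrite derive1E derive_val.
Qed.

(** On each cell the mean value theorem for the primitive replaces the integral by a value of the
    integrand, and the Lipschitz bound compares it with the midpoint. With h = pi / (2k) this costs
    L h^2 for each of the k cells. *)
Lemma riemann_Iint_error d : exists2 C : R, 0 <= C &
  forall k, (0 < k)%N -> `|riemann_Iint k d - Iint R d| <= C / k%:R.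
Proof.
have [F FD ->] := Iint_primitive d; have [L L0 lip] := csum_pow_lipschitz d.
have p0 : 0 < pi / 2 :> R by rewrite divr_gt0// pi_gt0.
exists (L * (pi / 2) ^+ 2) => [|k k0]; first by rewrite mulr_ge0// exprn_ge0// ltW.
have k0' : 0 < k%:R :> R by rewrite ltr0n.
pose h : R := pi / 2 / k%:R; have h0 : 0 < h by rewrite divr_gt0.
have kh : k%:R * h = pi / 2 by rewrite /h mulrC divfK// gt_eqF.
have cell (m : 'I_k) : `|h * csum (midpoint m) ^+ d - (F (m.+1%:R * h) - F (m%:R * h))| <= L * h * h.
  have mh : m%:R * h < m.+1%:R * h by rewrite ltr_pM2r// ltr_nat.
  have m0 : 0 <= m%:R * h by rewrite mulr_ge0// ltW.
  have mk : m.+1%:R * h <= pi / 2 by rewrite -kh ler_pM2r// ler_nat.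
  have dF x : m%:R * h <= x <= m.+1%:R * h -> is_derive x 1 F (csum x ^+ d).
    by move=> /andP[x1 x2]; apply: FD; apply/andP; split; lra.
  have [||z] := @MVT R F (fun x => csum x ^+ d) _ _ mh.
  - by move=> x; rewrite in_itv/= => /andP[? ?]; apply: dF; rewrite !ltW.
  - apply: derivable_within_continuous => x; rewrite in_itv/= => hx.
    by have [] := dF x hx.
  rewrite in_itv/= => /andP[z1 z2] ->.
  rewrite -mulrBl -natr1 addrAC subrr add0r mul1r mulrC -mulrBl normrM (gtr0_norm h0).
  rewrite ler_pM2r//; apply: le_trans (lip _ _) _; rewrite ler_wpM2l//.
  rewrite -natr1 in z2.
  rewrite /midpoint -/h ler_norml; apply/andP; split; lra.
rewrite /riemann_Iint -mulrBr.
have -> : F (pi / 2) - F 0 = \sum_(m < k) (F (m.+1%:R * h) - F (m%:R * h)).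
  rewrite -(big_mkord xpredT (fun m => F (m.+1%:R * h) - F (m%:R * h))).
  by rewrite (telescope_sumr (fun m => F (m%:R * h)))// kh mul0r.
rewrite -/h -sumrB normrM ger0_norm ?invr_ge0//.
set S := \sum_(m < k) _; have : `|S| <= L * (pi / 2) ^+ 2 / k%:R.
  apply: le_trans (ler_norm_sum _ _ _) _; apply: le_trans (ler_sum _ (fun m _ => cell m)) _.
  rewrite sumr_const card_ord -[_ *+ _]mulr_natl -kh le_eqVlt; apply/orP; left; apply/eqP.
  by rewrite -/h; field; rewrite gt_eqF.
have := normr_ge0 S.
by lra.
Qed.

End RiemannSum.

Section DegreeProduct.
Variables (R : comNzRingType) (N : nat) (H : graph N).

Lemma prod_arcs_deg (F : 'I_N -> R) :
  \prod_(e in arcs H) (F e.1 * F e.2) = \prod_v F v ^+ deg H v.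
Proof.
have half (g : 'I_N * 'I_N -> 'I_N) :
    \prod_(e in arcs H) F (g e) = \prod_v F v ^+ #|[set e in arcs H | g e == v]%SET|.
  rewrite (partition_big g xpredT)//=; apply: eq_bigr => v _.
  rewrite (eq_bigr (fun=> F v)) => [|e /andP[_ /eqP ->]//].
  by rewrite prodr_const; congr (_ ^+ _); apply: eq_card => e; rewrite !inE.
rewrite big_split/= !half -big_split/=; apply: eq_bigr => v _.
by rewrite -exprD addnC.
Qed.

End DegreeProduct.

Section TreeCosines.
Variables (R : realType) (n : nat) (G : wdigraph R n.+1).
Local Notation V := 'I_n.+1.
Variables (T : graph n.+1) (r : V).
Hypothesis Tr : ditree_rooted G r T.
Hypothesis Tspan : verts T = [set: V].
Variables (i : V) (k : nat) (t : 'I_k -> R).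
Hypothesis t_rev : forall m, t (rev_ord m) = pi / 2 - t m.

Lemma prod_span_arcs (E : V * V -> R) :
  \prod_(e in arcs T) E e = \prod_(j < n) E (lift r j, outf T (lift r j)).
Proof.
have [_ -> _ _ _] := ditree_rooted_out Tr.
rewrite big_arcs_fun Tspan big_mkcond/= (bigD1_ord r)//= !inE eqxx /= mul1r.
by apply: eq_bigr => j _; rewrite !inE eq_sym neq_lift.
Qed.

Definition sdiff (u : R) : R := sin u - cos u.

Lemma cosB_csum (u v : R) : cos (u - v) = csum u * csum v / 2 + sdiff u * sdiff v / 2.
Proof. by rewrite cosB /csum /sdiff; field. Qed.

Definition phases (c : {ffun 'I_n -> 'I_k}) : 'rV[R]_n.+1 := pin i (\row_j t (c j)).

Definition reflect_at (eps : {ffun 'I_n -> bool}) (c : {ffun 'I_n -> 'I_k}) :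
    {ffun 'I_n -> 'I_k} :=
  [ffun j => if eps j then rev_ord (c j) else c j].

(** The pinned phase 0 is never reflected, so it keeps its sign. *)
Definition pin_sign (eps : {ffun 'I_n -> bool}) (a : V) : bool :=
  if unlift i a is Some j then eps j else false.

Definition arc_sign (eps : {ffun 'I_n -> bool}) : {ffun 'I_n -> bool} :=
  [ffun j => pin_sign eps (lift r j) (+) pin_sign eps (outf T (lift r j))].

(** If two families give the same signs on arcs, their difference is constant along the arcs of the
    spanning tree, hence everywhere, and it is trivial at i. The tree has n arcs, as many as there
    are free phases, so arc signs range freely. *)
Lemma arc_sign_inj : injective arc_sign.
Proof.
move=> e e' E; pose s a := pin_sign e a (+) pin_sign e' a.
have sr a : s r = s a.
  apply: (@span_outf_ind _ _ _ _ _ Tr Tspan (fun v => s v = s a) a) => // v vr <-.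
  have [j vE] : exists j, v = lift r j.
    by case: (unliftP r v) vr => [j ->|->]; [exists j|rewrite eqxx].
  have /ffunP/(_ j) := E; rewrite !ffunE -vE /s.
  by do 4!case: pin_sign.
have si : s i = false by rewrite /s /pin_sign unlift_none.
apply/ffunP => j; have : s (lift i j) = false by rewrite -sr (sr i) si.
by rewrite /s /pin_sign liftK; case: (e j); case: (e' j).
Qed.

Lemma reflect_atK eps : involutive (reflect_at eps).
Proof. by move=> c; apply/ffunP => j; rewrite !ffunE; case: (eps j); rewrite ?rev_ordK. Qed.

Lemma csum_reflect eps c a : csum (phases (reflect_at eps c) ord0 a) = csum (phases c ord0 a).
Proof.
rewrite /phases !mxE; case: unlift => // j; rewrite !mxE ffunE; case: (eps j) => //.
by rewrite t_rev /csum cosB sinB cos_pihalf sin_pihalf; ring.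
Qed.

Lemma sdiff_reflect eps c a :
  sdiff (phases (reflect_at eps c) ord0 a) = (-1) ^+ pin_sign eps a * sdiff (phases c ord0 a).
Proof.
rewrite /phases /pin_sign !mxE; case: unlift => [j|]; last by rewrite expr0 mul1r.
rewrite !mxE ffunE; case: (eps j); last by rewrite expr0 mul1r.
by rewrite t_rev /sdiff cosB sinB cos_pihalf sin_pihalf; ring.
Qed.

(* Averaging over the reflections of the grid leaves only the csum parts: since T
   is a tree, the signs on its arcs are independent. *)
Lemma sum_prod_cos_csum :
  \sum_c \prod_(e in arcs T) cos (phases c ord0 e.1 - phases c ord0 e.2) =
  \sum_c \prod_(e in arcs T) (csum (phases c ord0 e.1) * csum (phases c ord0 e.2) / 2).
Proof.
pose A c (j : 'I_n) : R := csum (phases c ord0 (lift r j)) * csum (phases c ord0 (outf T (lift r j))) / 2.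
pose B c (j : 'I_n) : R := sdiff (phases c ord0 (lift r j)) * sdiff (phases c ord0 (outf T (lift r j))) / 2.
have -> : \sum_c \prod_(e in arcs T) (csum (phases c ord0 e.1) * csum (phases c ord0 e.2) / 2) =
    \sum_c \prod_j A c j.
  by apply: eq_bigr => c _; rewrite prod_span_arcs.
transitivity (\sum_c \prod_j (A c j + B c j)).
  by apply: eq_bigr => c _; rewrite prod_span_arcs; apply: eq_bigr => j _; rewrite cosB_csum.
have refl eps c : \prod_j (A (reflect_at eps c) j + B (reflect_at eps c) j) =
    \prod_j (A c j + (-1) ^+ arc_sign eps j * B c j).
  apply: eq_bigr => j _; rewrite /A /B !csum_reflect !sdiff_reflect ffunE signr_addb.
  by congr (_ + _); ring.
have n2 : 2 ^+ n != 0 :> R by rewrite expf_neq0.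
apply: (mulfI n2).
transitivity (\sum_(eps : {ffun 'I_n -> bool}) \sum_c \prod_j (A c j + (-1) ^+ arc_sign eps j * B c j)).
  rewrite [RHS](eq_bigr (fun=> \sum_c \prod_j (A c j + B c j))) => [|eps _].
    by rewrite [RHS]sumr_const card_ffun card_bool card_ord -[RHS]mulr_natl natrX.
  rewrite [RHS](reindex_inj (inv_inj (reflect_atK eps)))/=.
  by apply: eq_bigr => c _; rewrite refl.
rewrite exchange_big/= mulr_sumr; apply: eq_bigr => c _.
rewrite -(reindex_inj arc_sign_inj (P := xpredT)
  (F := fun eta : {ffun 'I_n -> bool} => \prod_j (A c j + (-1) ^+ eta j * B c j)))/=.
rewrite -(bigA_distr_bigA (fun (j : 'I_n) (b : bool) => A c j + (-1) ^+ b * B c j))/=.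
have <- : \prod_(j < n) 2 = 2 ^+ n :> R by rewrite prodr_const card_ord.
rewrite -big_split/=.
by apply: eq_bigr => j _; rewrite big_bool /= expr0 expr1; lra.
Qed.

(** At the pinned phase [csum] is 1, so the factor of vertex i drops out. The n halves, one for each
    arc, are shared out among the n other vertices. *)
Lemma sum_prod_cos :
  \sum_(c : {ffun 'I_n -> 'I_k}) \prod_(e in arcs T)
    cos (pin i (\row_j t (c j)) ord0 e.1 - pin i (\row_j t (c j)) ord0 e.2) =
  \prod_(j < n) \sum_(m < k) 2^-1 * csum (t m) ^+ deg T (lift i j).
Proof.
rewrite [LHS]sum_prod_cos_csum bigA_distr_bigA; apply: eq_bigr => c _.
rewrite big_split/= (prod_arcs_deg _ (fun v => csum (phases c ord0 v))).
rewrite (bigD1_ord i)//= {1}/phases pin_pin /csum cos0 sin0 addr0 expr1n mul1r.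
rewrite prod_span_arcs mulrC -big_split/=; apply: eq_bigr => j _.
by rewrite /phases pin_lift mxE.
Qed.

End TreeCosines.

(** * Assembling the lower bound *)

Section LowerBound.
Variables (R : realType) (n : nat) (G : wdigraph R n.+1).
Variable P : 'M[R]_(n, n.+1).
Hypothesis hP : @orthonormal_projection R n.+1 P.
Local Notation V := 'I_n.+1.
Local Notation w := (weight G).
Local Notation mu := (@lebesgue_rV R _).
Variables (T : graph n.+1) (r : V).
Hypothesis Tr : ditree_rooted G r T.
Hypothesis Tspan : verts T = [set: V].

Lemma pi2_gt0 : 0 < pi / 2 :> R. Proof. by rewrite divr_gt0// pi_gt0. Qed.

Definition mesh (k : nat) : R := pi / 2 / k%:R.

Lemma mesh_ge0 k : 0 <= mesh k.
Proof. by rewrite divr_ge0// ltW// pi2_gt0. Qed.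

Definition center k (c : {ffun 'I_n -> 'I_k}) : 'rV[R]_n := \row_j midpoint R (c j).

Lemma midpoint_rev k (m : 'I_k) : midpoint R (rev_ord m) = pi / 2 - midpoint R m.
Proof.
have k0 : (0 < k)%N by exact: leq_ltn_trans (ltn_ord m).
rewrite /midpoint /= natrB//; field.
by rewrite pnatr_eq0 -lt0n.
Qed.

(** The factor q < 1 keeps the closed cube strictly inside its cell, hence in the open region where
    phase vectors are acute; it also makes cubes of different cells disjoint. *)
Lemma cube_center_itv k (c : {ffun 'I_n -> 'I_k}) q x : 0 < q < 1 ->
  cube (center c) (q * mesh k / 2) x -> forall j, 0 < x ord0 j < pi / 2.
Proof.
move=> /andP[q0 q1] cx j; have := cx j; rewrite mxE.
have k0 : (0 < k)%N by exact: leq_ltn_trans (ltn_ord (c j)).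
have h0 : 0 < mesh k by rewrite divr_gt0 ?pi2_gt0// ltr0n.
have kh : k%:R * mesh k = pi / 2 by rewrite /mesh mulrC divfK// pnatr_eq0 -lt0n.
rewrite /midpoint -/(mesh k) ler_norml => /andP[x1 x2].
have m0 : 0 <= (c j)%:R * mesh k by rewrite mulr_ge0// ltW.
have m1 : ((c j)%:R + 1) * mesh k <= pi / 2.
  by rewrite -kh ler_pM2r// natr1 ler_nat.
have qh : q * mesh k < mesh k by rewrite gtr_pMl.
by apply/andP; split; lra.
Qed.

Lemma cube_center_inj k (c c' : {ffun 'I_n -> 'I_k}) q x : 0 < q < 1 ->
  cube (center c) (q * mesh k / 2) x -> cube (center c') (q * mesh k / 2) x -> c = c'.
Proof.
move=> /andP[q0 q1] cx cx'; apply/ffunP => j.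
have := cx j; have := cx' j; rewrite !mxE.
have k0 : (0 < k)%N by exact: leq_ltn_trans (ltn_ord (c j)).
have h0 : 0 < mesh k by rewrite divr_gt0 ?pi2_gt0// ltr0n.
have qh : q * mesh k < mesh k by rewrite gtr_pMl.
rewrite /midpoint -/(mesh k) !ler_norml => /andP[x1 x2] /andP[y1 y2].
have lt (a b : nat) : a%:R * mesh k < (b%:R + 1) * mesh k -> (a <= b)%N.
  by rewrite ltr_pM2r// natr1 ltr_nat ltnS.
by apply/val_inj/eqP; rewrite eqn_leq; apply/andP; split; apply: lt; lra.
Qed.

Definition Vol_riemann k : R := (Num.sqrt n.+1%:R)^-1 *
  \sum_(H in ST G) graph_weight G H *
    \sum_(i < n.+1) \prod_(j < n) riemann_Iint R k (deg H (lift i j)).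

(** At acute phases every tree contributes a positive product, so the absolute value disappears and
    the determinant can be expanded tree by tree. Midpoints are symmetric about pi / 4, so the
    cosine identity applies without error. *)
Lemma sum_det_center k : \sum_(i < n.+1) \sum_(c : {ffun 'I_n -> 'I_k})
  mesh k ^+ n * `|\det (Dpgmap G P i (center c))| = Vol_riemann k.
Proof.
rewrite /Vol_riemann mulrC mulr_suml.
transitivity (\sum_(i < n.+1) \sum_(H in ST G) graph_weight G H *
    (\prod_(j < n) riemann_Iint R k (deg H (lift i j))) / Num.sqrt n.+1%:R); last first.
  rewrite exchange_big/=; apply: eq_bigr => H _.
  by rewrite mulr_sumr mulr_suml.
apply: eq_bigr => i _.
transitivity (\sum_(c : {ffun 'I_n -> 'I_k}) \sum_(H in ST G) graph_weight G H * (mesh k ^+ n * \prod_(e in arcs H)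
    cos (pin i (center c) ord0 e.1 - pin i (center c) ord0 e.2)) / Num.sqrt n.+1%:R).
  apply: eq_bigr => c _; rewrite (det_Dpgmap _ hP) ger0_norm; last first.
    apply: ltW; apply: (tree_sum_acute Tr Tspan); apply: acute_pin.
    apply: (@cube_center_itv k c 2^-1); first by apply/andP; split; lra.
    by apply: cube_center; rewrite divr_ge0// mulr_ge0// mesh_ge0.
  rewrite mulrA -mulr_suml mulr_sumr; congr (_ / _); apply: eq_bigr => H _.
  by rewrite big_split/= mulrCA.
rewrite exchange_big/=; apply: eq_bigr => H /set_mem[[s Hs] Hspan].
rewrite -mulr_suml -mulr_sumr -mulr_sumr; congr (_ * _ / _).
rewrite (sum_prod_cos Hs Hspan i (@midpoint_rev k)).
have <- : \prod_(j < n) mesh k = mesh k ^+ n by rewrite prodr_const card_ord.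
rewrite -big_split/=; apply: eq_bigr => j _.
rewrite /riemann_Iint !mulr_sumr; apply: eq_bigr => m _.
by rewrite mulrCA.
Qed.

Definition cell_image (q : R) k (p : V * {ffun 'I_n -> 'I_k}) : set 'rV[R]_n :=
  [set pgmap G P p.1 x | x in cube (center p.2) (q * mesh k / 2)]%classic.

Lemma cell_image_measurable q k p : rV_measurable (@cell_image q k p).
Proof.
apply: compact_rV_measurable; apply: continuous_compact; last exact: cube_compact.
by apply: continuous_subspaceT; exact: continuous_pgmap.
Qed.

Lemma cell_image_disjoint q k p p' : 0 < q < 1 -> p != p' ->
  (@cell_image q k p `&` @cell_image q k p' = set0)%classic.
Proof.
move=> q01 pp'; apply/seteqP; split => // _ [[x cx <-] [x' cx' e]].
have [e1 e2] := pgmap_inj hP Tr Tspan (cube_center_itv q01 cx') (cube_center_itv q01 cx) e.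
move: cx'; rewrite e2 => /(cube_center_inj q01 cx) e3.
by move/negP: pp'; apply; rewrite [p]surjective_pairing [p']surjective_pairing e1 e3.
Qed.

Lemma cell_image_sub q k p : 0 < q < 1 ->
  (@cell_image q k p `<=` [set y *m P^T | y in @Omega_stable R n.+1 G P])%classic.
Proof.
move=> q01 _ [x cx <-]; exists (gmap G (pin p.1 x)) => //.
exists (pin p.1 x) => //; apply: (Theta_stable_acute hP Tr Tspan).
by apply: acute_pin; exact: cube_center_itv cx.
Qed.

Lemma inverse_bound_ge0 (e : R) : 0 < e -> 0 <= inverse_bound G P e.
Proof.
move=> e0; have K0 := lin_const_ge0 G P; have D0 := Dbound_ge0 G P.
have D1 : 0 <= (Dbound G P + 1) ^+ n.-1 by rewrite exprn_ge0// addr_ge0.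
apply: mulr_ge0 K0; apply: mulr_ge0; first exact: ler0n.
apply: divr_ge0 (ltW e0); exact: mulr_ge0 (ler0n _ _) D1.
Qed.

(** One factor q^n comes from shrinking the cells, the other from the loss in local surjectivity. Of
    the N k^n cells those with determinant below e are dropped, and with cell volume (pi / 2k)^n
    this costs at most N (pi / 2)^n e. *)
Lemma Vol_stable_ge_riemann (q e : R) k : 0 < q < 1 -> 0 < e -> (0 < k)%N ->
  inverse_bound G P e * mesh k <= 1 - q ->
  ((q ^+ (2 * n) * Vol_riemann k - n.+1%:R * (pi / 2) ^+ n * e)%:E <=
    @Vol_stable R n.+1 G P)%E.
Proof.
move=> q01 e0 k0 hk; have /andP[q0 q1] := q01.
have k0' : 0 < k%:R :> R by rewrite ltr0n.
have h0 : 0 < mesh k by rewrite divr_gt0 ?pi2_gt0.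
pose rho := q * mesh k / 2.
have r0 : 0 < rho by rewrite /rho divr_gt0// mulr_gt0.
have qh : q * mesh k < mesh k by rewrite gtr_pMl.
have rh : rho <= mesh k by rewrite /rho; lra.
pose D (p : V * {ffun 'I_n -> 'I_k}) : R := `|\det (Dpgmap G P p.1 (center p.2))|.
pose I := [seq p <- index_enum (V * {ffun 'I_n -> 'I_k})%type | e <= D p].
apply: (@le_trans _ _ (mu (\big[setU/set0]_(p <- I) @cell_image q k p)%classic)); last first.
  apply: lebesgue_rV_mono => y; rewrite -bigcup_seq => -[p _]; exact: cell_image_sub.
rewrite lebesgue_rV_bigcup_disj; last 3 first.
- by rewrite filter_uniq// index_enum_uniq.
- by move=> p; exact: cell_image_measurable.
- by move=> p p'; exact: cell_image_disjoint.
rewrite big_filter.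
apply: (@le_trans _ _ (\sum_(p | (e <= D p)%R) ((2 * q * rho) ^+ n * D p)%:E)%E); last first.
  apply: lee_sum => p ep; apply: (@lebesgue_pgmap_cube R n G P p.1 (center p.2) rho q e) => //; first by rewrite e0.
  apply: le_trans hk; apply: ler_wpM2l => //.
  exact: inverse_bound_ge0.
rewrite sumEFin lee_fin lerBlDr -sum_det_center pair_big/=.
have -> : (2 * q * rho) ^+ n = q ^+ (2 * n) * mesh k ^+ n.
  by rewrite exprM -exprMn; congr (_ ^+ _); rewrite /rho; field.
rewrite mulr_sumr (bigID (fun p => e <= D p))/=.
apply: lerD.
  by apply: ler_sum => p _; rewrite mulrA.
apply: (@le_trans _ _ (\sum_(p : V * {ffun 'I_n -> 'I_k}) mesh k ^+ n * e)).
  rewrite big_mkcond/=; apply: ler_sum => p _; case: ifPn => [|_]; last first.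
    by rewrite mulr_ge0// ?exprn_ge0// ltW.
  rewrite -ltNge => pe; rewrite -[leRHS]mul1r; apply: ler_pM => //.
  - by rewrite exprn_ge0// ltW.
  - by rewrite mulr_ge0// exprn_ge0// ltW.
  - by rewrite exprn_ile1// ltW.
  - by apply: ler_wpM2l; rewrite ?exprn_ge0// ltW.
rewrite sumr_const card_prod card_ffun !card_ord -[_ *+ _]mulr_natl natrM natrX.
have -> : pi / 2 = k%:R * mesh k by rewrite /mesh [RHS]mulrC divfK// gt_eqF.
by move: (mesh k) => h; rewrite exprMn !mulrA.
Qed.

Lemma Vol_riemann_cvg : (Vol_riemann k @[k --> \oo] --> @Vol_lower R n.+1 G)%classic.
Proof.
have cI d : (riemann_Iint R k d @[k --> \oo] --> Iint R d)%classic.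
  have [C C0 hC] := riemann_Iint_error R d.
  apply/cvgrPdist_lt => e e0; near=> k.
  have kC : C / e < k%:R by near: k; exact: nbhs_infty_gtr.
  have k0 : 0 < k%:R :> R by apply: le_lt_trans kC; rewrite divr_ge0// ltW.
  rewrite distrC; apply: le_lt_trans (hC k _) _; first by rewrite -(ltr_nat R).
  by rewrite ltr_pdivrMr// mulrC -ltr_pdivrMr.
have -> : @Vol_lower R n.+1 G = (Num.sqrt n.+1%:R)^-1 * \sum_(H in ST G) graph_weight G H *
    \sum_(i < n.+1) \prod_(j < n) Iint R (deg H (lift i j)).
  congr (_ * _); apply: eq_bigr => H _; congr (_ * _); apply: eq_bigr => i _.
  rewrite big_mkcond (bigD1_ord i)//= eqxx mul1r.
  by apply: eq_bigr => j _; rewrite eq_sym neq_lift.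
apply: cvgM; first exact: cvg_cst.
apply: (@cvg_big _ _ +%R) => [|H _]; first exact: add_continuous.
apply: cvgM; first exact: cvg_cst.
apply: (@cvg_big _ _ +%R) => [|i _]; first exact: add_continuous.
apply: (@cvg_big R _ *%R) => [|j _]; first exact: mul_continuous.
exact: cI.
Unshelve. all: by end_near. Qed.

Lemma bernoulli_lower (d : R) m : 0 <= d <= 1 -> 1 - m%:R * d <= (1 - d) ^+ m.
Proof.
move=> /andP[d0 d1]; elim: m => [|m IH]; first by rewrite mul0r subr0 expr0.
rewrite exprS -natr1; apply: (@le_trans _ _ ((1 - d) * (1 - m%:R * d))); last first.
  by apply: ler_wpM2l => //; lra.
have : 0 <= m%:R * d * d by rewrite !mulr_ge0.
by lra.
Qed.

Lemma lee_lower_stable : ((@Vol_lower R n.+1 G)%:E <= @Vol_stable R n.+1 G P)%E.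
Proof.
set L := Vol_lower G.
(* The upper bound shows that the stable volume is finite, so the limits can be taken in R. *)
have stable_le : (@Vol_stable R n.+1 G P <= (@Vol_upper' R n.+1 G)%:E)%E.
  apply: le_trans (lee_locked_upper' G hP); apply: lebesgue_rV_mono => _ [y [theta _ <-] <-].
  by exists (gmap G theta) => //; exists theta.
have [v vE] : exists v, @Vol_stable R n.+1 G P = v%:E.
  have : (0 <= @Vol_stable R n.+1 G P)%E by exact: lebesgue_rV_ge0.
  by move: stable_le; case: Vol_stable => [v|//|//] _ _; exists v.
rewrite vE lee_fin.
have step1 q e : 0 < q < 1 -> 0 < e -> q ^+ (2 * n) * L - n.+1%:R * (pi / 2) ^+ n * e <= v.
  move=> q01 e0.
  have lim : (q ^+ (2 * n) * Vol_riemann k - n.+1%:R * (pi / 2) ^+ n * e @[k --> \oo] -->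
    q ^+ (2 * n) * L - n.+1%:R * (pi / 2) ^+ n * e)%classic.
    apply: cvgB; last exact: cvg_cst.
    by apply: cvgM; [exact: cvg_cst|exact: Vol_riemann_cvg].
  apply: (cvgr_to_le lim).
  have [m hm] : exists m, forall k, (m <= k)%N -> (0 < k)%N && (inverse_bound G P e * mesh k <= 1 - q).
    have q1 : 0 < 1 - q by case/andP: q01 => _ ?; lra.
    pose X : R := inverse_bound G P e * (pi / 2) / (1 - q).
    have X0 : 0 <= X.
      apply: divr_ge0 (ltW q1); apply: mulr_ge0 (ltW pi2_gt0); exact: inverse_bound_ge0.
    exists (Num.truncn X).+1 => k mk.
    have kX : X < k%:R by apply: lt_le_trans (truncnS_gt X) _; rewrite ler_nat.
    have k0 : 0 < k%:R :> R by exact: le_lt_trans X0 kX.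
    rewrite -(ltr_nat R) k0 /= /mesh mulrA ler_pdivrMr//.
    by rewrite mulrC [leRHS]mulrC -ler_pdivrMr ?(ltW kX)// mulrC ltW.
  exists m => // k /= mk; have /andP[k0 hk] := hm k mk.
  by rewrite -lee_fin -vE; exact: Vol_stable_ge_riemann.
have step2 q : 0 < q < 1 -> q ^+ (2 * n) * L <= v.
  move=> q01; apply/ler_addgt0Pr => e e0.
  have C0 : 0 < n.+1%:R * (pi / 2) ^+ n :> R by rewrite mulr_gt0// exprn_gt0// pi2_gt0.
  have := step1 q (e / (n.+1%:R * (pi / 2) ^+ n)) q01; rewrite divr_gt0// => /(_ isT).
  by rewrite [_ * (e / _)]mulrC divfK ?gt_eqF// lerBlDr.
have [L0|L0] := ltP L 0.
  apply: le_trans (ltW L0) _; rewrite -lee_fin -vE; exact: lebesgue_rV_ge0.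
apply/ler_addgt0Pr => e e0.
(* With d = e / C this makes d < 1 and 2 n d L <= e, so by the Bernoulli inequality q = 1 - d loses
   at most e. *)
pose C : R := (2 * n)%:R * L + e + 1.
have nL : 0 <= (2 * n)%:R * L by rewrite mulr_ge0.
have C0 : 0 < C by rewrite /C; lra.
have dC : e / C * C = e by rewrite divfK// gt_eqF.
have d0 : 0 < e / C by rewrite divr_gt0.
have d1 : e / C < 1 by rewrite ltr_pdivrMr// /C; lra.
have := step2 (1 - e / C); rewrite subr_gt0 d1 gtrBl d0 => /(_ isT).
have d01 : 0 <= e / C <= 1 by rewrite !ltW.
have := ler_wpM2r L0 (bernoulli_lower (2 * n) d01).
rewrite mulrBl mul1r => h1 h2.
have : (2 * n)%:R * (e / C) * L <= e.
  rewrite -{2}dC mulrAC [leLHS]mulrC ler_wpM2l ?(ltW d0)//.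
  by rewrite /C; lra.
by lra.
Qed.

End LowerBound.

Theorem theorem1 (R : realType) (N : nat) (G : wdigraph R N)
    (P : 'M[R]_(N.-1, N)) (hP : orthonormal_projection P)
    (hG : exists T : graph N, spanning_ditree G T) :
  [/\ ((Vol_lower G)%:E <= Vol_stable G P)%E,
      (Vol_stable G P <= Vol_locked G P)%E &
      (Vol_locked G P <= (Num.min (Vol_upper G) (Vol_upper' G))%:E)%E].
Proof.
case: hG => T [[r Tr] Tspan].
(* The root is a vertex, so N = 0 cannot occur. *)
case: N => [|n] in G P hP T r Tr Tspan *; first by case: r {Tr}.
split; first exact: (lee_lower_stable hP Tr Tspan).
  by apply: lebesgue_rV_mono => _ [_ [theta _ <-] <-]; exists (gmap G theta) => //; exists theta.
rewrite /Num.min; case: ifP => _; first exact: lee_locked_upper.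
exact: lee_locked_upper'.
Qed.
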